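(* Let $K$ and $K'$ be regular Cantor sets (in the real line) with Hausdorff dimensions $d$ and $d'$, respectively, such that $K$ is of class $C^2$ and non essentially affine. Then, for every real $s\neq 0$, $$HD(K+sK')=\overline{\dim}(K+sK')=\min\{1,\,HD(K)+HD(K')\},$$ where $HD$ denotes Hausdorff dimension, $\overline{\dim}$ denotes upper box dimension, and $K+sK'=\{x+sy : x\in K,\ y\in K'\}$.
   Context: Regular Cantor sets. Let $\mathbf{A}$ be a finite alphabet and $\Sigma\subset\mathbf{A}^{\mathbb{Z}}$ a subshift of finite type defined by a transition set $\mathcal{B}\subset\mathbf{A}^2$ (the bi-infinite sequences all of whose consecutive pairs lie in $\mathcal{B}$); $\Sigma$ is always assumed to be mixing and to use all letters of $\mathbf{A}$. Let $I(a)$, $a\in\mathbf{A}$, be pairwise disjoint compact nondegenerate intervals of the real line (each identified affinely with $[0,1]\times\{a\}$). Let $r\in(1,+\infty]$. A $C^r$ map $g$ is expanding of type $\Sigma$ if its domain is a finite disjoint union $\bigsqcup_{(a_0,a_1)\in\mathcal{B}}I(a_0,a_1)$, where each $I(a_0,a_1)$ is a compact subinterval of $I(a_0)$, and if for each $(a_0,a_1)\in\mathcal{B}$ the restriction of $g$ to $I(a_0,a_1)$ is a $C^r$-diffeomorphism onto $I(a_1)$ with $|Dg(t)|>1$ for every $t\in I(a_0,a_1)$ (the derivative being computed after the affine identifications of the $I(a)$ with $[0,1]\times\{a\}$). The regular Cantor set (of class $C^r$) defined by $g$ is $$K=\bigcap_{n\ge 0}g^{-n}\Big(\bigsqcup_{(a_0,a_1)\in\mathcal{B}}I(a_0,a_1)\Big).$$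 A regular Cantor set without specified class is one of class $C^r$ for some $r>1$. $K'$ is defined in the same way by an expanding map $g'$ with its own alphabet and subshift. A regular Cantor set $K$ of class $C^2$ is non essentially affine if the expanding map $g$ which defines it cannot be $C^2$-conjugated to a map whose second derivative is identically zero on the (corresponding) Cantor set; that is, there is no $C^2$ change of coordinates $\varphi$ such that $(\varphi\circ g\circ\varphi^{-1})''=0$ at all points of $\varphi(K)$. *)

(* Defs.v *)
From HB Require Import structures.
From mathcomp Require Import all_boot all_order all_algebra.
From mathcomp Require Import all_classical all_reals all_analysis.

Set Implicit Arguments.
Unset Strict Implicit.
Unset Printing Implicit Defensive.
Import Order.TTheory GRing.Theory Num.Theory.
Import numFieldNormedType.Exports.
Local Open Scope classical_set_scope.
Local Open Scope ring_scope.

Definition bi_seq (A : finType) : topologicalType :=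
  prod_topology (fun _ : int => discrete_topology A).

Definition subshift (A : finType) (B : {set A * A}) : set (bi_seq A) :=
  [set x | forall i : int, (x i, x (i + 1)) \in B].

Definition seq_shift (A : finType) (x : bi_seq A) : bi_seq A := fun i => x (i + 1).

(* Topological mixing of the shift on S; the relatively open subsets of S are
   the sets S `&` U with U open in the product topology. *)
Definition mixing (A : finType) (S : set (bi_seq A)) : Prop :=
  forall U V : set (bi_seq A), open U -> open V ->
    S `&` U !=set0 -> S `&` V !=set0 ->
    exists N, forall n, (N <= n)%N ->
      (iter n (@seq_shift A) @` (S `&` U)) `&` (S `&` V) !=set0.

Section Calculus.
Variable R : realType.
Implicit Types (D E : set R) (f h : R -> R).

Definition quotient f (x y : R) : R := (f y - f x) / (y - x).

(* Derivatives are relative to the domain D (one-sided at the end points of an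
   interval); they are meaningful only at points of D that are not isolated in
   D. Values of f outside D are ignored. *)
Definition derivable_on D f : Prop :=
  forall x, D x -> cvg (quotient f x @ within D x^').

Definition derive_on D f : R -> R :=
  fun x => lim (quotient f x @ within D x^').

Definition derive_n_on D (n : nat) f : R -> R := iter n (derive_on D) f.

Definition Cn_on D (n : nat) f : Prop :=
  (forall k, (k < n)%N -> derivable_on D (derive_n_on D k f)) /\
  (forall k, (k <= n)%N -> {within D, continuous (derive_n_on D k f)}).

(* For non-integer r = n + alpha with 0 < alpha < 1, class C^r means C^n with
   an alpha-Hoelder n-th derivative (used only for compact D). *)
Definition Cr_on D (r : \bar R) f : Prop :=
  match r with
  | r0%:E => let n := Num.truncn r0 in
      Cn_on D n f /\
      (n%:R < r0 -> exists C : R, forall x y, D x -> D y ->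
        `|derive_n_on D n f x - derive_n_on D n f y|
          <= C * `|x - y| `^ (r0 - n%:R))
  | +oo%E => forall n, Cn_on D n f
  | -oo%E => False
  end.

(* f is a C^r-diffeomorphism of D onto E with inverse h. *)
Definition Cr_diffeo (r : \bar R) D E f h : Prop :=
  [/\ f @` D `<=` E, h @` E `<=` D,
      (forall x, D x -> h (f x) = x), (forall y, E y -> f (h y) = y)
    & Cr_on D r f /\ Cr_on E r h].

End Calculus.

Record expanding_map (R : realType) (r : \bar R) := ExpandingMap {
  alphabet : finType;
  transitions : {set alphabet * alphabet};
  alphabet_nonempty : (0 < #|alphabet|)%N;
  subshift_mixing : mixing (subshift transitions);
  all_letters_used : forall a : alphabet,
    exists2 x, subshift transitions x & exists i, x i = a;
  (* I(a) = [lo a, hi a] *)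
  lo : alphabet -> R;
  hi : alphabet -> R;
  lo_lt_hi : forall a, lo a < hi a;
  intervals_disjoint :
    trivIset setT (fun a => [set` `[lo a, hi a]] : set R);
  (* I(a, b) = [lo2 (a, b), hi2 (a, b)], relevant for (a, b) in transitions *)
  lo2 : alphabet * alphabet -> R;
  hi2 : alphabet * alphabet -> R;
  subintervals : forall p, p \in transitions ->
    [set` `[lo2 p, hi2 p]] `<=` [set` `[lo p.1, hi p.1]];
  subintervals_disjoint :
    trivIset [set p | p \in transitions]
      (fun p => [set` `[lo2 p, hi2 p]] : set R);
  (* only the values on the union of the I(a, b) matter *)
  emap : R -> R;
  emap_diffeo : forall p, p \in transitions ->
    exists h, Cr_diffeo r [set` `[lo2 p, hi2 p]] [set` `[lo p.2, hi p.2]]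
      emap h;
  (* the derivative in the affine coordinates identifying each I(a) with
     [0, 1] is Dg multiplied by |I(p.1)| / |I(p.2)| *)
  emap_expanding : forall p, p \in transitions ->
    forall t, t \in `[lo2 p, hi2 p] ->
      1 < `|derive_on [set` `[lo2 p, hi2 p]] emap t|
            * ((hi p.1 - lo p.1) / (hi p.2 - lo p.2))
}.

Definition edom (R : realType) (r : \bar R) (g : expanding_map r) : set R :=
  \bigcup_(p in [set p | p \in transitions g]) [set` `[lo2 p, hi2 p]].

Definition cantor_set (R : realType) (r : \bar R) (g : expanding_map r) :
    set R :=
  \bigcap_n (iter n (emap g) @^-1` edom g).

(* A change of coordinates is a C^2-diffeomorphism phi of the line, with inverse
   psi; the second derivative is taken on the domain phi(edom g) of
   phi \o g \o psi. *)
Definition non_essentially_affine (R : realType) (r : \bar R)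
    (g : expanding_map r) : Prop :=
  ~ exists phi psi : R -> R,
      Cr_diffeo 2%:E setT setT phi psi /\
      forall x, (phi @` cantor_set g) x ->
        derive_n_on (phi @` edom g) 2 (phi \o emap g \o psi) x = 0.

Section Dimensions.
Variable R : realType.
Implicit Types E : set R.
Local Open Scope ereal_scope.

Definition diam E : \bar R :=
  ereal_sup [set `|xy.1 - xy.2|%:E | xy in E `*` E].

(* diam E ^ s, with the conventions 0 ^ 0 = 1 for nonempty E and 0 for the
   empty set, whatever s. *)
Definition hausdorff_gauge (s : R) E : \bar R :=
  if `[< E = set0 >] then 0 else diam E `^ s.

Definition hausdorff_premeasure (s delta : R) E : \bar R :=
  ereal_inf [set \sum_(0 <= i <oo) hausdorff_gauge s (U i) | U in
    [set U : (set R)^nat |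
      (forall i, diam (U i) <= delta%:E) /\ E `<=` \bigcup_i U i]].

Definition hausdorff_measure (s : R) E : \bar R :=
  ereal_sup [set hausdorff_premeasure s delta E | delta in
    [set delta : R | (0 < delta)%R]].

Definition hausdorff_dim E : \bar R :=
  ereal_inf [set s%:E | s in
    [set s : R | (0 <= s)%R /\ hausdorff_measure s E = 0]].

(* least number of balls of radius e covering E; +oo if there is no finite
   cover *)
Definition covering_number E (e : R) : \bar R :=
  ereal_inf [set n%:R%:E | n in
    [set n : nat | exists c : 'I_n -> R, E `<=` \bigcup_i ball (c i) e]].

Definition upper_box_dim E : \bar R :=
  limf_esup (fun e : R => lne (covering_number E e) * ((ln e^-1)^-1)%:E) 0^'+.

End Dimensions.

(* K + s K' *)
Definition sum_scaled (R : realType) (K : set R) (s : R) (K' : set R) : set R :=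
  [set x + s * y | x in K & y in K'].

(* Main.v *)
Require Import Defs.
From mathcomp Require Import all_boot all_order all_algebra.
From mathcomp Require Import all_classical all_reals all_analysis.
From mathcomp Require Import ring lra zify.
Set Implicit Arguments.
Unset Strict Implicit.
Unset Printing Implicit Defensive.
Import Order.TTheory GRing.Theory Num.Theory.
Import numFieldNormedType.Exports.
Local Open Scope classical_set_scope.
Local Open Scope ring_scope.

(** Near a letter, [K] is described by a semigroup of increasing contractions of
    an interval with bounded distortion, and the pieces of [K + s K'] by pairs
    [(f, f')] of contractions of comparable sizes. The box dimensions provide
    trees with [N] and [N'] branches of ratio [1 / q], where [N N' <= q] is close
    to [q ^ (d + d')]. By Marstrand's transversality, averaged over a grid of
    slopes, there is a slope [tau] for which, in most pairs of long words, few
    other pairs overlap at almost all levels; hence almost [(N N') ^ n] of the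
    intervals of [X + tau Y] are pairwise disjoint. Since [K] is not essentially
    affine, there are words [A], [B] whose ratio of sizes is uniformly close to,
    and bounded away from, [1]; replacing [A] by [B] brings any pair [(f, f')] to
    the slope [tau] at a bounded cost. Iteration yields a tree of disjoint
    intervals meeting [K + s K'], hence the lower bound for the Hausdorff
    dimension. The words [A] and [B] differ by the exchange of two pasts of the
    same letter: if such exchanges had no effect, the limits of the
    log-derivatives along backward orbits would integrate to a [C^2] coordinate
    in which the second derivative of [g] vanishes on [K]. *)

(** * Box dimension and Hausdorff dimension *)

(** Transversality controls overlaps only for typical slopes, whereas the slopes of the pairs inside
    [K + s K'] are imposed by [s] and by the sizes of [f] and [f']. One slope [tau] is therefore
    fixed and every pair is brought to it. Two facts make this uniform. First, on the image of a
    small branch [u] every [f] is affine up to a factor [1 + q ^- m], so overlaps are counted once,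
    for the reference pair [(u, u')], and the count serves all [(f, f')] of slope close to [tau].
    Secondly, the loss [K0] caused by the adjustment does not depend on the number [h * M] of blocks
    in a word: each round of [h] blocks gains a factor 2 over the exponent [e], and [M] is taken so
    large that [2 ^ M] pays for [K0]. Transversality costs a factor linear in [m] per block,
    negligible against a gain exponential in [m]; it needs [N * N' <= q], hence the two exponents
    are first lowered until [d + d' < 1]. The [C^2] regularity of [K] enters only through the change
    of coordinates; everything else uses Hoelder log-derivatives. *)

Section BoxDimension.
Variable R : realType.
Implicit Types (E F : set R) (n : nat).

Definition ball_cover E (e : R) n : Prop :=
  exists c : 'I_n -> R, E `<=` \bigcup_i ball (c i) e.

Lemma covering_number_le E e n : ball_cover E e n ->
  (covering_number E e <= n%:R%:E)%E.
Proof. by move=> h; apply: ereal_inf_lbound; exists n. Qed.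

Lemma covering_number_ge0 E e : (0 <= covering_number E e)%E.
Proof. by apply: le_ereal_inf_tmp => _ [n _ <-]; rewrite lee_fin. Qed.

Lemma upper_box_dim_le E (d : R) :
  (exists2 e0 : R, 0 < e0 & forall e, 0 < e -> e < e0 ->
     exists2 n, ball_cover E e n & n%:R <= e^-1 `^ d) ->
  (upper_box_dim E <= d%:E)%E.
Proof.
move=> [e0 e0_gt0 H].
(* Scales are kept below 1, where [ln e^-1] is positive and division by it preserves
   inequalities. *)
apply: ge_ereal_inf; exists (ereal_sup [set (lne (covering_number E e) * ((ln e^-1)^-1)%:E)%E | e in [set e : R | 0 < e < Num.min e0 1]]).
  exists [set e : R | 0 < e < Num.min e0 1] => //.
  have m0 : 0 < Num.min e0 1 :> R by rewrite lt_min e0_gt0 ltr01.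
  near=> e; apply/andP; split; first by near: e; exact: nbhs_right_gt.
  by near: e; exact: nbhs_right_lt.
apply: ge_ereal_sup => _ [e /= He <-]; move: He => /andP[e_gt0]; rewrite lt_min => /andP[ee0 e1].
have [n cov lecov] := H e e_gt0 ee0.
have L0 : 0 < exp.ln e^-1 by rewrite ln_gt0// invf_gt1.
have P0 : 0 < e^-1 `^ d by rewrite powR_gt0 ?invr_gt0.
have h : (lne (covering_number E e) <= (d * exp.ln e^-1)%:E)%E.
  rewrite -ln_powR -lne_EFin//.
  rewrite lee_lne ?in_itv/= ?leey ?covering_number_ge0 ?lee_fin ?(ltW P0)//.
  by apply: le_trans (covering_number_le cov) _; rewrite lee_fin.
apply: le_trans (lee_wpmul2r _ h) _; first by rewrite lee_fin invr_ge0 ltW.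
by rewrite -EFinM mulfK ?lt0r_neq0.
Unshelve. all: by end_near. Qed.

Lemma upper_box_dim_lt E (d : R) : (upper_box_dim E < d%:E)%E ->
  exists2 e0 : R, 0 < e0 & forall e, 0 < e -> e < e0 ->
     exists2 n, ball_cover E e n & n%:R <= e^-1 `^ d.
Proof.
move=> /ereal_inf_lt [_ [V V0 <-] sV].
have : \forall e \near 0^'+, V e by exact: V0.
rewrite near_withinE => /nbhs_ballP [e0 /= e0_gt0 H].
exists (Num.min e0 1); first by rewrite lt_min e0_gt0 ltr01.
move=> e e_gt0; rewrite lt_min => /andP[ee0 e1].
have Ve : V e by apply: H => //; rewrite /ball/= sub0r normrN gtr0_norm.
have L0 : 0 < ln e^-1 by rewrite ln_gt0// invf_gt1.
have P0 : 0 < e^-1 `^ d by rewrite powR_gt0 ?invr_gt0.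
have h1 : (lne (covering_number E e) * ((ln e^-1)^-1)%:E < d%:E)%E.
  by apply: le_lt_trans sV; apply: ereal_sup_ubound; exists e.
have h2 : (lne (covering_number E e) < (d * ln e^-1)%:E)%E.
  rewrite -[X in (X < _)%E]mule1 -[in X in (X < _)%E](@divff _ (ln e^-1)) ?lt0r_neq0//.
  by rewrite mulrC EFinM muleA EFinM lte_pmul2r// lte_fin.
have h3 : (covering_number E e < (e^-1 `^ d)%:E)%E.
  move: h2; rewrite -ln_powR -lne_EFin//.
  rewrite lte_lne ?in_itv/= ?leey ?covering_number_ge0 ?lee_fin ?(ltW P0)//.
move/ereal_inf_lt: h3 => [_ [n cov <-]]; rewrite lte_fin => /ltW h3.
by exists n.
Qed.

(** For a negative exponent and a scale below 1 the permitted number of balls is less than 1, and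
    zero balls cannot cover a nonempty set. *)
Lemma upper_box_dim_ge0 E : E !=set0 -> (0 <= upper_box_dim E)%E.
Proof.
move=> [x Ex]; rewrite leNgt; apply/negP => H.
have [d dlt d0] : exists2 d : R, (upper_box_dim E < d%:E)%E & d < 0.
  case: (upper_box_dim E) H => [r||] //.
    by rewrite lte_fin => r0; exists (r / 2); rewrite ?lte_fin; lra.
  by move=> _; exists (-1); rewrite ?ltNyr//; lra.
have [e0 e0_gt0 /(_ (Num.min (e0 / 2) 2^-1))] := upper_box_dim_lt dlt.
set e := Num.min _ _.
have e_gt0 : 0 < e by rewrite lt_min; apply/andP; split; lra.
have e1 : e < 1 by rewrite gt_min; apply/orP; right; lra.
move=> /(_ e_gt0) [|[|n] [c cov]].
- by rewrite gt_min; apply/orP; left; lra.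
- by have [] := cov x Ex => -[].
have L0 : 0 < ln e^-1 by rewrite ln_gt0// invf_gt1.
apply/negP; rewrite -ltNge /powR gt_eqF ?invr_gt0//.
apply: (@lt_le_trans _ _ 1); last by rewrite ler1n.
by rewrite expR_lt1 nmulr_rlt0.
Qed.

End BoxDimension.

Section PowerEstimates.
Variable R : realType.

Lemma powRD_gt0 (x a b : R) : 0 < x -> x `^ (a + b) = x `^ a * x `^ b.
Proof. by move=> x0; rewrite powRD// (gt_eqF x0) /= implybT. Qed.

(** Absorbs constants into an arbitrarily small increase of an exponent. *)
Lemma powR_inv_large (C a : R) : 0 < a ->
  exists2 e0 : R, 0 < e0 & forall e, 0 < e -> e < e0 -> C <= e^-1 `^ a.
Proof.
move=> a0; pose B := 1 + `|C|.
have B0 : 0 < B by rewrite /B ltr_pwDl// normr_ge0.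
exists (B `^ a^-1)^-1; first by rewrite invr_gt0 powR_gt0.
move=> e e0 eB.
apply: (@le_trans _ _ B); first by rewrite /B; have := ler_norm C; lra.
rewrite /powR gt_eqF ?invr_gt0// -{1}(lnK B0) ler_expR lnV ?posrE//.
have : ln e < - (a^-1 * ln B).
  by rewrite -ln_powR -lnV ?posrE ?powR_gt0// ltr_ln ?posrE ?invr_gt0 ?powR_gt0.
rewrite -(ltr_pM2l a0) mulrN mulrA divff ?gt_eqF// mul1r => h.
by rewrite mulrN lerNr ltW.
Qed.

End PowerEstimates.

Section BoxDimensionBounds.
Variable R : realType.
Implicit Types (E F : set R) (n : nat).

Lemma ball_cover_card E (T : finType) (c : T -> R) (e : R) :
  E `<=` \bigcup_t ball (c t) e -> ball_cover E e #|T|.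
Proof.
move=> H; exists (c \o enum_val) => x /H[t _ ct].
by exists (enum_rank t) => //=; rewrite enum_rankK.
Qed.

Lemma ball_cover_sum_scaled (K K' : set R) (s e : R) n n' :
  s != 0 -> 0 < e ->
  ball_cover K (e / 2) n -> ball_cover K' (e / (2 * `|s|)) n' ->
  ball_cover (sum_scaled K s K') e (n * n').
Proof.
move=> s0 e0 [c Hc] [c' Hc'].
have -> : (n * n')%N = #|{: 'I_n * 'I_n'}| by rewrite card_prod !card_ord.
apply: (@ball_cover_card _ _ (fun i => c i.1 + s * c' i.2)) => _ [x Kx [y Ky <-]].
have [i _ Hi] := Hc x Kx; have [j _ Hj] := Hc' y Ky.
exists (i, j) => //; move: Hi Hj; rewrite /ball/= => Hi Hj.
have s1 : 0 < `|s| by rewrite normr_gt0.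
have -> : c i + s * c' j - (x + s * y) = (c i - x) + s * (c' j - y) by ring.
apply: le_lt_trans (ler_normD _ _) _; rewrite normrM.
have : `|s| * `|c' j - y| < `|s| * (e / (2 * `|s|)) by rewrite ltr_pM2l.
have -> : `|s| * (e / (2 * `|s|)) = e / 2 by field; rewrite gt_eqF.
lra.
Qed.

Lemma upper_box_dim_sum_scaled (K K' : set R) (s d d' : R) : s != 0 ->
  (upper_box_dim K < d%:E)%E -> (upper_box_dim K' < d'%:E)%E ->
  (upper_box_dim (sum_scaled K s K') <= (d + d')%:E)%E.
Proof.
move=> s0 /upper_box_dim_lt[e1 e1_gt0 H1] /upper_box_dim_lt[e2 e2_gt0 H2].
apply/lee_addgt0Pr => eps eps0; rewrite -EFinD.
have s1 : 0 < `|s| by rewrite normr_gt0.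
have [e3 e3_gt0 H3] := powR_inv_large (2 `^ d * (2 * `|s|) `^ d') eps0.
apply: upper_box_dim_le.
exists (Num.min (Num.min e1 (e2 * `|s|)) e3).
  by rewrite !lt_min e1_gt0 e3_gt0 mulr_gt0.
move=> e e0; rewrite !lt_min => /andP[/andP[ee1 ee2] ee3].
have [||n cn ln] := H1 (e / 2); [lra|lra|].
have [||n' cn' ln'] := H2 (e / (2 * `|s|)).
- by rewrite divr_gt0// mulr_gt0.
- by rewrite ltr_pdivrMr ?mulr_gt0//; nra.
exists (n * n')%N; first exact: ball_cover_sum_scaled.
rewrite natrM.
apply: le_trans (ler_pM _ _ ln ln') _ => //.
have -> : (e / 2)^-1 = e^-1 * 2 by rewrite invfM invrK.
have -> : (e / (2 * `|s|))^-1 = e^-1 * (2 * `|s|) by rewrite invfM invrK.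
have s2 : 0 <= 2 * `|s| by lra.
rewrite powRM ?invr_ge0 ?(ltW e0)// powRM ?invr_ge0 ?(ltW e0)//.
have -> : (d + d' + eps) = (d + (d' + eps)) by ring.
rewrite powRD_gt0 ?invr_gt0// powRD_gt0 ?invr_gt0//.
have P1 : 0 < e^-1 `^ d by rewrite powR_gt0 ?invr_gt0.
have P2 : 0 < e^-1 `^ d' by rewrite powR_gt0 ?invr_gt0.
have := H3 e e0 ee3.
set X := e^-1 `^ d in P1 *; set Y := e^-1 `^ d' in P2 *.
set A := 2 `^ d; set B := (2 * `|s|) `^ d'; set Z := e^-1 `^ eps => hZ.
have -> : X * A * (Y * B) = X * Y * (A * B) by ring.
by rewrite [leRHS]mulrA ler_wpM2l// mulr_ge0// ltW.
Qed.

Lemma upper_box_dim_le1 E (a b : R) : E `<=` `[a, b] ->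
  (upper_box_dim E <= 1)%E.
Proof.
move=> Eab; apply/lee_addgt0Pr => eps eps0; rewrite -EFinD.
have [e3 e3_gt0 H3] := powR_inv_large (`|b - a| + 1) eps0.
apply: upper_box_dim_le; exists (Num.min 1 e3); first by rewrite lt_min ltr01.
move=> e e0; rewrite lt_min => /andP[e1 ee3].
pose n := (Num.truncn (`|b - a| / e)).+1.
have D0 : 0 <= `|b - a| / e by rewrite divr_ge0 ?normr_ge0 ?ltW.
exists n.
  exists (fun i => a + i%:R * e) => x /Eab /=; rewrite in_itv/= => /andP[ax xb].
  have X0 : 0 <= (x - a) / e by rewrite divr_ge0 ?subr_ge0// ltW.
  have /andP[t1 t2] := truncn_itv X0.
  have hn : (Num.truncn ((x - a) / e) < n)%N.
    rewrite ltnS; apply: le_truncn; rewrite ler_pM2r ?invr_gt0//.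
    by rewrite (le_trans _ (ler_norm _))// lerD2r.
  exists (Ordinal hn) => //=; rewrite /ball/=.
  rewrite ler_pdivlMr// in t1; rewrite ltr_pdivrMr// in t2.
  move: t1 t2; rewrite -natr1; set t := _%:R; rewrite mulrDl mul1r => t1 t2.
  by rewrite ltr_norml; apply/andP; split; lra.
have /andP[t1 t2] := truncn_itv D0.
rewrite /n -natr1 powRD_gt0 ?invr_gt0//.
rewrite powRr1 ?invr_ge0 ?(ltW e0)//.
have := H3 e e0 ee3.
set X := e^-1 `^ eps => hX.
have ei : 1 <= e^-1 by rewrite invf_ge1// ltW.
apply: (@le_trans _ _ (e^-1 * (`|b - a| + 1))); last by rewrite ler_pM2l ?invr_gt0.
lra.
Qed.

Lemma diam_ball (x e : R) : (diam (ball x e) <= (2 * e)%:E)%E.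
Proof.
apply: ge_ereal_sup => _ [[y z] [/= Hy Hz] <-]; rewrite lee_fin.
move: Hy Hz; rewrite /ball/= !ltr_norml ler_norml => /andP[? ?] /andP[? ?].
by apply/andP; split; lra.
Qed.

Lemma hausdorff_gauge_ge0 (s : R) E : (0 <= hausdorff_gauge s E)%E.
Proof. by rewrite /hausdorff_gauge; case: ifP => // _; exact: poweR_ge0. Qed.

Lemma hausdorff_premeasure_ge0 (s del : R) E :
  (0 <= hausdorff_premeasure s del E)%E.
Proof.
apply: le_ereal_inf_tmp => _ [U _ <-]; apply: nneseries_ge0 => n _ _.
exact: hausdorff_gauge_ge0.
Qed.

(** Take [d < s] strictly between the two dimensions: [e ^- d] balls of radius [e] have total gauge
    at most [2 ^ s * e ^ (s - d)], which tends to 0, so the [s]-measure vanishes. *)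
Lemma hausdorff_dim_le_upper_box_dim E : E !=set0 ->
  (hausdorff_dim E <= upper_box_dim E)%E.
Proof.
move=> E0; rewrite leNgt; apply/negP => lt_dim.
have ubd0 := upper_box_dim_ge0 E0.
have [d dlt1 dlt2] : exists2 d : R, (upper_box_dim E < d%:E)%E &
    (d%:E < hausdorff_dim E)%E.
  case: (upper_box_dim E) ubd0 lt_dim => [r _|_|//]; last by rewrite ltNge leey.
  case: (hausdorff_dim E) => [r'||] //.
    by rewrite lte_fin => rr; exists ((r + r') / 2); rewrite lte_fin; lra.
  by move=> _; exists (r + 1); rewrite ?ltry// lte_fin; lra.
have [s sd slt2] : exists2 s : R, d < s & (s%:E < hausdorff_dim E)%E.
  case: (hausdorff_dim E) dlt2 => [r'||] //.
    by rewrite lte_fin => rr; exists ((d + r') / 2); rewrite ?lte_fin; lra.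
  by move=> _; exists (d + 1); rewrite ?ltry//; lra.
have d0 : 0 < d by rewrite -lte_fin; apply: le_lt_trans dlt1.
move: slt2; rewrite ltNge => /negP; apply.
apply: ereal_inf_lbound; exists s => //; split; first lra.
apply/eqP; rewrite eq_le; apply/andP; split; last first.
  apply: le_ereal_sup_tmp; exists (hausdorff_premeasure s 1 E).
    by exists 1 => //=.
  exact: hausdorff_premeasure_ge0.
apply: ge_ereal_sup => _ [del /= del0 <-].
apply/lee_addgt0Pr => eta eta0; rewrite add0e.
have [e1 e1_gt0 H1] := upper_box_dim_lt dlt1.
have sd0 : 0 < s - d by lra.
have [e3 e3_gt0 H3] := powR_inv_large (2 `^ s / eta) sd0.
pose m := Num.min (Num.min e1 (del / 2)) e3.
have m0 : 0 < m by rewrite !lt_min e1_gt0 e3_gt0; lra.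
pose e := m / 2.
have e0 : 0 < e by rewrite /e; lra.
have : e < m by rewrite /e; lra.
rewrite !lt_min => /andP[/andP[ee1 ee2] ee3].
have [n [c cov] ln] := H1 e e0 ee1.
(* The finite cover is continued by empty sets, whose gauge is 0 by convention. *)
pose U (i : nat) : set R :=
  if insub i is Some j then ball (c (j : 'I_n)) e else set0.
apply: ge_ereal_inf; exists (\sum_(0 <= i <oo) hausdorff_gauge s (U i))%E.
  exists U => //; split=> [i|x Ex]; last first.
    by have [i _ Hi] := cov x Ex; exists i => //; rewrite /U valK.
  rewrite /U; case: insubP => [j _ _|_].
    by apply: le_trans (diam_ball _ _) _; rewrite lee_fin; lra.
  apply: ge_ereal_sup => _ [[y z] [/= []]].
have P0 : 0 <= 2 * e by lra.
have gU i : (hausdorff_gauge s (U i) <= ((2 * e) `^ s)%:E)%E.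
  rewrite /hausdorff_gauge; case: ifP => [_|/asboolPn U0]; first by rewrite lee_fin powR_ge0.
  move: U0; rewrite /U; case: insubP => [j _ _|//] _.
  rewrite -poweR_EFin; apply: gt0_ler_poweR; rewrite ?in_itv/= ?leey ?andbT ?lee_fin//; [lra| |exact: diam_ball].
  apply: le_ereal_sup_tmp; exists 0%E => //; exists (c j, c j); last by rewrite subrr normr0.
  by split; exact: ballxx.
rewrite (@nneseries_split _ _ 0 n) ?add0n; last by move=> k _; exact: hausdorff_gauge_ge0.
rewrite [X in (_ + X)%E]eseries0 ?adde0; last first.
  move=> i ni _; rewrite /U insubF; last by rewrite ltnNge ni.
  by rewrite /hausdorff_gauge; case: ifPn => // /asboolPn.
apply: (@le_trans _ _ (\sum_(0 <= i < n) ((2 * e) `^ s)%:E)%E).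
  by apply: lee_sum => i _; exact: gU.
rewrite sumEFin lee_fin sumr_const_nat subn0 -[leLHS]mulr_natl.
apply: (@le_trans _ _ (e^-1 `^ d * (2 * e) `^ s)).
  by rewrite ler_wpM2r ?powR_ge0.
rewrite powRM ?(ltW e0)//.
have := H3 e e0 ee3; rewrite powRB ?invr_neq0 ?gt_eqF ?implybT//.
have P1 : 0 < e^-1 `^ d by rewrite powR_gt0 ?invr_gt0.
have P2 : 0 < e^-1 `^ s by rewrite powR_gt0 ?invr_gt0.
have -> : e `^ s = (e^-1 `^ s)^-1.
  apply: (mulIf (lt0r_neq0 P2)); rewrite mulVf ?lt0r_neq0//.
  by rewrite -powRM ?invr_ge0 ?(ltW e0)// divff ?gt_eqF// powR1.
rewrite ler_pdivrMr// mulrAC ler_pdivlMr// => H4.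
rewrite mulrA ler_pdivrMr//; lra.
Qed.
End BoxDimensionBounds.

(** * Counting in trees, and lower bounds for the Hausdorff dimension *)

Section TupleSums.
Variable T : finType.

Lemma sum_tuple_cons (V : nmodType) n (F : seq T -> V) :
  \sum_(w : n.+1.-tuple T) F w = \sum_(w : n.-tuple T) \sum_(i : T) F (i :: w).
Proof.
rewrite pair_big /=.
rewrite (reindex (fun p : n.-tuple T * T => [tuple of p.2 :: p.1])) //=.
exists (fun w : n.+1.-tuple T => (behead_tuple w, thead w)).
  by move=> [w i] _; congr pair => //; apply: val_inj.
by move=> w _; apply: val_inj; rewrite /= [in RHS](tuple_eta w).
Qed.

Lemma sum_tuple0 (V : nmodType) (F : seq T -> V) :
  \sum_(w : 0.-tuple T) F w = F [::].
Proof.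
rewrite (bigD1 [tuple]) //= big1 ?addr0// => w /eqP[].
exact: tuple0.
Qed.

(** Words grow at their head, so the last [j] letters are the ancestor of level [j]; a property
    inherited by ancestors is counted there, times the number of extensions. *)
Lemma sum_tuple_ext (P : pred (seq T)) k j :
  (forall i w, P (i :: w) -> P w) ->
  (\sum_(w : (k + j).-tuple T) (P w : nat) <=
   #|T| ^ k * \sum_(w : j.-tuple T) (P w : nat))%N.
Proof.
move=> HP; elim: k => [|k IH]; first by rewrite expn0 mul1n.
rewrite expnS -mulnA addSn.
rewrite (@sum_tuple_cons nat _ (fun w => nat_of_bool (P w))).
apply: leq_trans (leq_mul (leqnn _) IH); rewrite big_distrr /=.
apply: leq_sum => w _; rewrite -sum_nat_const; apply: leq_sum => i _.
by case E: (P (i :: w)) => //; rewrite (HP _ _ E).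
Qed.

Lemma sum_tuple_const n (c : nat) : (\sum_(w : n.-tuple T) c = #|T| ^ n * c)%N.
Proof. by rewrite sum_nat_const card_tuple. Qed.

End TupleSums.

Section TreeOfIntervals.
Variables (R : realType) (St : Type) (l r : St -> R) (N : nat).
Variables (ch : St -> 'I_N -> St) (rho : R) (E : set R).
Hypothesis rho0 : 0 < rho.
Hypothesis lr : forall v, l v < r v.
Hypothesis nest : forall v i, l v <= l (ch v i) /\ r (ch v i) <= r v.
Hypothesis shrink : forall v i, rho * (r v - l v) <= r (ch v i) - l (ch v i).
Hypothesis disj : forall v i j, i != j ->
  r (ch v i) < l (ch v j) \/ r (ch v j) < l (ch v i).
Hypothesis meets : forall v, exists x, E x /\ l v <= x <= r v.

Let node v (w : seq 'I_N) := foldr (fun i u => ch u i) v w.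

Let node_len v w : rho ^+ size w * (r v - l v) <= r (node v w) - l (node v w).
Proof.
elim: w => [|i w IH] /=; first by rewrite expr0 mul1r.
apply: le_trans (shrink _ _); rewrite exprS -mulrA.
by rewrite ler_pM2l.
Qed.

Let node_disj v w w' : size w = size w' -> w != w' ->
  r (node v w) < l (node v w') \/ r (node v w') < l (node v w).
Proof.
elim: w w' => [|i w IH] [|i' w'] //= [sz].
have [<-|ww' _] := eqVneq w w'.
  have [-> |ii' _] := eqVneq i i'; first by rewrite eqxx.
  exact: disj.
have := nest (node v w) i; have := nest (node v w') i'.
case=> h1 h2 [h3 h4]; have [h|h] := IH _ sz ww'; [left|right].
- exact: le_lt_trans h4 (lt_le_trans h h1).
- exact: le_lt_trans h2 (lt_le_trans h h3).
Qed.

Let hit (U : set R) v w := `[< exists x, U x /\ l (node v w) <= x <= r (node v w) >].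

(** Of three disjoint intervals of level [j], the middle one separates the other two by at least its
    own length, which exceeds the diameter of [U]. *)
Let card_hit (U : set R) v j :
  (forall x y, U x -> U y -> `|x - y| < rho ^+ j * (r v - l v)) ->
  (\sum_(w : j.-tuple 'I_N) (hit U v w : nat) <= 2)%N.
Proof.
move=> HU; rewrite -big_mkcond sum1_card leqNgt; apply/negP => /card_gt2P.
move=> [a [b [c [[ha hb hc] [ab bc ca]]]]].
have [x [Ux /andP[x1 x2]]] := asboolW ha.
have [y [Uy /andP[y1 y2]]] := asboolW hb.
have [z [Uz /andP[z1 z2]]] := asboolW hc.
have D (w w' : j.-tuple 'I_N) : w != w' ->
    r (node v w) < l (node v w') \/ r (node v w') < l (node v w).
  by move=> ww'; apply: node_disj => //; rewrite !size_tuple.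
have La := node_len v a; have Lb := node_len v b; have Lc := node_len v c.
rewrite !size_tuple in La Lb Lc.
have := HU _ _ Ux Uy; have := HU _ _ Uy Uz; have := HU _ _ Uz Ux.
rewrite !ltr_norml => /andP[? ?] /andP[? ?] /andP[? ?].
by case: (D _ _ ab) => ?; case: (D _ _ bc) => ?; case: (D _ _ ca) => ?; lra.
Qed.

Let card_hit_ext (U : set R) v j n : (j <= n)%N ->
  (forall x y, U x -> U y -> `|x - y| < rho ^+ j * (r v - l v)) ->
  (\sum_(w : n.-tuple 'I_N) (hit U v w : nat) <= N ^ (n - j) * 2)%N.
Proof.
move=> jn HU; move: (n - j)%N (subnK jn) => k <-.
 rewrite -[X in (X ^ k)%N](card_ord N).
apply: leq_trans (sum_tuple_ext _ _ _) _; last by rewrite leq_mul2l card_hit ?orbT.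
move=> i w /asboolW[x [Ux /andP[x1 x2]]]; apply/asboolP; exists x; split=> //.
have [h1 h2] := nest (node v w) i.
by apply/andP; split; [apply: le_trans x1|apply: le_trans h2].
Qed.

Hypothesis rho1 : rho < 1.

(* Each ball of radius [t i] meets at most [2 N ^ (n - j)] of the [N ^ n]
   intervals of level [n], where [rho ^ j] is comparable to [t i]. *)
Let finite_cover_bound (e : R) v (n : nat) (x t : 'I_n -> R) :
  0 < e -> rho^-1 `^ e <= N%:R ->
  (forall i, 0 < t i) -> (forall i, 2 * t i < r v - l v) ->
  E `<=` \bigcup_i ball (x i) (t i) ->
  1 <= 2 * (rho * (r v - l v)) `^ (- e) * \sum_(i < n) (2 * t i) `^ e.
Proof.
move=> e0 Ne t0 tL cov.
have L0 : 0 < r v - l v by rewrite subr_gt0.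
have exj i : exists j : nat, 2 * t i < rho ^+ j * (r v - l v) /\
    rho ^+ j.+1 * (r v - l v) <= 2 * t i.
  have [j Hj] : exists j : nat, rho ^+ j * (r v - l v) <= 2 * t i.
    have : `|rho| < 1 by rewrite gtr0_norm.
    move=> /cvg_geometric /= /(_ (r v - l v)) /cvgrPdist_lt /(_ (2 * t i)).
    have h0 : 0 < 2 * t i by have := t0 i; lra.
    move=> /(_ h0) [j _ /(_ j (leqnn j))] /=.
    rewrite sub0r normrN /geometric /= gtr0_norm ?mulr_gt0 ?exprn_gt0// => /ltW h.
    by exists j; rewrite mulrC.
  pose P j := rho ^+ j * (r v - l v) <= 2 * t i.
  have exP : exists j, P j by exists j.
  case: (ex_minnP exP) => -[|k] Pk min.
    by move: Pk; rewrite /P expr0 mul1r leNgt tL.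
  exists k; split=> //; rewrite ltNge; apply/negP => h.
  by have := min k h; rewrite ltnn.
have [j Hj] := choice exj.
pose n0 := (\max_(i < n) j i)%N.
have jn i : (j i <= n0)%N by rewrite /n0 (leq_bigmax i).
have Npos : 0 < N%:R :> R by apply: lt_le_trans Ne; rewrite powR_gt0 ?invr_gt0.
have main : ((N ^ n0)%N%:R <= \sum_(i < n) 2 * N%:R ^+ (n0 - j i) :> R).
  pose V (i : 'I_n) := ball (x i) (t i).
  apply: (@le_trans _ _ (\sum_(i < n) \sum_(w : n0.-tuple 'I_N) (hit (V i) v w : nat))%N%:R).
    rewrite ler_nat exchange_big /= -[X in (X ^ _)%N](card_ord N).
    rewrite -[leqLHS]muln1 -sum_tuple_const; apply: leq_sum => w _.
    have [y [Ey yI]] := meets (node v w).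
    have [i _ Hi] := cov y Ey.
    rewrite (bigD1 i) //= (_ : hit (V i) v w = true) //.
    by apply/asboolP; exists y.
  rewrite natr_sum; apply: ler_sum => i _.
  rewrite -natrX -natrM ler_nat mulnC.
  apply: card_hit_ext (jn i) _ => a b; rewrite /V /ball /= => Ha Hb.
  have [Hj1 _] := Hj i; apply: lt_trans Hj1.
  have -> : a - b = (x i - b) - (x i - a) by ring.
  apply: le_lt_trans (ler_normB _ _) _; lra.
(* [rho ^- e <= N] turns [N ^- j] into at most [rho ^ (e * j)], and the choice of [j] bounds
   [rho ^ (j + 1)] by [2 * t i] over the length of the root. *)
have K i : N%:R ^+ (n0 - j i) <= N%:R ^+ n0 * ((rho * (r v - l v)) `^ (- e) * (2 * t i) `^ e).
  have [_ Hj2] := Hj i.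
  rewrite expfB_cond; last by rewrite gt_eqF //= jn.
  rewrite ler_pM2l ?exprn_gt0// -exprVn.
  apply: (@le_trans _ _ ((rho `^ e) ^+ j i)).
    apply: lerXn2r; rewrite ?nnegrE ?invr_ge0 ?ler0n ?powR_ge0//.
    rewrite -[leRHS]invrK lef_pV2 ?posrE ?invr_gt0 ?powR_gt0//.
    apply: le_trans Ne; rewrite -[leLHS]mul1r ler_pdivrMr ?powR_gt0//.
    by rewrite -powRM ?invr_ge0 ?(ltW rho0)// mulVf ?gt_eqF// powR1.
  rewrite -powR_mulrn ?powR_ge0// -powRrM mulrC powRrM powR_mulrn ?(ltW rho0)//.
  rewrite powRN ler_pdivlMl ?powR_gt0 ?mulr_gt0//.
  rewrite -powRM ?exprn_ge0 ?mulr_ge0 ?(ltW rho0) ?(ltW L0)//.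
  apply: ge0_ler_powR; rewrite ?nnegrE ?(ltW e0)//.
  - by rewrite !mulr_ge0 ?exprn_ge0 ?(ltW rho0) ?(ltW L0).
  - by have := t0 i; lra.
  by move: Hj2; rewrite exprS; set a := rho ^+ _; nra.
rewrite -(ler_pM2l (exprn_gt0 n0 Npos)) mulr1 -natrX.
apply: le_trans main _; rewrite mulrA mulr_sumr; apply: ler_sum => i _.
have := K i; rewrite natrX; lra.
Qed.

(** A mass distribution argument without a measure: the intervals of one deep level are counted
    instead. Compactness of [E] reduces a countable cover to a finite one, for which a deepest
    relevant level exists. *)
Lemma hausdorff_dim_ge_tree (e : R) (v : St) : compact E -> 0 < e ->
  rho^-1 `^ e <= N%:R -> (e%:E <= hausdorff_dim E)%E.
Proof.
move=> cE e0 Ne; apply: le_ereal_inf_tmp => _ [s [s0 Hs] <-]; rewrite lee_fin leNgt.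
apply/negP => se.
pose L := r v - l v; have L0 : 0 < L by rewrite subr_gt0.
(* As [s] may be 0, a positive exponent below [e] is used, so that gauges can be converted back into
   radii by the power [1 / s']. *)
pose s' := (s + e) / 2.
have s'0 : 0 < s' by rewrite /s'; lra.
have s'e : s' <= e by rewrite /s'; lra.
have ss' : s <= s' by rewrite /s'; lra.
pose A := 2 * (rho * L) `^ (- s') * 2 `^ s'.
have A0 : 0 < A by rewrite !mulr_gt0 ?powR_gt0 ?mulr_gt0.
(* The bound by [A^-1] contradicts [finite_cover_bound]; the bound by [(L / 2) ^ s'] keeps every
   ball smaller than the root interval. *)
pose c := Num.min A^-1 ((L / 2) `^ s') / 2.
have m0 : 0 < Num.min A^-1 ((L / 2) `^ s').
  by rewrite lt_min invr_gt0 A0 powR_gt0 ?divr_gt0.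
have c0 : 0 < c by rewrite /c divr_gt0.
have cA : 2 * c <= A^-1 by rewrite /c mulrC divfK// ge_min lexx.
have cL : 2 * c <= (L / 2) `^ s' by rewrite /c mulrC divfK// ge_min lexx orbT.
(* With [delta = 1] all diameters are at most 1, where raising the exponent from [s] to [s']
   decreases the gauge. *)
have : (hausdorff_premeasure s 1 E < c%:E)%E.
  apply: (@le_lt_trans _ _ 0%E); last by rewrite lte_fin.
  by rewrite -Hs; apply: ereal_sup_ubound; exists 1 => //=.
move=> /ereal_inf_lt[_ [U [dU cU] <-] sU].
have dUge0 i : U i !=set0 -> (0 <= diam (U i))%E.
  move=> [x Ux]; apply: le_ereal_sup_tmp; exists 0%E => //.
  by exists (x, x); rewrite ?subrr ?normr0.
pose D i := fine (diam (U i)).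
have DE i : U i !=set0 -> diam (U i) = (D i)%:E.
  move=> U0; rewrite /D fineK// ge0_fin_numE ?dUge0//.
  exact: le_lt_trans (dU i) (ltry _).
have D0 i : U i !=set0 -> 0 <= D i <= 1.
  by move=> U0; rewrite -!lee_fin -DE// dUge0// dU.
pose g i := if `[< U i = set0 >] then 0 else D i `^ s'.
have g0 i : 0 <= g i by rewrite /g; case: ifP => // _; rewrite powR_ge0.
have gle i : ((g i)%:E <= hausdorff_gauge s (U i))%E.
  rewrite /g /hausdorff_gauge; case: ifPn => // /asboolPn/eqP/set0P U0.
  rewrite DE// poweR_EFin lee_fin.
  have /andP[d0 d1] := D0 i U0.
  have [->|Dn0] := eqVneq (D i) 0.
    by rewrite powR0 ?powR_ge0 ?gt_eqF.
  by apply: ger_powR => //; rewrite lt_neqAle eq_sym Dn0 d0 d1.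
(* A summable positive amount is added to each gauge: the ball of radius [(a i) ^ (1 / s')] is then
   open and strictly wider than the diameter of [U i], even for one-point sets. *)
pose a i := g i + c / 2 ^+ i.+1.
have a0 i : 0 < a i by rewrite /a ltr_wpDl// divr_gt0// exprn_gt0.
have geo n : \sum_(i < n) c / 2 ^+ i.+1 <= c.
  have -> : \sum_(i < n) c / 2 ^+ i.+1 = c - c / 2 ^+ n.
    elim: n => [|n IH]; first by rewrite big_ord0 expr0 divr1 subrr.
    rewrite big_ord_recr /= IH exprS invfM.
    set z := (2 ^+ n)^-1; lra.
  by rewrite gerBl divr_ge0 ?(ltW c0)// exprn_ge0.
have suma n : \sum_(i < n) a i < 2 * c.
  rewrite /a big_split /=; have := geo n.
  have : \sum_(i < n) g i < c.
    rewrite -lte_fin; apply: le_lt_trans sU; rewrite -sumEFin.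
    apply: (@le_trans _ _ (\sum_(0 <= i < n) hausdorff_gauge s (U i))%E).
      by rewrite big_mkord; apply: lee_sum => i _.
    by apply: nneseries_lim_ge => i _ _; exact: hausdorff_gauge_ge0.
  lra.
have alt i : a i < 2 * c.
  apply: le_lt_trans (suma i.+1); rewrite big_ord_recr /= lerDr.
  by apply: sumr_ge0 => j _; exact: ltW.
pose t i := a i `^ s'^-1.
have t0 i : 0 < t i by rewrite powR_gt0.
have tE i : t i `^ s' = a i.
  by rewrite -powRrM mulVf ?gt_eqF// powRr1// ltW.
pose x i := xget 0 (U i).
have UV i : U i `<=` ball (x i) (t i).
  move=> y Uy; have Ux : U i (x i) by apply: xgetPex; exists y.
  have U0 : U i !=set0 by exists y.
  rewrite /ball/=.
  apply: (@le_lt_trans _ _ (D i)).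
    by rewrite -lee_fin -DE//; apply: ereal_sup_ubound; exists (x i, y).
  rewrite ltNge; apply/negP => tD.
  have /andP[Di0 _] := D0 i U0.
  have : t i `^ s' <= D i `^ s'.
    by apply: ge0_ler_powR; rewrite ?nnegrE ?(ltW s'0)// ltW.
  rewrite tE /a /g; case: ifPn => [/asboolP Ui0|_]; first by case: U0 => z; rewrite Ui0.
  have : 0 < c / 2 ^+ i.+1 by rewrite divr_gt0// exprn_gt0.
  lra.
have : E `<=` cover setT (fun i => ball (x i) (t i)).
  by move=> y /cU[i _ Uy]; exists i => //; exact: UV.
move: (cE); rewrite compact_cover => /[apply].
case=> [i _|F _ cF]; first by exact: ball_open.
pose n := (\max_(i <- finmap.enum_fset F) i).+1.
have : E `<=` \bigcup_(i : 'I_n) ball (x i) (t i).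
  move=> y /cF[i /= iF Hi].
  have lin : (i < n)%N by rewrite ltnS; apply: (@leq_bigmax_seq _ _ xpredT id).
  by exists (Ordinal lin).
have Ne' : rho^-1 `^ s' <= N%:R.
  apply: le_trans Ne; apply: ler_powR => //.
  by rewrite invf_ge1// ltW.
have tL i : 2 * t i < L.
  rewrite ltNge; apply/negP => h.
  have : (L / 2) `^ s' <= t i `^ s'.
    apply: ge0_ler_powR; rewrite ?nnegrE ?(ltW s'0) ?(ltW (t0 i))//; first lra.
    by lra.
  by rewrite tE; have := alt i; lra.
move=> /(@finite_cover_bound s' v n (fun i => x i) (fun i => t i) s'0 Ne'
  (fun i => t0 i) (fun i => tL i)).
apply/negP; rewrite -ltNge.
have -> : \sum_(i < n) (2 * t i) `^ s' = 2 `^ s' * \sum_(i < n) a i.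
  by rewrite mulr_sumr; apply: eq_bigr => i _; rewrite powRM ?(ltW (t0 i))// tE.
rewrite mulrA -/A -ltr_pdivlMl// mulr1.
exact: lt_le_trans (suma n) cA.
Qed.

End TreeOfIntervals.

(** * Packing and counting *)

Local Close Scope classical_set_scope.

Section Packing.
Variable R : realType.

Lemma card_separated (T : finType) (A : {set T}) (z : T -> R) (a l D : R) :
  0 < l -> 0 <= D ->
  (forall t, t \in A -> a <= z t <= a + D * l) ->
  (forall t t', t \in A -> t' \in A -> t != t' -> l <= `|z t - z t'|) ->
  (#|A| <= (Num.truncn D).+1)%N.
Proof.
move=> l0 D0 zA sep.
pose f t : 'I_(Num.truncn D).+1 := inord (Num.truncn ((z t - a) / l)).
have ge0 t : t \in A -> 0 <= (z t - a) / l.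
  by move=> /zA /andP[h _]; rewrite divr_ge0 ?subr_ge0// ltW.
have fE t : t \in A -> f t = Num.truncn ((z t - a) / l) :> nat.
  move=> tA; rewrite inordK// ltnS; apply: le_truncn.
  by have /andP[_ h] := zA t tA; rewrite ler_pdivrMr//; lra.
have finj : {in A &, injective f}.
  move=> t t' tA t'A /(congr1 val) /=; rewrite !fE// => e.
  apply/eqP; apply: contraT => /(sep _ _ tA t'A); rewrite leNgt.
  have /andP[a1 a2] := truncn_itv (ge0 _ tA).
  have /andP[b1 b2] := truncn_itv (ge0 _ t'A).
  rewrite -e in b1 b2; move: a1 a2 b1 b2; rewrite -natr1.
  set k := _%:R; rewrite !ler_pdivlMr// !ltr_pdivrMr// mulrDl mul1r => a1 a2 b1 b2.
  by move=> /negP[]; rewrite ltr_norml; apply/andP; split; lra.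
by rewrite -(card_in_imset finj) -[leqRHS]card_ord max_card.
Qed.

(** Take a maximal disjoint subfamily [D]. Every interval of [A] meets some [t'] of [D] and has
    length at least [len], hence contains one of the [L + 1] points [l t' + k * len]; each of these
    points lies in at most [Mu] intervals. *)
Lemma disjoint_subfamily (T : finType) (A : {set T}) (l r : T -> R)
    (len : R) (L Mu : nat) :
  0 < len -> (forall t, t \in A -> len <= r t - l t <= L%:R * len) ->
  (forall x, (#|[set t in A | (l t <= x <= r t)%R]| <= Mu)%N) ->
  exists D : {set T}, [/\ D \subset A,
    (forall t t', t \in D -> t' \in D -> t != t' -> r t < l t' \/ r t' < l t) &
    (#|A| <= #|D| * (L.+1 * Mu))%N].
Proof.
move=> len0 HA HM.
pose ok (D : {set T}) := (D \subset A) &&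
  [forall t in D, forall t' in D, (t != t') ==> ((r t < l t') || (r t' < l t))].
have [|D /maxsetP[/andP[DA /'forall_in_'forall_in_implyP okD] maxD]] := @ex_maxset _ ok.
  exists finset.set0; rewrite /ok finset.sub0set /=; apply/'forall_in_'forall_in_implyP => t.
  by rewrite inE.
exists D; split=> //; first by move=> t t' tD t'D /(okD t tD t' t'D)/orP.
pose pt (c : T * 'I_L.+1) := l c.1 + c.2%:R * len.
have cov : A \subset \bigcup_(c in [set c : T * 'I_L.+1 | c.1 \in D])
    [set t in A | l t <= pt c <= r t].
  apply/fintype.subsetP => t tA.
  have [t' t'D meet] : exists2 t', t' \in D & (l t <= r t') && (l t' <= r t).
    apply: contrapT => nex.
    have far t' : t' \in D -> (r t < l t') || (r t' < l t).
      move=> t'D; apply: contraT; rewrite negb_or -!leNgt => /andP[h1 h2].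
      by case: nex; exists t' => //; rewrite h1 h2.
    have tD : t \in D.
      have <- : t |: D = D; last by rewrite !inE eqxx.
      apply: maxD; last exact: finset.subsetUr.
      apply/andP; split; first by rewrite finset.subUset finset.sub1set tA.
      apply/'forall_in_'forall_in_implyP => x + y; rewrite !inE.
      move=> /orP[/eqP->|xD] /orP[/eqP->|yD].
      - by rewrite eqxx.
      - by move=> _; exact: far.
      - by move=> _; rewrite orbC; exact: far.
      - exact: okD.
    have /andP[h _] := HA t tA.
    by have := far t tD; rewrite orbb; lra.
  have /andP[h1 h2] := HA t tA; have t'A := fintype.subsetP DA _ t'D.
  have /andP[h3 h4] := HA t' t'A; have /andP[m1 m2] := meet.
  have [lt|gt] := lerP (l t) (l t').
    apply/finset.bigcupP; exists (t', ord0); rewrite !inE //= tA /pt /= mul0r addr0 lt.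
    by rewrite m2.
  pose x := (l t - l t') / len.
  have x0 : 0 < x by rewrite divr_gt0// subr_gt0.
  have /andP[x1 x2] := truncn_itv (ltW x0).
  pose k := Num.truncn x.
  have xL : x <= L%:R by rewrite ler_pdivrMr//; lra.
  have kL : (k <= L)%N by rewrite -(ler_nat R); apply: le_trans xL.
  have xE : l t = l t' + x * len by rewrite /x divfK ?gt_eqF//; ring.
  have [kx|kx] := eqVneq k%:R x.
    have kL1 : (k < L.+1)%N by rewrite ltnS.
    apply/finset.bigcupP; exists (t', Ordinal kL1); rewrite !inE //= tA /pt /=.
    by rewrite kx -xE lexx /=; lra.
  have kx' : k%:R < x by rewrite lt_neqAle kx.
  have kL1 : (k.+1 < L.+1)%N by rewrite ltnS -(ltr_nat R); apply: lt_le_trans xL.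
  apply/finset.bigcupP; exists (t', Ordinal kL1); rewrite !inE //= tA /pt /= -natr1.
  move: x2 kx'; rewrite -/k -natr1; set kk := k%:R => x2 kx'.
  have y1 : x * len < (kk + 1) * len by rewrite ltr_pM2r.
  have y2 : kk * len < x * len by rewrite ltr_pM2r.
  by apply/andP; split; lra.
apply: leq_trans (subset_leq_card cov) _.
apply: (@leq_trans (\sum_(c in [set c : T * 'I_L.+1 | c.1 \in D])
    #|[set t in A | (l t <= pt c <= r t)%R]|)).
  elim/big_rec2: _ => [|c B n _ le]; first by rewrite cards0.
  by apply: leq_trans (leq_card_setU _ _) _; rewrite leq_add2l.
apply: leq_trans (leq_sum _ (fun c _ => HM (pt c))) _.
rewrite sum_nat_const.
have -> : #|[set c : T * 'I_L.+1 | c.1 \in D]| = (#|D| * L.+1)%N.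
  rewrite -[in RHS](card_ord L.+1) -cardsT -cardsX; apply: eq_card => c.
  by rewrite !inE andbT.
by rewrite mulnA.
Qed.

End Packing.

(** * Transversality over a grid of slopes *)

Section GridCount.
Variable R : realType.

(** Consecutive slopes move the value by [|a'| * q ^- m], so about [2 * C1 / |a'|] of them fall in a
    window of width [2 * C1 * q ^- m]. *)
Let card_grid (a a' : R) (q m C1 j : nat) : (0 < q)%N -> (j < m)%N ->
  q%:R ^- j.+1 < `|a'| ->
  (\sum_(k < q ^ m) (`|a + (1 + k%:R * q%:R ^- m) * a'| <= C1%:R * q%:R ^- m)%R <=
    (2 * C1 + 1) * q ^ j.+1)%N.
Proof.
move=> q0 jm ha'; have Q0 : 0 < q%:R :> R by rewrite ltr0n.
have Pm : 0 < q%:R ^- m :> R by rewrite invr_gt0 exprn_gt0.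
have Pj : 0 < q%:R ^- j.+1 :> R by rewrite invr_gt0 exprn_gt0.
have a'0 : 0 < `|a'| by apply: lt_trans ha'.
rewrite -big_mkcond sum1_card /=.
pose A := [set k : 'I_(q ^ m) | `|a + (1 + k%:R * q%:R ^- m) * a'| <= C1%:R * q%:R ^- m].
rewrite -(@eq_card _ (mem A)); last by move=> k; rewrite inE.
pose D := 2 * C1%:R / `|a'|.
have D0 : 0 <= D by rewrite divr_ge0 ?mulr_ge0.
apply: leq_trans (@card_separated R _ A
  (fun k => a + (1 + k%:R * q%:R ^- m) * a') (- (C1%:R * q%:R ^- m))
  (`|a'| * q%:R ^- m) D _ D0 _ _) _.
- by rewrite mulr_gt0.
- move=> k; rewrite inE ler_norml.
  have -> : D * (`|a'| * q%:R ^- m) = 2 * (C1%:R * q%:R ^- m).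
    rewrite /D; set b := `|a'|; set X := _ ^- m.
    by rewrite -[LHS]mulrA mulKf ?gt_eqF// mulrA.
  by move=> /andP[h1 h2]; apply/andP; split; lra.
- move=> k k' _ _ kk'.
  have -> : a + (1 + k%:R * q%:R ^- m) * a' - (a + (1 + k'%:R * q%:R ^- m) * a') =
     (k%:R - k'%:R) * a' * q%:R ^- m by ring.
  rewrite !normrM (gtr0_norm Pm) ler_pM2r// -[leLHS]mul1r ler_pM2r//.
  have : k != k' :> nat by [].
  rewrite neq_ltn => /orP[lt|lt].
    have h : k%:R + 1 <= k'%:R :> R by rewrite natr1 ler_nat.
    by rewrite distrC ger0_norm; lra.
  have h : k'%:R + 1 <= k%:R :> R by rewrite natr1 ler_nat.
  by rewrite ger0_norm; lra.
rewrite -(ler_nat R) -natr1 natrM natrD natrM natrX.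
have /andP[t1 _] := truncn_itv D0.
have Dle : D <= 2 * C1%:R * q%:R ^+ j.+1.
  rewrite /D ler_wpM2l ?mulr_ge0// -[leRHS]invrK lef_pV2 ?posrE//.
  exact: ltW.
have : 1 <= q%:R ^+ j.+1 :> R by rewrite exprn_ege1// ler1n.
by move=> h; rewrite [leRHS]mulrDl mul1r lerD// (le_trans t1 Dle).
Qed.

(* Marstrand's transversality: for given [t] and [t'] only few slopes of the
   grid make [a t + slope * a' t'] small. *)
Lemma grid_count (T T' : finType) (a : T -> R) (a' : T' -> R)
    (q m C N N' C1 : nat) :
  (0 < q)%N -> (N * N' <= q)%N -> (forall t', `|a' t'| <= 1) ->
  (forall j, (j <= m)%N ->
    (#|[set t | (`|a t| <= C1.+2%:R * q%:R ^- j)%R]| <= C * N ^ (m - j))%N) ->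
  (forall j, (j <= m)%N ->
    (#|[set t' | (`|a' t'| <= q%:R ^- j)%R]| <= C * N' ^ (m - j))%N) ->
  (\sum_(k < q ^ m) \sum_(t : T * T')
     (`|a t.1 + (1 + k%:R * q%:R ^- m) * a' t.2| <= C1%:R * q%:R ^- m)%R <=
   C * C * (2 * C1 + 1) * m.+1 * q * q ^ m)%N.
Proof.
move=> q0 NN' a'1 HA HA'; have Q0 : 0 < q%:R :> R by rewrite ltr0n.
have Q1 : 1 <= q%:R :> R by rewrite ler1n.
rewrite exchange_big /=.
apply: (@leq_trans (\sum_(t : T * T') \sum_(j < m.+1)
   ((`|a t.1| <= C1.+2%:R * q%:R ^- j)%R * (`|a' t.2| <= q%:R ^- j)%R *
    ((2 * C1 + 1) * q ^ j.+1)))%N).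
  apply: leq_sum => -[t t'] _ /=.
  have [/eqP->//|] := boolP (\sum_(k < q ^ m)
     (`|a t + (1 + k%:R * q%:R ^- m) * a' t'| <= C1%:R * q%:R ^- m)%R == 0)%N.
  rewrite sum_nat_eq0 negb_forall => /existsP[k]; rewrite eqb0 negbK => hk.
  (* [j] is the scale of [a' t'], the last level at which it is small. At least one slope makes the
     combination small, so [a t] has the same scale up to the factor [C1 + 2]. *)
  pose P j := (j <= m)%N && (`|a' t'| <= q%:R ^- j).
  have exP : exists j, P j by exists 0%N; rewrite /P expr0 invr1 a'1.
  have bP j : P j -> (j <= m)%N by case/andP.
  have [j /andP[jm aj] maxj] := ex_maxnP exP bP.
  have jm1 : (j < m.+1)%N by rewrite ltnS.
  rewrite (bigD1 (Ordinal jm1)) //= aj.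
  have Pm : 0 < q%:R ^- m :> R by rewrite invr_gt0 exprn_gt0.
  have Pj : q%:R ^- m <= q%:R ^- j :> R.
    by rewrite lef_pV2 ?posrE ?exprn_gt0// ler_weXn2l.
  have s1 : k%:R * q%:R ^- m <= 1 :> R.
    by rewrite ler_pdivrMr ?exprn_gt0// mul1r -natrX ler_nat ltnW.
  have s0 : 0 <= k%:R * q%:R ^- m :> R by rewrite mulr_ge0// ltW.
  have -> : `|a t| <= C1.+2%:R * q%:R ^- j.
    have -> : a t = (a t + (1 + k%:R * q%:R ^- m) * a' t') - (1 + k%:R * q%:R ^- m) * a' t'.
      by ring.
    apply: le_trans (ler_normB _ _) _; rewrite normrM (@ger0_norm _ (1 + _)); last by lra.
    have -> : C1.+2%:R = C1%:R + 2 :> R by rewrite -addn2 natrD.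
    have h1 : C1%:R * q%:R ^- m <= C1%:R * q%:R ^- j :> R by rewrite ler_wpM2l.
    have h2 : (1 + k%:R * q%:R ^- m) * `|a' t'| <= 2 * q%:R ^- j.
      by apply: ler_pM => //; lra.
    rewrite [leRHS]mulrDl; lra.
  rewrite !mul1n; apply: leq_trans (leq_addr _ _).
  have [jm'|] := ltnP j m.
    apply: card_grid => //; rewrite ltNge; apply/negP => h.
    by have := maxj j.+1; rewrite /P jm' h ltnn => /(_ isT).
  (* At the last scale maximality gives no lower bound for [a' t'], and the trivial count of all
     [q ^ m] slopes is enough. *)
  move=> mj; have -> : j = m by apply/eqP; rewrite eqn_leq jm.
  apply: (@leq_trans (q ^ m)).
    rewrite -[leqRHS]muln1 -[X in (_ <= X * _)%N]card_ord -sum_nat_const.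
    by apply: leq_sum => i _; exact: leq_b1.
  by rewrite expnS mulnA leq_pmull// muln_gt0 q0 andbT addn1.
rewrite exchange_big /=.
apply: (@leq_trans (\sum_(j < m.+1) (C * C * (2 * C1 + 1) * q * q ^ m))%N); last first.
  rewrite sum_nat_const card_ord; move: (q ^ m)%N (C * C * (2 * C1 + 1))%N => x y.
  by rewrite !mulnA (mulnC m.+1).
(* Pairs of scale [j] number at most [C ^ 2 * (N * N') ^ (m - j)], each with [O(q ^ (j + 1))]
   slopes. As [N * N' <= q], every scale contributes the same [O(q ^ (m + 1))], whence the factor
   [m + 1]. *)
apply: leq_sum => j _; rewrite -big_distrl /=.
have -> : (\sum_(t : T * T') (`|a t.1| <= C1.+2%:R * q%:R ^- j)%R * (`|a' t.2| <= q%:R ^- j)%R)%N =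
   (#|[set t | (`|a t| <= C1.+2%:R * q%:R ^- j)%R]| * #|[set t' | (`|a' t'| <= q%:R ^- j)%R]|)%N.
  rewrite -(pair_bigA _ (fun t t' => (`|a t| <= C1.+2%:R * q%:R ^- j)%R * (`|a' t'| <= q%:R ^- j)%R)%N) /=.
  rewrite -!sum1dep_card !(big_mkcond (fun t => _ <= _)) big_distrl /=.
  by apply: eq_bigr => t _; rewrite big_distrr /=.
have jm : (j <= m)%N by rewrite -ltnS.
apply: (@leq_trans ((C * N ^ (m - j)) * (C * N' ^ (m - j)) * ((2 * C1 + 1) * q ^ j.+1))%N).
  by rewrite leq_mul2r leq_mul ?orbT ?HA ?HA'.
have -> : ((C * N ^ (m - j)) * (C * N' ^ (m - j)) * ((2 * C1 + 1) * q ^ j.+1) =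
  (C * C * (2 * C1 + 1)) * ((N * N') ^ (m - j) * q ^ j.+1))%N.
  rewrite expnMn; move: (N ^ _)%N (N' ^ _)%N (q ^ _)%N (2 * C1 + 1)%N => x y z t.
  by lia.
rewrite -[leqRHS]mulnA leq_mul2l; apply/orP; right.
apply: (@leq_trans (q ^ (m - j) * q ^ j.+1)).
  by case: (m - j)%N => [|i]; rewrite // leq_mul2r leq_exp2r// NN' orbT.
by rewrite -expnD addnS subnK// expnS.
Qed.

End GridCount.

(** * Words with few bad steps *)

Section BadSteps.
Variable T : finType.
Implicit Types (bad : seq T -> T -> bool) (W : seq T).

Lemma sum_tuple_cons_nat n (F : seq T -> nat) :
  (\sum_(w : n.+1.-tuple T) F w = \sum_(w : n.-tuple T) \sum_(i : T) F (i :: w))%N.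
Proof. exact: (@sum_tuple_cons T nat n F). Qed.

Lemma sum_tuple0_nat (F : seq T -> nat) : (\sum_(w : 0.-tuple T) F w = F [::])%N.
Proof. exact: (@sum_tuple0 T nat F). Qed.

Fixpoint nbad bad W : nat :=
  if W is b :: W' then (bad W' b + nbad bad W')%N else 0%N.

Let sum_nbad (G h M : nat) (bad : 'I_G -> seq T -> T -> bool) :
  (forall W b, h * \sum_(k < G) bad k W b <= G)%N ->
  (h * \sum_(k < G) \sum_(W : M.-tuple T) nbad (bad k) W <= G * M * #|T| ^ M)%N.
Proof.
move=> H; elim: M => [|M IH].
  by rewrite big1 ?muln0// => k _; rewrite sum_tuple0_nat.
have -> : (\sum_(k < G) \sum_(W : M.+1.-tuple T) nbad (bad k) W =
    \sum_(W : M.-tuple T) \sum_b \sum_(k < G) bad k W b +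
    #|T| * \sum_(k < G) \sum_(W : M.-tuple T) nbad (bad k) W)%N.
  rewrite (eq_bigr (fun k => \sum_(W : M.-tuple T) \sum_b (bad k W b + nbad (bad k) W))%N);
    last by move=> k _; rewrite (sum_tuple_cons_nat _ (nbad (bad k))).
  rewrite exchange_big /= [X in (_ + #|T| * X)%N]exchange_big /= big_distrr /=.
  rewrite -big_split /=; apply: eq_bigr => W _.
  rewrite exchange_big /= -sum_nat_const -big_split /=; apply: eq_bigr => b _.
  by rewrite big_split.
rewrite mulnDr mulnCA.
apply: (@leq_trans (#|T| ^ M * (#|T| * G) + #|T| * (G * M * #|T| ^ M))).
  apply: leq_add; last by rewrite leq_mul2l IH orbT.
  rewrite big_distrr /= -sum_tuple_const; apply: leq_sum => W _.
  by rewrite big_distrr /= -sum_nat_const; apply: leq_sum => b _; exact: H.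
by rewrite expnS; move: (#|T| ^ M)%N => x; lia.
Qed.

(** Averaging over the parameters gives one [k] with at most [M] bad steps per word of length
    [h * M] on average; by Markov's inequality at least half of the words then have at most
    [2 * M]. *)
Lemma few_bad_steps (G h M : nat) (bad : 'I_G -> seq T -> T -> bool) :
  (0 < G)%N -> (0 < h)%N ->
  (forall W b, h * \sum_(k < G) bad k W b <= G)%N ->
  exists k, (#|T| ^ (h * M) <=
    2 * \sum_(W : (h * M).-tuple T) (nbad (bad k) W <= 2 * M))%N.
Proof.
move=> G0 h0 H; have S := sum_nbad (h * M) H.
have [k Hk] : exists k, (\sum_(W : (h * M).-tuple T) nbad (bad k) W <= M * #|T| ^ (h * M))%N.
  apply: contrapT => nex.
  have lt k : (M * #|T| ^ (h * M) < \sum_(W : (h * M).-tuple T) nbad (bad k) W)%N.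
    by rewrite ltnNge; apply/negP => le; apply: nex; exists k.
  have : (\sum_(k < G) (M * #|T| ^ (h * M)).+1 <=
     \sum_(k < G) \sum_(W : (h * M).-tuple T) nbad (bad k) W)%N by apply: leq_sum => k _.
  rewrite sum_nat_const card_ord; move: S; set s := (\sum_(k < G) _)%N.
  move: (#|T| ^ _)%N => x; nia.
exists k; set small := (\sum_(W : _.-tuple T) _)%N.
pose big := (\sum_(W : (h * M).-tuple T) (2 * M < nbad (bad k) W))%N.
have split_count : (small + big = #|T| ^ (h * M))%N.
  rewrite /small /big -big_split /= -[RHS]muln1 -sum_tuple_const.
  by apply: eq_bigr => W _; rewrite ltnNge; case: leqP.
have : (big * (2 * M).+1 <= M * #|T| ^ (h * M))%N.
  apply: leq_trans Hk; rewrite /big big_distrl /=; apply: leq_sum => W _.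
  by case: ltnP => //; rewrite mul1n.
rewrite -split_count; case: (M) => [|M0]; nia.
Qed.

(** A good step leaves at most [Q] letters compatible with [P], a bad one at most [#|T|], and
    [2 ^ M] bounds the choices of the places of the bad steps. *)
Lemma few_bad_multiplicity bad (P : pred (seq T)) (Q M B : nat) :
  (0 < #|T|)%N -> (0 < Q)%N -> (forall b W, P (b :: W) -> P W) ->
  (forall W, \sum_b (P (b :: W) && ~~ bad W b) <= Q)%N ->
  (\sum_(W : M.-tuple T) (P W && (nbad bad W <= B)) <= (2 * Q) ^ M * #|T| ^ B)%N.
Proof.
move=> T0 Q0 mono good; elim: M B => [|M IH] B.
  rewrite (sum_tuple0_nat (fun W => P W && (nbad bad W <= B)%N)) /=.
  by apply: leq_trans (leq_b1 _) _; rewrite mul1n expn_gt0 T0.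
rewrite (sum_tuple_cons_nat _ (fun W => P W && (nbad bad W <= B)%N)) /=.
apply: (@leq_trans (\sum_(W : M.-tuple T)
   ((P W && (nbad bad W <= B)) * Q + (P W && (nbad bad W < B)) * #|T|))%N).
  apply: leq_sum => W _.
  apply: (@leq_trans (\sum_b ((P W && (nbad bad W <= B)) * (P (b :: W) && ~~ bad W b)
     + (P W && (nbad bad W < B))))%N).
    apply: leq_sum => b _.
    case E: (P (b :: W)) => //=; rewrite (mono _ _ E) /=.
    by case: (bad W b) => /=; rewrite ?add1n ?add0n ?muln0 ?muln1 ?leq_addr.
  rewrite big_split /= -big_distrr /= sum_nat_const mulnC [leqRHS]addnC [leqLHS]addnC.
  by apply: leq_add; rewrite mulnC // leq_mul.
rewrite big_split /= -!big_distrl /=.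
case: B => [|B].
  rewrite [X in (_ + X * _)%N]big1 ?mul0n ?addn0; last by move=> W _; rewrite andbF.
  apply: leq_trans (leq_mul (IH 0%N) (leqnn Q)) _.
  by rewrite !expn0 !muln1 expnS mulnC leq_mul// leq_pmull.
have h1 := IH B.+1; have h2 := IH B.
apply: (@leq_trans ((2 * Q) ^ M * #|T| ^ B.+1 * Q + (2 * Q) ^ M * #|T| ^ B * #|T|)%N).
  by rewrite leq_add// leq_mul.
rewrite !expnS; move: ((2 * Q) ^ M)%N (#|T| ^ B)%N => x y; nia.
Qed.

End BadSteps.

(** * Systems of contractions with bounded distortion *)

Local Open Scope classical_set_scope.
Local Open Scope ring_scope.

Section System.
Variable R : realType.

(* [F] is a family of increasing branches of [lo, hi] into itself, closed under
   composition and of bounded distortion; [K] is the part of the Cantor set in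
   [lo, hi]. *)
Record csystem (lo hi : R) (K : set R) (F : set (R -> R)) : Prop := CSystem {
  cs_lt : lo < hi;
  cs_sub : K `<=` `[lo, hi];
  cs_compact : compact K;
  cs_nonempty : K !=set0;
  cs_id : F id;
  cs_comp : forall f g, F f -> F g -> F (f \o g);
  cs_in : forall f x, F f -> lo <= x <= hi -> lo <= f x <= hi;
  cs_incr : forall f x y, F f -> lo <= x -> x < y -> y <= hi -> f x < f y;
  cs_K : forall f x, F f -> K x -> K (f x);
  cs_dist : exists2 C : R, 0 < C & forall f x y x' y', F f ->
    lo <= x -> x < y -> y <= hi -> lo <= x' -> x' < y' -> y' <= hi ->
    (f y - f x) * (y' - x') <= C * (f y' - f x') * (y - x);
  cs_dist0 : forall eta : R, 0 < eta -> exists2 d : R, 0 < d &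
    forall f z x y x' y', F f ->
    lo <= x -> x < y -> y <= hi -> lo <= x' -> x' < y' -> y' <= hi ->
    z <= x -> y <= z + d -> z <= x' -> y' <= z + d ->
    (f y - f x) * (y' - x') <= (1 + eta) * (f y' - f x') * (y - x)
}.

(** The last condition is Moran's inequality [n * sg ^ d >= 1]. Relative sizes are controlled after
    every [f], so that the branches can be iterated in any position; the bound [1 / 2] makes
    subdivisions terminate. *)
Definition branching (lo hi : R) (F : set (R -> R)) (d : R) : Prop :=
  exists n (Phi : 'I_n -> R -> R) (sg : R), [/\ 0 < sg,
    forall i, F (Phi i),
    forall i j, i != j -> Phi i hi < Phi j lo \/ Phi j hi < Phi i lo,
    forall f i, F f -> sg * (f hi - f lo) <= f (Phi i hi) - f (Phi i lo) <= (f hi - f lo) / 2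
  & sg^-1 `^ d <= n%:R].

(** In any context [f], [g], exchanging [B] for [A] changes the size by a factor close to 1 but
    uniformly away from 1: [del] is the precision of an adjustment and [kap] the progress guaranteed
    by each exchange. *)
Definition toggling (lo hi : R) (F : set (R -> R)) : Prop :=
  forall del : R, 0 < del -> exists A B (kap : R), [/\ F A, F B, 0 < kap,
    forall f, F f -> f (B hi) - f (B lo) <= (f hi - f lo) / 2
  & forall f g, F f -> F g ->
    (1 + kap) * (f (B (g hi)) - f (B (g lo))) <= f (A (g hi)) - f (A (g lo))
      <= (1 + del) * (f (B (g hi)) - f (B (g lo)))].

Variables (lo hi : R) (K : set R) (F : set (R -> R)).
Hypothesis S : csystem lo hi K F.

Local Notation sz f := (f hi - f lo).

Lemma cs_le f x y : F f -> lo <= x -> x <= y -> y <= hi -> f x <= f y.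
Proof.
move=> Ff lx; rewrite le_eqVlt => /orP[/eqP->//|xy] yh.
by apply: ltW; apply: (cs_incr S).
Qed.

Lemma cs_lo f : F f -> lo <= f lo <= hi.
Proof. by move=> Ff; apply: (cs_in S) => //; rewrite lexx ltW ?(cs_lt S). Qed.

Lemma cs_hi f : F f -> lo <= f hi <= hi.
Proof. by move=> Ff; apply: (cs_in S) => //; rewrite lexx andbT ltW ?(cs_lt S). Qed.

Lemma cs_size_gt0 f : F f -> 0 < sz f.
Proof. by move=> Ff; rewrite subr_gt0; apply: (cs_incr S); rewrite ?(cs_lt S). Qed.

Lemma cs_nest f g : F f -> F g -> f lo <= f (g lo) /\ f (g hi) <= f hi.
Proof.
move=> Ff Fg; have /andP[? ?] := cs_lo Fg; have /andP[? ?] := cs_hi Fg.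
by split; apply: cs_le => //; rewrite lexx.
Qed.

Lemma cs_comp_lt f g : F f -> F g -> f (g lo) < f (g hi).
Proof. by move=> Ff Fg; rewrite -subr_gt0; apply: (cs_size_gt0 (cs_comp S Ff Fg)). Qed.

(** Pieces larger than [r] are split again by the branches [Phi i]. The count never drops below
    [(size / r) ^ d] because [n * sg ^ d >= 1]. *)
Lemma subdivide d : branching lo hi F d -> 0 <= d ->
  exists2 sg : R, 0 < sg <= 2^-1 & forall f r, F f -> 0 < r -> r < sz f ->
  exists (T : finType) (Psi : T -> R -> R), [/\ forall t, F (Psi t),
    forall t t', t != t' -> f (Psi t hi) < f (Psi t' lo) \/ f (Psi t' hi) < f (Psi t lo),
    forall t, sg * r <= f (Psi t hi) - f (Psi t lo) <= r
  & (sz f / r) `^ d <= #|T|%:R].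
Proof.
move=> [n [Phi [sg [sg0 FPhi dPhi sPhi nd]]]] d0.
have n0 : (0 < n)%N.
  by rewrite -(ltr_nat R); apply: lt_le_trans nd; rewrite powR_gt0 ?invr_gt0.
exists sg.
  rewrite sg0 /=; have /andP[h1 h2] := sPhi id (Ordinal n0) (cs_id S).
  by have := le_trans h1 h2; rewrite mulrC ler_pM2l// subr_gt0 (cs_lt S).
move=> f r Ff r0 rf.
have [k Hk] : exists k, sz f <= r * 2 ^+ k.
  pose x := sz f / r; have x0 : 0 <= x by rewrite divr_ge0// ltW// cs_size_gt0.
  exists (Num.truncn x).+1; have /andP[_ x1] := truncn_itv x0.
  rewrite mulrC -ler_pdivrMr// -/x; apply: le_trans (ltW x1) _.
  by rewrite -natrX ler_nat ltnW// ltn_expl.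
elim: k f Ff rf Hk => [|k IH] f Ff rf Hk.
  by move: Hk; rewrite expr0 mulr1 leNgt rf.
(* The index type depends on the piece, so it is packed together with the branches before a choice
   is made. *)
pose Q (i : 'I_n) (TP : {T : finType & T -> R -> R}) := let Psi := projT2 TP in
  [/\ forall t, F (Psi t),
    forall t t', t != t' -> f (Phi i (Psi t hi)) < f (Phi i (Psi t' lo)) \/
       f (Phi i (Psi t' hi)) < f (Phi i (Psi t lo)),
    forall t, sg * r <= f (Phi i (Psi t hi)) - f (Phi i (Psi t lo)) <= r
  & (sz (f \o Phi i) / r) `^ d <= #|projT1 TP|%:R].
have exQ i : exists TP, Q i TP.
  have Ffi := cs_comp S Ff (FPhi i); have /andP[s1 s2] := sPhi f i Ff.
  have [le_r|gt_r] := lerP (sz (f \o Phi i)) r.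
    exists (existT (fun T : finType => T -> R -> R) (unit : finType) (fun=> id)); split => //=.
    - by move=> _; exact: (cs_id S).
    - by move=> _; rewrite le_r andbT; apply: le_trans s1; rewrite ler_pM2l// ltW.
    have <- : 1 `^ d = #|{: unit}|%:R :> R by rewrite powR1 card_unit.
    apply: ge0_ler_powR => //; rewrite ?nnegrE ?ler01//.
      by rewrite divr_ge0 ?ltW// (cs_size_gt0 Ffi).
    by rewrite ler_pdivrMr// mul1r.
  have [|T [Psi H]] := IH _ Ffi gt_r.
    move: Hk; rewrite exprS /=; lra.
  by exists (existT (fun T : finType => T -> R -> R) T Psi).
have [TP HTP] := choice exQ.
exists {i : 'I_n & projT1 (TP i)}, (fun t => Phi (tag t) \o projT2 (TP (tag t)) (tagged t)).
split.
- by move=> [i t] /=; apply: (cs_comp S) => //; have [] := HTP i.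
- move=> [i t] [j t'] /=; have [ij|ij] := eqVneq i j.
    subst j; rewrite eq_Tagged /= => tt'.
    by have [_ h _ _] := HTP i; apply: h.
  move=> _; have [FP _ _ _] := HTP i; have [FP' _ _ _] := HTP j.
  have [h1 h2] := cs_nest (FPhi i) (FP t); have [h3 h4] := cs_nest (FPhi j) (FP' t').
  have := cs_hi (cs_comp S (FPhi i) (FP t)); have := cs_lo (cs_comp S (FPhi i) (FP t)).
  have := cs_hi (cs_comp S (FPhi j) (FP' t')); have := cs_lo (cs_comp S (FPhi j) (FP' t')).
  move=> /= /andP[? ?] /andP[? ?] /andP[? ?] /andP[? ?].
  by have [h|h] := dPhi _ _ ij; [left|right]; apply: (cs_incr S) => //; lra.
- by move=> [i t] /=; have [_ _ h _] := HTP i; apply: h.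
rewrite card_tagged sumnE big_map natr_sum.
(* Each piece has at least the fraction [sg] of the size, so the sum is at least [n * sg ^ d] times
   the required value. *)
apply: (@le_trans _ _ (\sum_(i <- enum 'I_n) (sg * sz f / r) `^ d)); last first.
  apply: ler_sum => i _; have [_ _ _ h] := HTP i; apply: le_trans h.
  have /andP[s1 s2] := sPhi f i Ff.
  apply: ge0_ler_powR; rewrite ?nnegrE ?divr_ge0 ?mulr_ge0 ?(ltW r0) ?(ltW sg0) ?(ltW (cs_size_gt0 Ff))//.
    by rewrite ltW// (cs_size_gt0 (cs_comp S Ff (FPhi i))).
  by rewrite ler_pM2r ?invr_gt0.
rewrite big_const_seq count_predT size_enum_ord iter_addr addr0 -mulr_natl.
have X0 : 0 <= sz f / r by rewrite divr_ge0 ?ltW// cs_size_gt0.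
have -> : sg * sz f / r = sg * (sz f / r) by rewrite mulrA.
rewrite [(sg * _) `^ d]powRM ?(ltW sg0)//.
rewrite [leRHS]mulrA ler_peMl ?powR_ge0//.
apply: le_trans (_ : sg^-1 `^ d * sg `^ d <= _); last by rewrite ler_wpM2r ?powR_ge0.
by rewrite -powRM ?invr_ge0 ?(ltW sg0)// mulVf ?gt_eqF// powR1.
Qed.

Lemma deep_branch d : branching lo hi F d -> forall r, 0 < r ->
  exists2 u, F u & sz u <= r.
Proof.
move=> [n [Phi [sg [sg0 FPhi _ sPhi nd]]]] r r0.
have n0 : (0 < n)%N.
  by rewrite -(ltr_nat R); apply: lt_le_trans nd; rewrite powR_gt0 ?invr_gt0.
have half k : exists2 u, F u & sz u * 2 ^+ k <= hi - lo.
  elim: k => [|k [u Fu Hu]]; first by exists id; [exact: (cs_id S)|rewrite expr0 mulr1].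
  exists (u \o Phi (Ordinal n0)); first exact: (cs_comp S).
  have /andP[_ h] := sPhi u (Ordinal n0) Fu; apply: le_trans Hu.
  rewrite exprS mulrA ler_pM2r ?exprn_gt0//=; lra.
have L0 : 0 < hi - lo by rewrite subr_gt0 (cs_lt S).
pose x := (hi - lo) / r; have x0 : 0 <= x by rewrite divr_ge0// ltW.
have /andP[_ x1] := truncn_itv x0.
have [u Fu Hu] := half (Num.truncn x).+1; exists u => //.
have : x <= 2 ^+ (Num.truncn x).+1.
  by apply: le_trans (ltW x1) _; rewrite -natrX ler_nat ltnW// ltn_expl.
rewrite ler_pdivrMr// mulrC => h.
by rewrite -(@ler_pM2r _ (2 ^+ (Num.truncn x).+1)) ?exprn_gt0// (le_trans Hu).
Qed.

(** On the image of a sufficiently small [u] every [f] is affine up to the factor [1 + eta], with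
    one [u] for all [f]. This lets a computation at [u] stand for all compositions [f \o u]. *)
Lemma deep_distortion d eta : branching lo hi F d -> 0 < eta ->
  exists2 u, F u & forall f x y x' y', F f ->
    lo <= x -> x < y -> y <= hi -> lo <= x' -> x' < y' -> y' <= hi ->
    (f (u y) - f (u x)) * (u y' - u x') <=
    (1 + eta) * (f (u y') - f (u x')) * (u y - u x).
Proof.
move=> br eta0; have [del del0 H] := cs_dist0 S eta0.
have [u Fu Hu] := deep_branch br del0; exists u => // f x y x' y' Ff lx xy yh lx' xy' yh'.
have /andP[? ?] := cs_lo Fu; have /andP[? ?] := cs_hi Fu.
have ux : u lo <= u x by apply: cs_le => //; lra.
have ux' : u lo <= u x' by apply: cs_le => //; lra.
have uy : u y <= u hi by apply: cs_le => //; lra.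
have uy' : u y' <= u hi by apply: cs_le => //; lra.
have uxy : u x < u y by apply: (cs_incr S).
have uxy' : u x' < u y' by apply: (cs_incr S).
apply: (H f (u lo)) => //; lra.
Qed.

End System.

Local Close Scope classical_set_scope.

(** * Trees of branches with a fixed ratio *)

Section Trees.
Variable R : realType.
Variables (lo hi : R) (K : set R) (F : set (R -> R)).
Hypothesis S : csystem lo hi K F.

Local Notation sz f := (f hi - f lo).

(* A word is read from its last letter: [i :: w] is a child of [w]. *)
Record branch_tree (u : R -> R) (sg : R) (q N : nat) (gam : seq 'I_N -> R -> R) :
    Prop := BranchTree {
  bt_nil : gam [::] = id;
  bt_in : forall w, F (gam w);
  bt_cons : forall i w, exists2 h, F h & gam (i :: w) = gam w \o h;
  bt_size : forall w, sg * q%:R ^- size w * sz u <= u (gam w hi) - u (gam w lo)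
    <= q%:R ^- size w * sz u;
  bt_disj : forall w i j, i != j ->
    u (gam (i :: w) hi) < u (gam (j :: w) lo) \/
    u (gam (j :: w) hi) < u (gam (i :: w) lo)
}.

(** A node of level [n] has size at least [sg * q ^- n]; cutting it into pieces of size about
    [q ^- (n + 1)] yields at least [(sg * q) ^ d] of them, of which [N] are kept. *)
Lemma branch_tree_exists d : branching lo hi F d -> 0 <= d ->
  exists2 sg : R, 0 < sg <= 2^-1 & forall (q N : nat) u, F u -> (0 < q)%N ->
    q%:R^-1 < sg -> N%:R <= (sg * q%:R) `^ d ->
    exists gam : seq 'I_N -> R -> R, branch_tree u sg q gam.
Proof.
move=> br d0; have [sg /andP[sg0 sg1] H] := subdivide S br d0.
exists sg; first by rewrite sg0.
move=> q N u Fu q0 qsg Nle; have Q0 : 0 < q%:R :> R by rewrite ltr0n.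
have L0 : 0 < sz u by exact: (cs_size_gt0 S).
(* The hypotheses on the node are put inside the relation, so that a step function can be chosen for
   all nodes at once; they are recovered by induction along the tree. *)
pose P (ng : nat * (R -> R)) (h : 'I_N -> R -> R) := F ng.2 ->
  sg * q%:R ^- ng.1 * sz u <= u (ng.2 hi) - u (ng.2 lo) ->
  [/\ forall i, F (h i),
    forall i, sg * q%:R ^- ng.1.+1 * sz u <= u (ng.2 (h i hi)) - u (ng.2 (h i lo))
      <= q%:R ^- ng.1.+1 * sz u
  & forall i j, i != j -> u (ng.2 (h i hi)) < u (ng.2 (h j lo)) \/
    u (ng.2 (h j hi)) < u (ng.2 (h i lo))].
have exP ng : exists h, P ng h.
  case: ng => n g.
  have [[Fg sg_le]|nP] := pselect (F g /\
      sg * q%:R ^- n * sz u <= u (g hi) - u (g lo)); last first.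
    by exists (fun=> id) => Fg le; case: nP.
  have Pn : 0 < q%:R ^- n :> R by rewrite invr_gt0 exprn_gt0.
  have qS : q%:R ^- n.+1 = q%:R^-1 * q%:R ^- n :> R by rewrite exprS invfM.
  pose r := q%:R ^- n.+1 * sz u.
  have r0 : 0 < r by rewrite mulr_gt0 ?invr_gt0 ?exprn_gt0.
  have rlt : r < sz (u \o g).
    apply: lt_le_trans sg_le; rewrite /r qS ltr_pM2r// ltr_pM2r//.
  have [T [Psi [FPsi dPsi sPsi cT]]] := H _ _ (cs_comp S Fu Fg) r0 rlt.
  have NT : (N <= #|T|)%N.
    rewrite -(ler_nat R); apply: le_trans Nle (le_trans _ cT).
    apply: ge0_ler_powR => //; rewrite ?nnegrE.
    - by rewrite mulr_ge0// ltW.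
    - by rewrite divr_ge0 ?ltW// (cs_size_gt0 S (cs_comp S Fu Fg)).
    rewrite ler_pdivlMr//; apply: le_trans sg_le.
    rewrite /r qS; set X := _ ^- n; set Y := sz u.
    by rewrite [leLHS](_ : _ = sg * X * Y * (q%:R * q%:R^-1)); [rewrite divff ?gt_eqF// mulr1|ring].
  pose e (i : 'I_N) : T := enum_val (widen_ord NT i).
  have einj i j : i != j -> e i != e j.
    apply: contra_neq => /enum_val_inj /(congr1 val) /= ij; exact: val_inj.
  exists (fun i => Psi (e i)) => _ _; split=> // [i|i j ij] /=.
    by have := sPsi (e i); rewrite /r mulrA.
  by apply: dPsi; exact: einj.
have [step Hstep] := choice exP.
pose gam := fix gam (w : seq 'I_N) : R -> R :=
  if w is i :: w' then gam w' \o step (size w', gam w') i else id.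
have inv w : F (gam w) /\ sg * q%:R ^- size w * sz u <= u (gam w hi) - u (gam w lo)
    <= q%:R ^- size w * sz u.
  elim: w => [|i w [Fw /andP[IH1 IH2]]] /=.
    split; first exact: (cs_id S).
    rewrite expr0 invr1 mulr1 mul1r lexx andbT -[leRHS]mul1r ler_pM2r//; lra.
  have [h1 h2 _] := Hstep (size w, gam w) Fw IH1.
  by split; [exact: (cs_comp S)|exact: h2].
exists gam; split=> // [w|i w|w|w i j ij].
- by have [] := inv w.
- have [Fw /andP[IH1 IH2]] := inv w; have [h1 _ _] := Hstep (size w, gam w) Fw IH1.
  by exists (step (size w, gam w) i).
- by have [] := inv w.
have [Fw /andP[IH1 IH2]] := inv w; have [_ _ h3] := Hstep (size w, gam w) Fw IH1.
exact: h3.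
Qed.

Section Tree.
Variables (u : R -> R) (sg : R) (q N : nat) (gam : seq 'I_N -> R -> R).
Hypotheses (Fu : F u) (sg0 : 0 < sg) (q0 : (0 < q)%N).
Hypothesis BT : branch_tree u sg q gam.

Lemma bt_ext v w : exists2 h, F h & gam (v ++ w) = gam w \o h.
Proof.
elim: v => [|i v [h Fh E]] /=; first by exists id => //; exact: (cs_id S).
have [h' Fh' ->] := bt_cons BT i (v ++ w); exists (h \o h'); first exact: (cs_comp S).
by rewrite E.
Qed.

Lemma bt_nest f v w : F f -> f (gam w lo) <= f (gam (v ++ w) lo) /\
  f (gam (v ++ w) hi) <= f (gam w hi).
Proof.
move=> Ff; have [h Fh ->] := bt_ext v w.
exact: (cs_nest S (cs_comp S Ff (bt_in BT w)) Fh).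
Qed.

Lemma bt_disjoint v v' w : size v = size v' -> v != v' ->
  u (gam (v ++ w) hi) < u (gam (v' ++ w) lo) \/
  u (gam (v' ++ w) hi) < u (gam (v ++ w) lo).
Proof.
elim: v v' => [|i v IH] [|i' v'] //= [sz_eq].
have [<-|vv' _] := eqVneq v v'.
  have [->|ii' _] := eqVneq i i'; first by rewrite eqxx.
  exact: (bt_disj BT).
have [h1 h2] := @bt_nest u [:: i] (v ++ w) Fu.
have [h3 h4] := @bt_nest u [:: i'] (v' ++ w) Fu.
have [h|h] := IH _ sz_eq vv'; [left|right].
- exact: le_lt_trans h2 (lt_le_trans h h3).
- exact: le_lt_trans h4 (lt_le_trans h h1).
Qed.

(** The ancestors of level [j] are disjoint, with lengths between [sg] and 1 times the scale, so at
    most about [(2 * B + 1) / sg] of them come within [B] scales of [x]; each has [N ^ (m - j)]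
    descendants. *)
Lemma bt_frostman w x (B j m : nat) : (j <= m)%N ->
  (#|[set v : m.-tuple 'I_N | (`|u (gam (v ++ w) lo) - x| <=
      B%:R * (q%:R ^- j * (q%:R ^- size w * sz u)))%R]| <=
    (Num.truncn ((2 * B%:R + 1) / sg)).+1 * N ^ (m - j))%N.
Proof.
move=> jm; have Q0 : 0 < q%:R :> R by rewrite ltr0n.
have L0 : 0 < sz u by exact: (cs_size_gt0 S).
pose D := q%:R ^- j * (q%:R ^- size w * sz u).
have D0 : 0 < D by rewrite /D !mulr_gt0 ?invr_gt0 ?exprn_gt0.
pose P (c : seq 'I_N) := (u (gam (c ++ w) lo) <= x + B%:R * D) &&
  (x - B%:R * D <= u (gam (c ++ w) hi)).
rewrite -sum1dep_card big_mkcond /=.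
apply: (@leq_trans (\sum_(v : m.-tuple 'I_N) (P v : nat))).
  apply: leq_sum => v _; rewrite -/D; case: ifP => // /ler_normlP[h1 h2].
  have := cs_comp_lt S Fu (bt_in BT (v ++ w)).
  rewrite lt0b /P; move=> h3; apply/andP; split; lra.
move: (m - j)%N (subnK jm) => k <-.
apply: leq_trans (sum_tuple_ext _ _ _) _.
  move=> i c /andP[h1 h2]; have [h3 h4] := @bt_nest u [:: i] (c ++ w) Fu.
  by apply/andP; split; [exact: le_trans h1|exact: le_trans h4].
rewrite card_ord mulnC leq_mul2r; apply/orP; right.
rewrite -big_mkcond sum1dep_card.
have sgD0 : 0 < sg * D by rewrite mulr_gt0.
have D'0 : 0 <= (2 * B%:R + 1) / sg by rewrite divr_ge0 ?(ltW sg0)// addr_ge0 ?mulr_ge0.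
have szc (c : j.-tuple 'I_N) : sg * D <= u (gam (c ++ w) hi) - u (gam (c ++ w) lo) <= D.
  have := bt_size BT (c ++ w); rewrite size_cat size_tuple exprD invfM.
  by rewrite /D !mulrA.
apply: (@card_separated R _ _ (fun c : j.-tuple 'I_N => u (gam (c ++ w) lo)) (x - B%:R * D - D) (sg * D)) => //.
  move=> c; rewrite inE => /andP[h1 h2]; have /andP[s1 s2] := szc c.
  have -> : (2 * B%:R + 1) / sg * (sg * D) = (2 * B%:R + 1) * D.
    by rewrite mulrA divfK ?gt_eqF.
  by rewrite mulrDl mul1r -mulrA; apply/andP; split; lra.
move=> c c' _ _ cc'; have /andP[s1 s2] := szc c; have /andP[s1' s2'] := szc c'.
have sz_eq : size c = size c' by rewrite !size_tuple.
have [h|h] := bt_disjoint w sz_eq cc'.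
  by rewrite distrC ger0_norm; lra.
by rewrite ger0_norm; lra.
Qed.

End Tree.
End Trees.

(** * Overlaps of the intervals of a sum *)

Section PairStep.
Variable R : realType.

Lemma branch_tree_le lo hi (F : set (R -> R)) u (sg sg' : R) q N
    (gam : seq 'I_N -> R -> R) : sg' <= sg -> 0 <= u hi - u lo ->
  branch_tree lo hi F u sg q gam -> branch_tree lo hi F u sg' q gam.
Proof.
move=> le_sg L0 [h1 h2 h3 h4 h5]; split=> // w; have /andP[s1 s2] := h4 w.
rewrite s2 andbT; apply: le_trans s1; rewrite !ler_wpM2r//.
Qed.

(** The hypothesis, applied to a subinterval against the whole interval and conversely, bounds the
    normalized differences of [f \o u] by those of [u] from both sides. *)
Lemma deep_difference lo hi K (F : set (R -> R)) u (eta : R) :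
  csystem lo hi K F -> F u -> 0 < eta ->
  (forall f x y x' y', F f ->
    lo <= x -> x < y -> y <= hi -> lo <= x' -> x' < y' -> y' <= hi ->
    (f (u y) - f (u x)) * (u y' - u x') <=
    (1 + eta) * (f (u y') - f (u x')) * (u y - u x)) ->
  forall f x y, F f -> lo <= x <= hi -> lo <= y <= hi ->
  `|(f (u x) - f (u y)) / (f (u hi) - f (u lo)) - (u x - u y) / (u hi - u lo)|
    <= eta * `|(u x - u y) / (u hi - u lo)|.
Proof.
move=> S Fu eta0 H f.
have key x y : F f -> lo <= x -> x < y -> y <= hi ->
    `|(f (u y) - f (u x)) / (f (u hi) - f (u lo)) - (u y - u x) / (u hi - u lo)|
    <= eta * `|(u y - u x) / (u hi - u lo)|.
  move=> Ff lx xy yh; have lohi := cs_lt S.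
  have L0 := cs_size_gt0 S Fu; have L1 := cs_size_gt0 S (cs_comp S Ff Fu).
  have h1 := H f x y lo hi Ff lx xy yh (lexx _) lohi (lexx _).
  have h2 := H f lo hi x y Ff (lexx _) lohi (lexx _) lx xy yh.
  have uxy : 0 < u y - u x by rewrite subr_gt0; apply: (cs_incr S).
  move: L0 L1 h1 h2 uxy => /=; set L := u hi - u lo; set L' := f (u hi) - f (u lo).
  set d := u y - u x; set d' := f (u y) - f (u x) => L0 L1 h1 h2 d0.
  have g1 : d' / L' <= (1 + eta) * (d / L).
    rewrite ler_pdivrMr// mulrAC [leRHS](_ : _ = (1 + eta) * L' * d / L); last by ring.
    by rewrite ler_pdivlMr.
  have g2 : d / L <= (1 + eta) * (d' / L').
    rewrite ler_pdivrMr// mulrAC [leRHS](_ : _ = (1 + eta) * d' * L / L'); last by ring.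
    by rewrite ler_pdivlMr// mulrC.
  have p0 : 0 < d / L by rewrite divr_gt0.
  rewrite [X in _ <= _ * X]gtr0_norm// ler_norml; apply/andP; split; last lra.
  (* For [eta > 1] the lower bound is negative, hence trivial. *)
  have : (1 - eta) * (d / L) <= (1 - eta ^+ 2) * (d' / L') \/ 1 - eta < 0.
    have [e1|e1] := lerP 0 (1 - eta); [left|by right].
    have := ler_wpM2l e1 g2; rewrite mulrA; lra.
  have d'0 : 0 < d' / L'.
    by have := lt_le_trans p0 g2; rewrite pmulr_rgt0//; lra.
  case=> [h|h].
    have : 0 <= eta ^+ 2 * (d' / L') by rewrite mulr_ge0 ?exprn_ge0 ?ltW.
    lra.
  have : (1 - eta) * (d / L) < 0 by rewrite nmulr_rlt0.
  lra.
move=> x y Ff /andP[lx xh] /andP[ly yh].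
have [xy|xy|->] := ltgtP x y; last by rewrite !subrr !mul0r subr0 normr0 mulr0.
  have := key x y Ff lx xy yh.
  rewrite -[_ / _ - _]opprK normrN [X in `|X|](_ : _ =
    (f (u x) - f (u y)) / (f (u hi) - f (u lo)) - (u x - u y) / (u hi - u lo)); last by ring.
  by rewrite -[in X in _ -> X](normrN (_ / (u hi - u lo))) -[- (_ / _)]mulNr opprB.
exact: key.
Qed.

(** Here [13 = 8 + 1 + 3 + 1]: the actual overlap, the error on [a], the error on [a'] multiplied by
    a slope at most 3, and the error on the slope. *)
Lemma overlap_estimate (a a' b b' e rho tau th : R) :
  0 < e -> 0 < rho -> 0 <= th <= 3 ->
  `|a'| <= rho -> `|b - a| <= e * rho -> `|b' - a'| <= e * rho ->
  `|th - tau| <= e -> `|b + th * b'| <= 8 * e * rho ->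
  `|a / rho + tau * (a' / rho)| <= 13%:R * e.
Proof.
move=> e0 rho0 /andP[th0 th3] a'1 ba ba' tt bb.
have -> : a / rho + tau * (a' / rho) = (a + tau * a') / rho by ring.
rewrite normrM normfV (gtr0_norm rho0) ler_pdivrMr//.
have -> : a + tau * a' = (b + th * b') - (b - a) - th * (b' - a') - (th - tau) * a' by ring.
have h1 : `|th * (b' - a')| <= 3 * (e * rho).
  by rewrite normrM (ger0_norm th0) ler_pM.
have h2 : `|(th - tau) * a'| <= e * rho by rewrite normrM ler_pM.
apply: le_trans (ler_normB _ _) _; apply: le_trans (lerD (ler_normB _ _) h2) _.
apply: le_trans (lerD (lerD (ler_normB _ _) h1) (lexx _)) _; lra.
Qed.

Variables (lo hi : R) (K : set R) (F : set (R -> R)).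
Variables (lo' hi' : R) (K' : set R) (F' : set (R -> R)).
Hypotheses (S : csystem lo hi K F) (S' : csystem lo' hi' K' F').
Variables (q N N' m h : nat) (sg : R).
Hypotheses (q0 : (0 < q)%N) (N0 : (0 < N)%N) (N'0 : (0 < N')%N).
Hypotheses (NN' : (N * N' <= q)%N) (h0 : (0 < h)%N) (sg0 : 0 < sg).
Variables (u u' : R -> R) (gam : seq 'I_N -> R -> R) (gam' : seq 'I_N' -> R -> R).
Hypotheses (Fu : F u) (Fu' : F' u').
Hypotheses (BT : branch_tree lo hi F u sg q gam)
  (BT' : branch_tree lo' hi' F' u' sg q gam').

Definition block := (m.-tuple 'I_N * m.-tuple 'I_N')%type.
Definition word1 (W : seq block) : seq 'I_N := flatten [seq val b.1 | b <- W].
Definition word2 (W : seq block) : seq 'I_N' := flatten [seq val b.2 | b <- W].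

Lemma size_word1 W : size (word1 W) = (size W * m)%N.
Proof. by elim: W => //= b W IH; rewrite size_cat IH size_tuple mulSn. Qed.

Lemma size_word2 W : size (word2 W) = (size W * m)%N.
Proof. by elim: W => //= b W IH; rewrite size_cat IH size_tuple mulSn. Qed.

(** The Frostman constant for the radius [B = 13 + 2] required by [grid_count], so that
    [31 = 2 * 15 + 1]. Likewise [27 = 2 * 13 + 1] below. *)
Let C := (Num.truncn (31%:R / sg)).+1.
Definition multiplicity := (C * C * 27 * m.+1 * q)%N.

Let rho (W : seq block) : R := q%:R ^- (size W * m).
Let L := u hi - u lo.
Let L' := u' hi' - u' lo'.

(** Only the reference pair [(u, u')] appears: the relation does not depend on the actual pair
    [(f, f')], and the tolerance [13 * q ^- m] leaves room for passing from one to the other. *)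
Definition overlap (tau : R) (W : seq block) (b b2 : block) : bool :=
  `|(u (gam (b.1 ++ word1 W) lo) - u (gam (b2.1 ++ word1 W) lo)) / (rho W * L) +
    tau * ((u' (gam' (b.2 ++ word2 W) lo') - u' (gam' (b2.2 ++ word2 W) lo')) / (rho W * L'))|
    <= 13%:R * q%:R ^- m.

Let slope k : R := 1 + k%:R * q%:R ^- m.

Lemma overlap_count W b :
  (\sum_(k < q ^ m) \sum_b2 overlap (slope k) W b b2 <= multiplicity * q ^ m)%N.
Proof.
have Q0 : 0 < q%:R :> R by rewrite ltr0n.
have rho0 : 0 < rho W by rewrite invr_gt0 exprn_gt0.
have L0 : 0 < L by exact: (cs_size_gt0 S).
have L'0 : 0 < L' by exact: (cs_size_gt0 S').
have frost (B n0 n1 : nat) : (B <= 15)%N ->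
   (n0 <= (Num.truncn ((2 * B%:R + 1) / sg)).+1 * n1)%N -> (n0 <= C * n1)%N.
  move=> B15 le; apply: leq_trans le _; rewrite leq_mul2r; apply/orP; right.
  rewrite /C ltnS; apply: le_truncn; rewrite ler_pM2r ?invr_gt0//.
  have : B%:R <= 15%:R :> R by rewrite ler_nat.
  lra.
apply: (@grid_count R _ _
  (fun t : m.-tuple 'I_N => (u (gam (b.1 ++ word1 W) lo) - u (gam (t ++ word1 W) lo)) / (rho W * L))
  (fun t : m.-tuple 'I_N' => (u' (gam' (b.2 ++ word2 W) lo') - u' (gam' (t ++ word2 W) lo')) / (rho W * L'))
  q m C N N' 13) => //.
- move=> t; rewrite normrM normfV (gtr0_norm (mulr_gt0 rho0 L'0)) ler_pdivrMr ?mulr_gt0// mul1r.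
  have [h1 h2] := bt_nest S' BT' b.2 (word2 W) Fu'.
  have [h3 h4] := bt_nest S' BT' t (word2 W) Fu'.
  have h5 := cs_comp_lt S' Fu' (bt_in BT' (b.2 ++ word2 W)).
  have h6 := cs_comp_lt S' Fu' (bt_in BT' (t ++ word2 W)).
  have /andP[_] := bt_size BT' (word2 W); rewrite size_word2 -/(rho W) -/L' => h7.
  by rewrite ler_norml; apply/andP; split; lra.
- move=> j jm; apply: (frost 15%N) => //.
  apply: leq_trans (bt_frostman S Fu sg0 q0 BT (word1 W) (u (gam (b.1 ++ word1 W) lo)) 15 jm).
  apply/subset_leq_card/fintype.subsetP => t; rewrite !inE size_word1 -/(rho W) -/L.
  rewrite normrM normfV (gtr0_norm (mulr_gt0 rho0 L0)) ler_pdivrMr ?mulr_gt0//.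
  by rewrite distrC mulrA.
- move=> j jm; apply: (frost 1%N) => //.
  apply: leq_trans (bt_frostman S' Fu' sg0 q0 BT' (word2 W) (u' (gam' (b.2 ++ word2 W) lo')) 1 jm).
  apply/subset_leq_card/fintype.subsetP => t; rewrite !inE size_word2 -/(rho W) -/L'.
  rewrite normrM normfV (gtr0_norm (mulr_gt0 rho0 L'0)) ler_pdivrMr ?mulr_gt0//.
  by rewrite distrC mul1r.
Qed.

Definition bad_step (k : nat) (W : seq block) (b : block) : bool :=
  (multiplicity * h < \sum_b2 overlap (slope k) W b b2)%N.

Lemma multiplicity_gt0 : (0 < multiplicity)%N.
Proof. by rewrite /multiplicity !muln_gt0. Qed.

(** On average over the grid a block overlaps at most [multiplicity] others, so a given step is bad
    for at most a fraction [1 / h] of the slopes, as [few_bad_steps] requires. *)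
Lemma good_slope M : exists2 k, (k < q ^ m)%N & (#|{: block}| ^ (h * M) <=
    2 * #|[set W : (h * M).-tuple block | nbad (bad_step k) W <= 2 * M]|)%N.
Proof.
have [|W b|k Hk] := @few_bad_steps _ (q ^ m) h M (fun k => bad_step k) _ h0.
- by rewrite expn_gt0 q0.
- rewrite -(@leq_pmul2l multiplicity) ?multiplicity_gt0//.
  apply: leq_trans (overlap_count W b); rewrite mulnA big_distrr /=.
  apply: leq_sum => k _; rewrite /bad_step.
  by case: ltnP; rewrite ?muln0// muln1 => /ltnW.
by exists k => //; rewrite -sum1dep_card big_mkcond.
Qed.

Section ActualSum.
Variables (f f' : R -> R) (s : R) (k M : nat).
Hypotheses (Ff : F f) (Ff' : F' f') (s0 : 0 < s) (kq : (k < q ^ m)%N).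
Hypothesis few_bad : (#|{: block}| ^ (h * M) <=
  2 * #|[set W : (h * M).-tuple block | nbad (bad_step k) W <= 2 * M]|)%N.
Hypothesis Hu : forall g x y x' y', F g ->
  lo <= x -> x < y -> y <= hi -> lo <= x' -> x' < y' -> y' <= hi ->
  (g (u y) - g (u x)) * (u y' - u x') <=
  (1 + q%:R ^- m) * (g (u y') - g (u x')) * (u y - u x).
Hypothesis Hu' : forall g x y x' y', F' g ->
  lo' <= x -> x < y -> y <= hi' -> lo' <= x' -> x' < y' -> y' <= hi' ->
  (g (u' y) - g (u' x)) * (u' y' - u' x') <=
  (1 + q%:R ^- m) * (g (u' y') - g (u' x')) * (u' y - u' x).

Let Lf := f (u hi) - f (u lo).
Let Lf' := f' (u' hi') - f' (u' lo').
Let th := s * Lf' / Lf.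
Hypothesis th_slope : `|th - slope k| <= q%:R ^- m.

Definition sum_lo (W : seq block) :=
  f (u (gam (word1 W) lo)) + s * f' (u' (gam' (word2 W) lo')).
Definition sum_hi (W : seq block) :=
  f (u (gam (word1 W) hi)) + s * f' (u' (gam' (word2 W) hi')).

Let Q0 : @Order.lt _ R 0 q%:R. Proof. by rewrite ltr0n. Qed.
Let e0 : @Order.lt _ R 0 (q%:R ^- m). Proof. by rewrite invr_gt0 exprn_gt0. Qed.
Let e1 : @Order.le _ R (q%:R ^- m) 1.
Proof. by rewrite invf_le1 ?exprn_gt0// exprn_ege1// ler1n. Qed.
Let e01 : forall x : R, x = q%:R ^- m -> 0 < x <= 1.
Proof. by move=> x ->; rewrite e0 e1. Qed.
Let rho0 W : 0 < rho W. Proof. by rewrite invr_gt0 exprn_gt0. Qed.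
Let L0 : 0 < L. Proof. exact: (cs_size_gt0 S). Qed.
Let L'0 : 0 < L'. Proof. exact: (cs_size_gt0 S'). Qed.
Let Lf0 : 0 < Lf. Proof. exact: (cs_size_gt0 S (cs_comp S Ff Fu)). Qed.
Let Lf'0 : 0 < Lf'. Proof. exact: (cs_size_gt0 S' (cs_comp S' Ff' Fu')). Qed.

Let slope_le : 1 <= slope k <= 2.
Proof.
rewrite /slope lerDl mulr_ge0 ?(ltW e0)//=.
have : k%:R * q%:R ^- m <= 1 :> R.
  by rewrite ler_pdivrMr ?exprn_gt0// mul1r -natrX ler_nat ltnW.
lra.
Qed.

Let th_bounds : 0 < th <= 3.
Proof.
have /andP[e0' e1'] := e01 (erefl (q%:R ^- m)).
have /andP[h1 h2] := slope_le; move: th_slope; rewrite ler_norml => /andP[h3 h4].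
apply/andP; split; last lra.
by rewrite divr_gt0// mulr_gt0.
Qed.

Let len1 W : sg * rho W / 2 <=
  (f (u (gam (word1 W) hi)) - f (u (gam (word1 W) lo))) / Lf <= 2 * rho W.
Proof.
have /andP[s1 s2] := bt_size BT (word1 W); rewrite size_word1 -/(rho W) -/L in s1 s2.
have d0 := cs_comp_lt S Fu (bt_in BT (word1 W)); have lohi := cs_lt S.
have /andP[g1 g2] := cs_lo S (bt_in BT (word1 W)).
have /andP[g3 g4] := cs_hi S (bt_in BT (word1 W)).
have g5 : gam (word1 W) lo < gam (word1 W) hi by apply: (cs_incr S (bt_in BT _)).
have k1 := Hu Ff g1 g5 g4 (lexx _) lohi (lexx _).
have k2 := Hu Ff (lexx _) lohi (lexx _) g1 g5 g4.
rewrite -/L -/Lf in k1 k2; move: d0 s1 s2 k1 k2 (rho0 W) => {g1 g2 g3 g4 g5}.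
set a := u (gam _ hi) - _; set b := f (u (gam _ hi)) - _.
rewrite -subr_gt0 -/a => a0 s1 s2 k1 k2 r0.
have sr0 : 0 < sg * rho W by rewrite mulr_gt0.
apply/andP; split.
  rewrite ler_pdivlMr// -(ler_pM2r L0).
  have b0 : 0 < b by rewrite subr_gt0 (cs_comp_lt S (cs_comp S Ff Fu) (bt_in BT _)).
  have : (1 + q%:R ^- m) * b * L <= 2 * b * L.
    by rewrite ler_pM2r// ler_pM2r//; have /andP[? ?] := e01 (erefl (q%:R ^- m)); lra.
  have : Lf * (sg * rho W * L) <= Lf * a by rewrite ler_pM2l.
  lra.
rewrite ler_pdivrMr// -(ler_pM2r L0); apply: le_trans k1 _.
have h1 : (1 + q%:R ^- m) * Lf * a <= 2 * Lf * a.
  by rewrite ler_pM2r// ler_pM2r//; have /andP[? ?] := e01 (erefl (q%:R ^- m)); lra.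
have h2 : Lf * a <= Lf * (rho W * L) by rewrite ler_pM2l.
lra.
Qed.

Let len2 W : 0 < f' (u' (gam' (word2 W) hi')) - f' (u' (gam' (word2 W) lo'))
   <= 2 * rho W * Lf'.
Proof.
have /andP[s1 s2] := bt_size BT' (word2 W); rewrite size_word2 -/(rho W) -/L' in s1 s2.
have d0 := cs_comp_lt S' Fu' (bt_in BT' (word2 W)); have lohi := cs_lt S'.
have /andP[g1 g2] := cs_lo S' (bt_in BT' (word2 W)).
have /andP[g3 g4] := cs_hi S' (bt_in BT' (word2 W)).
have g5 : gam' (word2 W) lo' < gam' (word2 W) hi' by apply: (cs_incr S' (bt_in BT' _)).
have k1 := Hu' Ff' g1 g5 g4 (lexx _) lohi (lexx _).
have := cs_comp_lt S' (cs_comp S' Ff' Fu') (bt_in BT' (word2 W)).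
rewrite -/L' -/Lf' /= in k1 *; move: d0 s1 s2 k1 (rho0 W) => {g1 g2 g3 g4 g5}.
set a := u' (gam' _ hi') - _; set b := f' (u' (gam' _ hi')) - _.
move=> d0 s1 s2 k1 r0 d1.
have a0 : 0 < a by rewrite subr_gt0.
have -> : 0 < b by rewrite subr_gt0.
rewrite /= -(ler_pM2r L'0); apply: le_trans k1 _.
have h1 : (1 + q%:R ^- m) * Lf' * a <= 2 * Lf' * a.
  by rewrite ler_pM2r// ler_pM2r//; have /andP[? ?] := e01 (erefl (q%:R ^- m)); lra.
have h2 : Lf' * a <= Lf' * (rho W * L') by rewrite ler_pM2l.
lra.
Qed.

(** Both relative lengths are within a factor 2 of the reference ones, and the slope [th] is at most
    3: the upper constant is [8 = 2 + 2 * 3]. *)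
Let sum_len W : Lf * (sg * rho W / 2) <= sum_hi W - sum_lo W <= Lf * (8 * rho W).
Proof.
have /andP[h1 h2] := len1 W; have /andP[h3 h4] := len2 W.
rewrite ler_pdivlMr// in h1; rewrite ler_pdivrMr// in h2.
have /andP[t0 t3] := th_bounds.
have E : sum_hi W - sum_lo W = (f (u (gam (word1 W) hi)) - f (u (gam (word1 W) lo))) +
   s * (f' (u' (gam' (word2 W) hi')) - f' (u' (gam' (word2 W) lo'))).
  by rewrite /sum_hi /sum_lo; ring.
rewrite E; move: h1 h2 h3 h4; set A := f _ - f _; set B := f' _ - f' _ => h1 h2 h3 h4.
have sB0 : 0 < s * B by rewrite mulr_gt0.
have sB : s * B <= 6 * (Lf * rho W).
  have h5 : s * B <= s * (2 * rho W * Lf') by rewrite ler_pM2l.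
  have h6 : s * Lf' = th * Lf by rewrite /th divfK ?gt_eqF.
  have h7 : th * (Lf * rho W) <= 3 * (Lf * rho W) by rewrite ler_pM2r// mulr_gt0.
  have h8 : s * (2 * rho W * Lf') = 2 * (th * (Lf * rho W)).
    have -> : 2 * (th * (Lf * rho W)) = 2 * rho W * (th * Lf) by ring.
    by rewrite -h6; ring.
  by rewrite h8 in h5; lra.
by apply/andP; split; lra.
Qed.

Let sum_nest b W : sum_lo W <= sum_lo (b :: W) /\ sum_hi (b :: W) <= sum_hi W.
Proof.
have [h1 h2] := bt_nest S BT b.1 (word1 W) (cs_comp S Ff Fu).
have [h3 h4] := bt_nest S' BT' b.2 (word2 W) (cs_comp S' Ff' Fu').
by split; apply: lerD => //; rewrite ler_pM2l.
Qed.

(** A common point puts the left ends within one interval length, [8 * q ^- m] relative to the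
    parent. Near affinity of [f \o u] and [f' \o u'] transfers this to the reference pair. *)
Let meet_overlap x W b b2 : sum_lo (b :: W) <= x <= sum_hi (b :: W) ->
  sum_lo (b2 :: W) <= x <= sum_hi (b2 :: W) -> overlap (slope k) W b b2.
Proof.
move=> /andP[x1 x2] /andP[x3 x4].
have /andP[_ l1] := sum_len (b :: W); have /andP[_ l2] := sum_len (b2 :: W).
have rS b0 : rho (b0 :: W) = q%:R ^- m * rho W by rewrite /rho /= mulSn exprD invfM.
rewrite !rS in l1 l2.
have /andP[t0 t3] := th_bounds.
have G1 (v : m.-tuple 'I_N) := bt_in BT (v ++ word1 W).
have G2 (v : m.-tuple 'I_N') := bt_in BT' (v ++ word2 W).
have A1 := deep_difference S Fu e0 Hu Ff (cs_lo S (G1 b.1)) (cs_lo S (G1 b2.1)).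
have A2 := deep_difference S' Fu' e0 Hu' Ff' (cs_lo S' (G2 b.2)) (cs_lo S' (G2 b2.2)).
have in1 : `|(u (gam (b.1 ++ word1 W) lo) - u (gam (b2.1 ++ word1 W) lo)) / L| <= rho W.
  rewrite normrM normfV (gtr0_norm L0) ler_pdivrMr//.
  have [h1 h2] := bt_nest S BT b.1 (word1 W) Fu.
  have [h3 h4] := bt_nest S BT b2.1 (word1 W) Fu.
  have h5 := cs_comp_lt S Fu (G1 b.1); have h6 := cs_comp_lt S Fu (G1 b2.1).
  have /andP[_] := bt_size BT (word1 W); rewrite size_word1 -/(rho W) -/L => h7.
  by rewrite ler_norml; apply/andP; split; lra.
have in2 : `|(u' (gam' (b.2 ++ word2 W) lo') - u' (gam' (b2.2 ++ word2 W) lo')) / L'| <= rho W.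
  rewrite normrM normfV (gtr0_norm L'0) ler_pdivrMr//.
  have [h1 h2] := bt_nest S' BT' b.2 (word2 W) Fu'.
  have [h3 h4] := bt_nest S' BT' b2.2 (word2 W) Fu'.
  have h5 := cs_comp_lt S' Fu' (G2 b.2); have h6 := cs_comp_lt S' Fu' (G2 b2.2).
  have /andP[_] := bt_size BT' (word2 W); rewrite size_word2 -/(rho W) -/L' => h7.
  by rewrite ler_norml; apply/andP; split; lra.
have E (c d g : R) : c / (d * g) = c / g / d by rewrite invfM mulrCA mulrC.
rewrite /overlap !E.
rewrite -/L -/Lf in A1; rewrite -/L' -/Lf' in A2.
apply: (overlap_estimate e0 (rho0 W) _ in2 _ _ th_slope); first by rewrite (ltW t0).
- by apply: le_trans A1 _; rewrite ler_pM2l.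
- by apply: le_trans A2 _; rewrite ler_pM2l.
set A := f _ - f _; set B := f' _ - f' _.
have -> : A / Lf + th * (B / Lf') = (sum_lo (b :: W) - sum_lo (b2 :: W)) / Lf.
  rewrite /th /sum_lo /= -/A; set X := Lf; set Y := Lf'.
  have Y0 : Y != 0 by rewrite gt_eqF. have X0 : X != 0 by rewrite gt_eqF.
  rewrite [s * Y / X * _](_ : _ = s * B / X); last by field; rewrite X0 Y0.
  by rewrite /A /B; ring.
rewrite normrM normfV (gtr0_norm Lf0) ler_pdivrMr// ler_norml.
by apply/andP; split; lra.
Qed.

(** Half of the words have few bad steps, and for those each point lies in a bounded number of
    intervals; a disjoint subfamily is then extracted. The ratio [16 / sg] is that of the two bounds
    in [sum_len]. *)
Lemma disjoint_sums : exists D : {set (h * M).-tuple block},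
  [/\ forall W W', W \in D -> W' \in D -> W != W' ->
    sum_hi W < sum_lo W' \/ sum_hi W' < sum_lo W
  & (#|{: block}| ^ (h * M) <= #|D| * (2 * ((Num.truncn (16%:R / sg)).+2 *
    ((2 * (multiplicity * h)) ^ (h * M) * #|{: block}| ^ (2 * M)))))%N].
Proof.
pose A := [set W : (h * M).-tuple block | nbad (bad_step k) W <= 2 * M]%N.
pose r : R := q%:R ^- (h * M * m).
have rE (W : (h * M).-tuple block) : rho W = r by rewrite /rho size_tuple.
have r0 : 0 < r by rewrite invr_gt0 exprn_gt0.
pose len := Lf * (sg * r / 2).
have len0 : 0 < len by rewrite !mulr_gt0.
have T0 : (0 < #|{: block}|)%N.
  by rewrite card_prod !card_tuple !card_ord muln_gt0 !expn_gt0 N0 N'0.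
have X0 : 0 <= 16%:R / sg by rewrite divr_ge0 ?(ltW sg0).
have /andP[_ X1] := truncn_itv X0.
have HA t : t \in A -> len <= sum_hi t - sum_lo t <= (Num.truncn (16%:R / sg)).+1%:R * len.
  move=> _; have /andP[h1 h2] := sum_len t; rewrite rE in h1 h2.
  rewrite h1; apply: le_trans h2 _; rewrite /len.
  rewrite [leLHS](_ : _ = 16%:R / sg * (Lf * (sg * r / 2))).
    by rewrite ler_pM2r// ltW.
  by field; rewrite gt_eqF.
have HM x : (#|[set t in A | (sum_lo t <= x <= sum_hi t)%R]| <=
    (2 * (multiplicity * h)) ^ (h * M) * #|{: block}| ^ (2 * M))%N.
  rewrite -sum1dep_card big_mkcond /=.
  rewrite (eq_bigr (fun W : (h * M).-tuple block =>
     ((sum_lo W <= x <= sum_hi W) && (nbad (bad_step k) W <= 2 * M)%N : nat))); last first.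
    by move=> W _; rewrite inE andbC; case: ifP.
  apply: (@few_bad_multiplicity _ (bad_step k) (fun W => sum_lo W <= x <= sum_hi W)) => //.
  - by rewrite muln_gt0 multiplicity_gt0.
  - move=> b W /andP[h1 h2]; have [h3 h4] := sum_nest b W.
    by apply/andP; split; [exact: le_trans h1|exact: le_trans h4].
  move=> W; have [/existsP[b /andP[xb gb]]|] :=
    boolP [exists b, (sum_lo (b :: W) <= x <= sum_hi (b :: W)) && ~~ bad_step k W b].
    move: gb; rewrite /bad_step -leqNgt; apply: leq_trans.
    apply: leq_sum => b2 _; case E: (sum_lo (b2 :: W) <= x <= sum_hi (b2 :: W)) => //=.
    by rewrite (meet_overlap xb E) leq_b1.
  rewrite negb_exists => /forallP nb; rewrite big1// => b _.
  by rewrite (negbTE (nb b)).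
have [D [DA dD cD]] := disjoint_subfamily len0 HA HM.
exists D; split=> //; apply: leq_trans few_bad _.
by rewrite mulnCA leq_mul2l.
Qed.

End ActualSum.
End PairStep.

(** * Dimension of sums of two systems *)

Local Open Scope classical_set_scope.
Local Open Scope ring_scope.

Section Adjust.
Variable R : realType.
Variables (lo hi : R) (K : set R) (F : set (R -> R)).
Hypothesis S : csystem lo hi K F.

Local Notation sz f := (f hi - f lo).

Lemma cs_iter f n : F f -> F (iter n f).
Proof.
move=> Ff; elim: n => [|n IH]; first exact: (cs_id S).
exact: (cs_comp S Ff IH).
Qed.

(** Sizes are multiplicative up to a constant: bounded distortion compares the mean slope of [f]
    over the image of [g] with that over the whole interval. *)
Lemma cs_comp_bounds : exists2 C : R, 0 < C & forall f g, F f -> F g ->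
  f (g hi) - f (g lo) <= C * sz f * sz g /\
  sz f * sz g <= C * (f (g hi) - f (g lo)).
Proof.
have [C C0 H] := cs_dist S; have lohi := cs_lt S.
have D0 : 0 < hi - lo by rewrite subr_gt0.
exists (C / (hi - lo) + C * (hi - lo)); first by rewrite addr_gt0 ?divr_gt0 ?mulr_gt0.
move=> f g Ff Fg.
have /andP[g1 g2] := cs_lo S Fg; have /andP[g3 g4] := cs_hi S Fg.
have g5 : g lo < g hi by apply: (cs_incr S).
have h1 := H f _ _ _ _ Ff g1 g5 g4 (lexx _) lohi (lexx _).
have h2 := H f _ _ _ _ Ff (lexx _) lohi (lexx _) g1 g5 g4.
have p1 := cs_size_gt0 S Ff; have p2 := cs_size_gt0 S Fg.
have p3 : 0 < f (g hi) - f (g lo) by rewrite subr_gt0; apply: (cs_incr S).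
move: h1 h2 p1 p2 p3; set a := f (g hi) - _; set b := f hi - _; set c := g hi - _.
set D := hi - lo in D0 * => h1 h2 p1 p2 p3.
have E1 : (C / D + C * D) * b * c = C / D * b * c + C * D * b * c by ring.
have E2 : (C / D + C * D) * a = C / D * a + C * D * a by ring.
rewrite E1 E2; split.
  have h3 : a <= C / D * b * c.
    rewrite [leRHS](_ : _ = C * b * c / D); last by ring.
    by rewrite ler_pdivlMr.
  by apply: le_trans h3 _; rewrite lerDl !mulr_ge0 ?ltW.
have h3 : 0 < C / D * a by rewrite !mulr_gt0 ?invr_gt0.
apply: le_trans h2 _; rewrite [C * a * D](_ : _ = C * D * a); last by ring.
by rewrite lerDr ltW.
Qed.

(* The sizes of [f A^i B^j u], [i + j = n], form a chain with ratios in
   [1 + kap, 1 + del], and the chains for consecutive [n] overlap once [n] is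
   large. *)
Lemma adjust u del : toggling lo hi F -> F u -> 0 < del ->
  exists2 c : R, 0 < c & forall f x, F f -> 0 < x -> x <= c * sz f ->
  exists2 b, F b & x <= f (b (u hi)) - f (b (u lo)) <= (1 + del) * x.
Proof.
move=> tog Fu del0; have [A [B [kap [FA FB kap0 half step]]]] := tog _ del0.
have [C C0 CH] := cs_comp_bounds.
have [C' C'0 dist] := cs_dist S.
pose z (f : R -> R) i j := f (iter i A (iter j B (u hi))) - f (iter i A (iter j B (u lo))).
have zstep f i j : F f -> (1 + kap) * z f i j.+1 <= z f i.+1 j <= (1 + del) * z f i j.+1.
  move=> Ff; rewrite /z ![iter i.+1 A _]iterSr.
  exact: (step _ _ (cs_comp S Ff (cs_iter i FA)) (cs_comp S (cs_iter j FB) Fu)).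
have z0 f i j : F f -> 0 < z f i j.
  move=> Ff; exact: (cs_size_gt0 S (cs_comp S Ff (cs_comp S (cs_iter i FA) (cs_comp S (cs_iter j FB) Fu)))).
(* By bounded distortion, one more letter [B] shrinks a size by at most the factor [cB], whatever
   the context. *)
pose cB := sz (B \o u) / (C' * sz u).
have szu0 := cs_size_gt0 S Fu.
have cB0 : 0 < cB by rewrite divr_gt0 ?mulr_gt0 ?(cs_size_gt0 S (cs_comp S FB Fu)).
have zB f j : F f -> cB * z f 0%N j <= z f 0%N j.+1.
  move=> Ff; have Fg := cs_comp S Ff (cs_iter j FB).
  have /andP[g1 g2] := cs_lo S Fu; have /andP[g3 g4] := cs_hi S Fu.
  have g5 : u lo < u hi by apply: (cs_incr S); rewrite ?(cs_lt S).
  have FBu := cs_comp S FB Fu.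
  have /andP[b1 b2] := cs_lo S FBu; have /andP[b3 b4] := cs_hi S FBu.
  have b5 := cs_comp_lt S FB Fu.
  have := dist _ _ _ _ _ Fg g1 g5 g4 b1 b5 b4.
  rewrite /z /= -!iterSr /cB; set X := f _ - f _; set Y := f _ - f _.
  by move=> hd; rewrite [leLHS]mulrAC ler_pdivrMr ?mulr_gt0//=; move: hd; set P := B _ - _; set Q := u hi - _; lra.
have zhalf f j : F f -> z f 0%N j <= sz f / 2 ^+ j.
  move=> Ff; apply: (@le_trans _ _ (sz (f \o iter j B))).
    have [h1 h2] := cs_nest S (cs_comp S Ff (cs_iter j FB)) Fu.
    by rewrite /z /=; apply: lerB.
  elim: j => [|j IH]; first by rewrite expr0 divr1.
  apply: (@le_trans _ _ (sz (f \o iter j B) / 2)).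
    have := half _ (cs_comp S Ff (cs_iter j FB)).
    by rewrite /= -!iterSr.
  rewrite exprS invfM; set X := _ ^- j in IH *; lra.
(* After [n0] exchanges of [B] for [A] the size has regained the factor lost by one extra [B], so
   consecutive chains overlap from [n0] on. *)
have [n0 Hn0] : exists n0, 1 <= (1 + kap) ^+ n0 * cB.
  pose y := (kap * cB)^-1; have y0 : 0 <= y by rewrite invr_ge0 mulr_ge0// ltW.
  exists (Num.truncn y).+1; have /andP[_ y1] := truncn_itv y0.
  set n0 := (Num.truncn y).+1 in y1 *.
  have : 1 + n0%:R * kap <= (1 + kap) ^+ n0.
    elim: n0 {y1} => [|n IH]; first by rewrite mul0r addr0 expr0.
    rewrite exprS; have : (1 + kap) * (1 + n%:R * kap) <= (1 + kap) * (1 + kap) ^+ n.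
      by rewrite ler_pM2l//; lra.
    have : 0 <= kap * (n%:R * kap) by rewrite !mulr_ge0// ltW.
    rewrite -natr1; lra.
  rewrite /y in y1; have : 1 < n0%:R * (kap * cB).
    have P0 : 0 < kap * cB by rewrite mulr_gt0.
    have h : (kap * cB)^-1 * (kap * cB) < n0%:R * (kap * cB) by rewrite ltr_pM2r.
    by rewrite mulVf ?gt_eqF// in h.
  move=> h1 h2; have : (1 + n0%:R * kap) * cB <= (1 + kap) ^+ n0 * cB by rewrite ler_pM2r.
  lra.
pose c := cB ^+ n0 * (sz u / C).
have c0 : 0 < c by apply: mulr_gt0; [exact: exprn_gt0|exact: divr_gt0].
exists c => // f x Ff x0 xc.
have zn0 : x <= z f 0%N n0.
  have [_ h1] := CH f u Ff Fu.
  have h2 : sz f * (sz u / C) <= z f 0%N 0%N.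
    by rewrite mulrA ler_pdivrMr// [leRHS]mulrC.
  have h3 : cB ^+ n0 * z f 0%N 0%N <= z f 0%N n0.
    elim: (n0) => [|n IH]; first by rewrite expr0 mul1r.
    apply: le_trans (zB f n Ff); rewrite exprS -mulrA ler_pM2l//.
  apply: le_trans xc (le_trans _ h3).
  by rewrite /c -mulrA ler_pM2l ?exprn_gt0// mulrC.
have chain i j : z f i j <= x -> x <= z f (i + j)%N 0%N ->
    exists i' j', x <= z f i' j' <= (1 + del) * x.
  elim: j i => [|j IH] i zx xz.
    exists i, 0%N; rewrite addn0 in xz; rewrite xz /=; apply: le_trans zx _.
    by rewrite mulrDl mul1r lerDl mulr_ge0 ?ltW.
  have [le|lt] := lerP (z f i.+1 j) x; first by apply: (IH i.+1) => //; rewrite addSnnS.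
  exists i.+1, j; rewrite (ltW lt) /=; have /andP[_ h] := zstep f i j Ff.
  by apply: le_trans h _; rewrite ler_pM2l//; lra.
suff [i [j Hij]] : exists i j, x <= z f i j <= (1 + del) * x.
  by exists (iter i A \o iter j B) => //; apply: (cs_comp S); exact: cs_iter.
(* For the least such [n > n0], the chain of length [n] starts below [x] at [B ^ n] and ends above
   it at [A ^ n]; its steps are at most [1 + del], so it cannot jump over [[x, (1 + del) * x]]. *)
pose P n := (n0 <= n)%N && (z f 0%N n <= x).
have exP : exists n, P n.
  pose y := sz f / x; have szf0 := cs_size_gt0 S Ff.
  have y0 : 0 <= y by rewrite divr_ge0// ltW.
  have /andP[_ y1] := truncn_itv y0; exists (maxn n0 (Num.truncn y).+1).
  rewrite /P leq_maxl /=; apply: le_trans (zhalf _ _ Ff) _.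
  rewrite ler_pdivrMr ?exprn_gt0// mulrC -ler_pdivrMr// -/y.
  apply: le_trans (ltW y1) _; rewrite -natrX ler_nat.
  by apply: leq_trans (leq_maxr n0 _) (ltnW (ltn_expl _ _)).
case: (ex_minnP exP) => n /andP[n0n zx] minn.
move: n0n; rewrite leq_eqVlt => /orP[/eqP nE|n0n].
  exists 0%N, n0; rewrite zn0 /= -nE in zx *; apply: le_trans zx _.
  by rewrite mulrDl mul1r lerDl mulr_ge0 ?ltW.
apply: (chain 0%N n zx); rewrite add0n.
case: n n0n zx minn => // n n0n zx minn.
have znx : x < z f 0%N n.
  rewrite ltNge; apply/negP => h; have := minn n; rewrite /P h andbT ltnn.
  by move=> /(_ n0n).
have h1 : cB * x <= z f 0%N n.+1 by apply: le_trans (zB f n Ff); rewrite ler_pM2l// ltW.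
have h2 i j : (1 + kap) ^+ i * z f 0%N (i + j)%N <= z f i j.
  elim: i j => [|i IH] j; first by rewrite expr0 mul1r.
  have /andP[h _] := zstep f i j Ff; apply: le_trans h.
  rewrite exprS -mulrA ler_pM2l; last lra.
  by rewrite addSnnS; exact: IH.
have := h2 n.+1 0%N; rewrite addn0; apply: le_trans.
have kn : (1 + kap) ^+ n0 <= (1 + kap) ^+ n.+1.
  by apply: ler_weXn2l; [lra|exact: leqW].
apply: (@le_trans _ _ ((1 + kap) ^+ n.+1 * (cB * x))); last first.
  by rewrite ler_pM2l// exprn_gt0//; lra.
rewrite mulrA -[leLHS]mul1r ler_pM2r//; apply: le_trans Hn0 _.
by rewrite ler_pM2r.
Qed.

End Adjust.

Section Numeric.
Variable R : realType.

Lemma exp_beats_linear (b c : R) : 1 < b -> exists m : nat, c * m.+1%:R <= b ^+ m.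
Proof.
move=> b1; pose x := b - 1; have x0 : 0 < x by rewrite subr_gt0.
pose y := 3 * `|c| / x ^+ 2.
have y0 : 0 <= y by rewrite divr_ge0 ?exprn_ge0 ?mulr_ge0 ?(ltW x0).
have /andP[_] := truncn_itv y0; set k := (Num.truncn y).+1 => yk.
exists (k + k)%N.
have bern n : 1 + n%:R * x <= b ^+ n.
  elim: n => [|n IH]; first by rewrite mul0r addr0 expr0.
  rewrite exprS; have : b * (1 + n%:R * x) <= b * b ^+ n by rewrite ler_pM2l//; lra.
  have : 0 <= x * (n%:R * x) by rewrite !mulr_ge0// ltW.
  rewrite -natr1 /x; lra.
have K1 : 1 <= k%:R :> R by rewrite ler1n.
have kx : 0 < k%:R * x by rewrite mulr_gt0//; lra.
have h1 : (k%:R * x) * (k%:R * x) <= b ^+ (k + k).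
  by rewrite exprD; apply: ler_pM; have := bern k; lra.
apply: le_trans h1; rewrite [leRHS](_ : _ = k%:R * (k%:R * x ^+ 2)); last by ring.
have h2 : 3 * `|c| <= k%:R * x ^+ 2.
  by rewrite -ler_pdivrMr ?exprn_gt0// ltW.
have h3 : k%:R * (3 * `|c|) <= k%:R * (k%:R * x ^+ 2) by rewrite ler_pM2l//; lra.
apply: le_trans h3; apply: (@le_trans _ _ (`|c| * (k + k).+1%:R)).
  by rewrite ler_wpM2r// ler_norm.
have h4 : (k + k).+1%:R <= 3 * k%:R :> R by rewrite -natr1 natrD; lra.
have := ler_wpM2l (normr_ge0 c) h4; lra.
Qed.

End Numeric.

Section SumOfSystems.
Variable R : realType.

Lemma deep_ratio lo hi K (F : set (R -> R)) u (eta : R) :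
  csystem lo hi K F -> F u -> eta <= 1 ->
  (forall f x y x' y', F f ->
    lo <= x -> x < y -> y <= hi -> lo <= x' -> x' < y' -> y' <= hi ->
    (f (u y) - f (u x)) * (u y' - u x') <=
    (1 + eta) * (f (u y') - f (u x')) * (u y - u x)) ->
  forall f g (a b : R), F f -> F g ->
    a * (u hi - u lo) <= u (g hi) - u (g lo) <= b * (u hi - u lo) ->
    a / 2 * (f (u hi) - f (u lo)) <= f (u (g hi)) - f (u (g lo))
      <= 2 * b * (f (u hi) - f (u lo)).
Proof.
move=> S Fu eta1 H f g a b Ff Fg /andP[s1 s2]; have lohi := cs_lt S.
have /andP[g1 g2] := cs_lo S Fg; have /andP[g3 g4] := cs_hi S Fg.
have g5 : g lo < g hi by apply: (cs_incr S).
have k1 := H f _ _ _ _ Ff g1 g5 g4 (lexx _) lohi (lexx _).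
have k2 := H f _ _ _ _ Ff (lexx _) lohi (lexx _) g1 g5 g4.
have L0 := cs_size_gt0 S Fu; have Lf0 := cs_size_gt0 S (cs_comp S Ff Fu).
have y0 := cs_comp_lt S (cs_comp S Ff Fu) Fg.
have x0 := cs_comp_lt S Fu Fg.
move: s1 s2 k1 k2 L0 Lf0 x0 y0 => /=; rewrite -[u (g lo) < _]subr_gt0 -[f (u (g lo)) < _]subr_gt0.
set x := u (g hi) - _; set y := f (u (g hi)) - _.
set L := u hi - u lo; set Lf := f (u hi) - f (u lo) => s1 s2 k1 k2 L0 Lf0 x0 y0.
apply/andP; split; rewrite -(ler_pM2r L0).
  have h1 : Lf * (a * L) <= Lf * x by rewrite ler_pM2l.
  have h2 : (1 + eta) * y * L <= 2 * y * L by rewrite ler_pM2r// ler_pM2r//; lra.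
  lra.
have h1 : Lf * x <= Lf * (b * L) by rewrite ler_pM2l.
have h2 : (1 + eta) * Lf * x <= 2 * Lf * x by rewrite ler_pM2r// ler_pM2r//; lra.
lra.
Qed.

(* Parameters of the construction: [q] is the scale of the trees, [m] the
   length of a block and [1 / h] the frequency of bad blocks. *)
Lemma scale_exists (sg1 sg2 sg d d' th : R) : 0 < sg1 -> 0 < sg2 -> 0 < sg ->
  0 <= d -> 0 <= d' -> sg1 <= 1 -> sg2 <= 1 -> 0 < th -> th < d + d' -> d + d' < 1 ->
  exists q N N' : nat, [/\ (1 < q)%N, [/\ (0 < N)%N, (0 < N')%N & (N * N' <= q)%N],
    [/\ q%:R^-1 < sg1, q%:R^-1 < sg2 & q%:R^-1 < sg],
    N%:R <= (sg1 * q%:R) `^ d /\ N'%:R <= (sg2 * q%:R) `^ d'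
  & q%:R `^ th <= (N * N')%N%:R].
Proof.
move=> sg10 sg20 sg0 d0 d'0 sg11 sg21 th0 thd dd1.
pose D := d + d' - th; have D0 : 0 < D by rewrite /D; lra.
(* The integer parts [N] and [N'] are at least half of the real numbers they approximate, which
   costs the factor 4. *)
have [e0 e00 He0] := powR_inv_large (4 / (sg1 `^ d * sg2 `^ d')) D0.
pose y : R := e0^-1 + sg1^-1 + sg2^-1 + sg^-1 + 1.
have e0i : 0 < e0^-1 by rewrite invr_gt0.
have sg1i : 0 < sg1^-1 by rewrite invr_gt0.
have sg2i : 0 < sg2^-1 by rewrite invr_gt0.
have sgi : 0 < sg^-1 by rewrite invr_gt0.
have y0 : 0 <= y by rewrite /y; lra.
have /andP[_] := truncn_itv y0; set q := (Num.truncn y).+1 => yq.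
have Q0 : 0 < q%:R :> R by rewrite ltr0n.
have inv_lt (x : R) : 0 < x -> x^-1 < q%:R -> q%:R^-1 < x.
  by move=> x0 h; rewrite -[x]invrK ltf_pV2 ?posrE ?invr_gt0.
have q1 : 1 < q%:R :> R by rewrite /y in yq; lra.
have i1 : q%:R^-1 < sg1 by apply: inv_lt => //; rewrite /y in yq; lra.
have i2 : q%:R^-1 < sg2 by apply: inv_lt => //; rewrite /y in yq; lra.
have i3 : q%:R^-1 < sg by apply: inv_lt => //; rewrite /y in yq; lra.
have i4 : q%:R^-1 < e0 by apply: inv_lt => //; rewrite /y in yq; lra.
have He := He0 q%:R^-1; rewrite invrK invr_gt0 in He; have {He}He := He Q0 i4.
have ge1 (x a : R) : 0 < x -> 0 <= a -> q%:R^-1 < x -> 1 <= (x * q%:R) `^ a.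
  move=> x0 a0 h; rewrite -[leLHS](_ : 1 `^ a = 1 :> R); last by rewrite powR1.
  apply: ge0_ler_powR; rewrite ?nnegrE ?mulr_ge0 ?(ltW x0)//.
  by rewrite -ler_pdivrMr// div1r ltW.
have g1 := ge1 sg1 d sg10 d0 i1; have g2 := ge1 sg2 d' sg20 d'0 i2.
set X := (sg1 * q%:R) `^ d in g1 *; set X' := (sg2 * q%:R) `^ d' in g2 *.
have X0 : 0 <= X by lra. have X'0 : 0 <= X' by lra.
have /andP[n1 n2] := truncn_itv X0; have /andP[n3 n4] := truncn_itv X'0.
have N1 : (0 < Num.truncn X)%N.
  by rewrite lt0n; apply/eqP => E; move: n2; rewrite E; lra.
have N2 : (0 < Num.truncn X')%N.
  by rewrite lt0n; apply/eqP => E; move: n4; rewrite E; lra.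
have XX : X * X' = sg1 `^ d * sg2 `^ d' * q%:R `^ (d + d').
  rewrite /X /X' !powRM ?(ltW sg10) ?(ltW sg20)// powRD_gt0//; ring.
have le1 (x a : R) : 0 < x -> x <= 1 -> 0 <= a -> x `^ a <= 1.
  move=> x0 x1 a0; have <- : 1 `^ a = 1 :> R by rewrite powR1.
  by apply: ge0_ler_powR; rewrite ?nnegrE ?(ltW x0).
exists q, (Num.truncn X), (Num.truncn X'); split=> //.
- by rewrite -(ltr_nat R).
- split=> //; rewrite -(ler_nat R) natrM.
  apply: le_trans (ler_pM _ _ n1 n3) _ => //; rewrite XX.
  apply: (@le_trans _ _ (1 * q%:R `^ 1)); last by rewrite powRr1 ?mul1r// ltW.
  apply: ler_pM; rewrite ?mulr_ge0 ?powR_ge0//.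
    by rewrite -[leRHS]mulr1; apply: ler_pM; rewrite ?powR_ge0 ?le1.
  by apply: ler_powR; lra.
have h1 : X <= 2 * (Num.truncn X)%:R.
  have : 1 <= (Num.truncn X)%:R :> R by rewrite ler1n.
  by move: n2; rewrite -natr1; lra.
have h2 : X' <= 2 * (Num.truncn X')%:R.
  have : 1 <= (Num.truncn X')%:R :> R by rewrite ler1n.
  by move: n4; rewrite -natr1; lra.
rewrite natrM; have := ler_pM X0 X'0 h1 h2; rewrite XX.
have -> : d + d' = D + th by rewrite /D; ring.
rewrite powRD_gt0//; set T := q%:R `^ th; set U := q%:R `^ D in He *.
set V := sg1 `^ d * sg2 `^ d' in He *.
have V0 : 0 < V by rewrite mulr_gt0 ?powR_gt0.
have T0 : 0 < T by rewrite powR_gt0.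
rewrite ler_pdivrMr// in He.
have : 4 * T <= U * V * T by rewrite ler_pM2r.
set A := _%:R; set B := _%:R; lra.
Qed.

Lemma block_exists (b th e : R) (c : nat) : 1 < b -> 0 < e -> e < th ->
  exists h m : nat, [/\ (1 < h)%N, (0 < m)%N &
    2 * (2 * (c * m.+1 * h)%N%:R) ^+ h * b `^ (e * (m * h)%N%:R) <=
    b `^ (th * (m * (h - 2))%N%:R)].
Proof.
move=> b1 e0 eth; pose e2 := (e + th) / 2.
have b0 : 0 < b by lra.
pose y := 4 * th / (th - e); have y0 : 0 <= y by rewrite divr_ge0; lra.
have /andP[_] := truncn_itv y0; set h := (Num.truncn y).+1 => yh.
have hth : 2 * th <= (th - e2) * h%:R.
  have : 4 * th < h%:R * (th - e) by rewrite -ltr_pdivrMr//; lra.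
  rewrite /e2; lra.
have bb : 1 < b `^ (e2 - e).
  have <- : 1 `^ (e2 - e) = 1 :> R by rewrite powR1.
  by apply: gt0_ltr_powR; rewrite ?nnegrE ?(ltW b0)// /e2; lra.
have [m Hm] := exp_beats_linear (4 * (c * h)%N%:R + 2) bb.
have h1 : (1 < h)%N.
  rewrite ltnNge; apply/negP; rewrite -(ler_nat R) => h1.
  have : (th - e2) * h%:R <= (th - e2) * 1 by rewrite ler_wpM2l// /e2; lra.
  by rewrite /e2 in hth *; lra.
exists h, m; split=> //.
  rewrite lt0n; apply/eqP => E; move: Hm; rewrite E expr0 mulr1.
  have : 0 <= (c * h)%N%:R :> R by rewrite ler0n.
  lra.
apply: (@le_trans _ _ (b `^ (e2 * (m * h)%N%:R))); last first.
  apply: ler_powR; first exact: ltW.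
  rewrite !natrM natrB//; have := hth; have m0 : 0 <= m%:R :> R by rewrite ler0n.
  move=> hh; have := ler_wpM2l m0 hh; lra.
have -> : e2 * (m * h)%N%:R = (e2 - e) * (m * h)%N%:R + e * (m * h)%N%:R by ring.
rewrite powRD_gt0// ler_pM2r ?powR_gt0//.
have -> : b `^ ((e2 - e) * (m * h)%N%:R) = ((b `^ (e2 - e)) ^+ m) ^+ h.
  by rewrite powRrM powR_mulrn ?powR_ge0// exprM.
apply: (@le_trans _ _ ((4 * (c * m.+1 * h)%N%:R) ^+ h)).
  rewrite (_ : 4 * _ = 2 * (2 * (c * m.+1 * h)%N%:R)); last by ring.
  rewrite [leRHS]exprMn ler_wpM2r ?exprn_ge0 ?mulr_ge0//.
  by rewrite -{1}[2]expr1 ler_weXn2l ?(ltnW h1)//; lra.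
apply: lerXn2r; rewrite ?nnegrE ?exprn_ge0 ?mulr_ge0 ?powR_ge0//.
apply: le_trans Hm; rewrite !natrM.
have : 0 <= m.+1%:R :> R by rewrite ler0n.
lra.
Qed.

Lemma slope_bounds (q m k : nat) : (0 < q)%N -> (k < q ^ m)%N ->
  1 <= 1 + k%:R * q%:R ^- m :> R /\ 1 + k%:R * q%:R ^- m <= 2 :> R.
Proof.
move=> q0 kq; have Q0 : 0 < q%:R :> R by rewrite ltr0n.
have : k%:R * q%:R ^- m <= 1 :> R.
  by rewrite ler_pdivrMr ?exprn_gt0// mul1r -natrX ler_nat ltnW.
have : 0 <= k%:R * q%:R ^- m :> R by rewrite mulr_ge0// invr_ge0 exprn_ge0.
lra.
Qed.

(** [x] is the size giving exactly the slope [tau] and [z] the size obtained; since [tau <= 2], the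
    precision [eps / 2] on the size gives [eps] on the slope. *)
Lemma slope_transfer (x y z tau eps : R) : 0 < x -> 1 <= tau -> tau <= 2 ->
  0 < eps -> eps <= 1 -> y = x * tau -> x <= z -> z <= (1 + eps / 2) * x ->
  [/\ `|y / z - tau| <= eps, z <= 2 * y & y <= 2 * z].
Proof.
move=> x0 tau1 tau2 eps0 eps1 -> xz zx; have z0 : 0 < z by lra.
have h1 : x * tau <= z * tau by rewrite ler_pM2r//; lra.
have h2 : z * tau <= (1 + eps / 2) * x * tau by rewrite ler_pM2r//; lra.
have h3 : x * tau * eps <= 2 * x * eps.
  by rewrite ler_pM2r// mulrC ler_pM2r.
have h4 : x * eps <= z * eps by rewrite ler_pM2r.
have h5 : z * tau <= z * 2 by rewrite ler_pM2l.
have h6 : x * 1 <= x * tau by rewrite ler_pM2l.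
have h7 : eps / 2 * x <= 2^-1 * x by rewrite ler_pM2r//; lra.
split; [|lra|lra].
have -> : x * tau / z - tau = (x * tau - z * tau) / z.
  by rewrite [RHS]mulrBl [z * tau]mulrC mulfK ?gt_eqF.
rewrite normrM normfV (gtr0_norm z0) ler_pdivrMr// ler_norml.
by apply/andP; split; lra.
Qed.

(** The adjusted sizes [L] and [s * L'] agree up to a factor 2, so the new ratio is at most [8 / sg]
    whatever the old one was, and the bound [A] survives iteration. The loss is
    [k0 * sg / (4 * A * (1 + A))]; the extra term in the denominator only makes the constant less
    than 1. *)
Lemma ratio_step (sg r A k0 s X Y L L' Z Z' : R) : 0 < sg -> 0 < r -> 0 < A ->
  0 < k0 -> 0 < s -> 0 < L -> 0 < L' -> 0 < Z -> 12%:R / sg <= A ->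
  sg * r / 2 * L <= X -> X <= 2 * r * L -> sg * r / 2 * L' <= Y -> Y <= 2 * r * L' ->
  L <= 2 * (s * L') -> s * L' <= 2 * L ->
  s * Z' <= A * Z -> Z <= A * (s * Z') -> k0 * Z' <= L' ->
  [/\ s * Y <= A * X, X <= A * (s * Y) &
    k0 * sg / (4 * A * (1 + A) + k0 * sg) * r * (Z + s * Z') <= X + s * Y].
Proof.
move=> sg0 r0 A0 k00 s0 L0 L'0 Z0 gA X1 X2 Y1 Y2 L1 L2 Z1 Z2 kL.
rewrite ler_pdivrMr// in gA.
have sg_r : 0 < sg * r by rewrite mulr_gt0.
have sY1 : sg * r / 2 * (s * L') <= s * Y by have := ler_wpM2l (ltW s0) Y1; lra.
have sY2 : s * Y <= 2 * r * (s * L') by have := ler_wpM2l (ltW s0) Y2; lra.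
have X0 : 0 < X by apply: lt_le_trans X1; rewrite !mulr_gt0.
have sY0 : 0 < s * Y by apply: lt_le_trans sY1; rewrite !mulr_gt0.
have r1 : r * (s * L') <= r * (2 * L) by rewrite ler_pM2l.
have r2 : r * L <= r * (2 * (s * L')) by rewrite ler_pM2l.
have gX : 12%:R * X <= A * sg * X by rewrite ler_pM2r.
have gY : 12%:R * (s * Y) <= A * sg * (s * Y) by rewrite ler_pM2r.
split.
- rewrite -(ler_pM2l sg0).
  have h1 : sg * (s * Y) <= sg * (4 * (r * L)) by rewrite ler_pM2l//; lra.
  lra.
- rewrite -(ler_pM2l sg0).
  have h1 : sg * X <= sg * (4 * (r * (s * L'))) by rewrite ler_pM2l//; lra.
  lra.
have kk : 0 < k0 * sg by rewrite mulr_gt0.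
have AA : 0 < 4 * A * (1 + A) by rewrite !mulr_gt0//; lra.
have W0 : 0 < Z + s * Z'.
  by rewrite addr_gt0// -(pmulr_rgt0 _ A0); apply: lt_le_trans Z2.
have h1 : k0 * sg / (4 * A * (1 + A) + k0 * sg) <= k0 * sg / (4 * A * (1 + A)).
  rewrite ler_pM2l// lef_pV2 ?posrE//; lra.
apply: (@le_trans _ _ (k0 * sg / (4 * A * (1 + A)) * r * (Z + s * Z'))).
  by rewrite ler_pM2r// ler_pM2r.
apply: (@le_trans _ _ X); last by rewrite lerDl ltW.
apply: le_trans X1.
have h2 : Z + s * Z' <= (1 + A) * Z by lra.
have h3 : k0 * Z <= k0 * (A * (s * Z')) by rewrite ler_pM2l.
have h4 : A * s * (k0 * Z') <= A * s * L' by rewrite ler_pM2l// mulr_gt0.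
have h5 : A * (s * L') <= A * (2 * L) by rewrite ler_pM2l//; lra.
have h6 : k0 * Z <= 2 * A * L by lra.
rewrite -mulrA -mulrA mulrCA [leLHS](_ : _ = (k0 * sg * r * (Z + s * Z')) / (4 * A * (1 + A))); last by ring.
rewrite ler_pdivrMr//.
have h7 : k0 * (sg * r) * (Z + s * Z') <= k0 * (sg * r) * ((1 + A) * Z).
  by rewrite ler_pM2l// mulr_gt0.
have h8 : (sg * r) * (1 + A) * (k0 * Z) <= (sg * r) * (1 + A) * (2 * A * L).
  by rewrite ler_pM2l// mulr_gt0//; lra.
lra.
Qed.

(** [gain] wins a factor 2 over the exponent [e] in each of [M] rounds. The constants [K0] and [Lc],
    being independent of [M], are absorbed by [2 ^ M]. *)
Lemma count_step (K0 e r : R) (mu h M q m Om D Lc : nat) : 0 < K0 -> (0 < q)%N ->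
  (0 < mu)%N -> (0 < h)%N -> (0 < Om)%N ->
  2 * (2 * (mu * h)%N%:R) ^+ h * (q%:R ^+ (m * h)) `^ e * (Om ^ 2)%N%:R
    <= (Om ^ h)%N%:R :> R ->
  K0^-1 `^ e * (2 * Lc%:R) <= 2 ^+ M -> r = q%:R ^- (h * M * m) ->
  (Om ^ (h * M) <= D * (2 * (Lc * ((2 * (mu * h)) ^ (h * M) * Om ^ (2 * M)))))%N ->
  (K0 * r)^-1 `^ e <= D%:R.
Proof.
move=> K00 q0 mu0 h0 Om0 gain KM -> cD.
have Q0 : 0 < q%:R :> R by rewrite ltr0n.
set P : R := (2 * (mu * h)%N%:R) ^+ h in gain; set T : R := (q%:R ^+ (m * h)) `^ e in gain.
have P0 : 0 < P by rewrite exprn_gt0// mulr_gt0// ltr0n muln_gt0 mu0.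
have T0 : 0 < T by rewrite powR_gt0// exprn_gt0.
have O0 : 0 < Om%:R :> R by rewrite ltr0n.
have TM : (q%:R ^+ (h * M * m)) `^ e = T ^+ M :> R.
  have Qge := ltW Q0; rewrite /T -(powR_mulrn M (powR_ge0 _ e)).
  rewrite -(powR_mulrn (h * M * m) Qge) -(powR_mulrn (m * h) Qge).
  by rewrite -!powRrM !natrM; congr (_ `^ _); ring.
have E1 : (2 * P * T * (Om ^ 2)%N%:R) ^+ M <= (Om ^ (h * M))%N%:R.
  rewrite [leRHS](_ : _ = (Om ^ h)%N%:R ^+ M); last by rewrite expnM natrX.
  apply: lerXn2r => //; rewrite nnegrE ?ler0n//.
  by rewrite !mulr_ge0 ?ler0n ?(ltW P0) ?(ltW T0).
have E2 : (Om ^ (h * M))%N%:R <= D%:R * (2 * (Lc%:R * (P ^+ M * (Om ^ 2)%N%:R ^+ M))) :> R.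
  have -> : P ^+ M * (Om ^ 2)%N%:R ^+ M = ((2 * (mu * h)) ^ (h * M) * Om ^ (2 * M))%N%:R.
    by rewrite /P !natrM !natrX !natrM !exprM.
  by rewrite -!natrM ler_nat.
have PO : 0 < P ^+ M * (Om ^ 2)%N%:R ^+ M.
  by rewrite mulr_gt0// exprn_gt0// natrX exprn_gt0.
have := le_trans E1 E2.
have -> : (2 * P * T * (Om ^ 2)%N%:R) ^+ M = 2 ^+ M * T ^+ M * (P ^+ M * (Om ^ 2)%N%:R ^+ M).
  by rewrite !exprMn; ring.
have -> : D%:R * (2 * (Lc%:R * (P ^+ M * (Om ^ 2)%N%:R ^+ M))) =
   (D%:R * (2 * Lc%:R)) * (P ^+ M * (Om ^ 2)%N%:R ^+ M) by ring.
rewrite (ler_pM2r PO) => E3.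
rewrite invfM invrK powRM ?invr_ge0 ?(ltW K00) ?exprn_ge0 ?(ltW Q0)// TM.
have [Lc0|Lc0] := posnP Lc.
  have : 0 < 2 ^+ M * T ^+ M by rewrite mulr_gt0 ?exprn_gt0.
  by move: E3; rewrite Lc0 !mulr0 => h1; rewrite ltNge h1.
have Lc1 : 0 < 2 * Lc%:R :> R by rewrite mulr_gt0// ltr0n.
rewrite -(ler_pM2r Lc1); apply: le_trans E3.
rewrite mulrAC ler_pM2r// exprn_gt0//.
Qed.

(** Inserting a small branch of size [w] on the side of [K'] makes the target size on the side of
    [K] small enough for [adjust]. *)
Lemma adjusted_size (s Lf' tau ca z z' C A w : R) : 0 < s -> 1 <= tau -> 0 < ca ->
  0 < z -> 0 < z' -> 0 < C -> 0 < A -> s * z' <= A * z ->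
  w <= ca / (A * C) -> Lf' <= C * z' * w -> s * Lf' / tau <= ca * z.
Proof.
move=> s0 tau1 ca0 z0 z'0 C0 A0 ratio w1 h1.
have tau0 : 0 < tau by lra.
rewrite ler_pdivrMr//.
have h6 : s * Lf' <= s * (C * z' * (ca / (A * C))).
  by rewrite ler_pM2l//; apply: le_trans h1 _; rewrite ler_pM2l// mulr_gt0.
apply: le_trans h6 _.
have -> : s * (C * z' * (ca / (A * C))) = s * z' * ca / A.
  by field; rewrite !gt_eqF.
rewrite ler_pdivrMr//; apply: (@le_trans _ _ (A * z * ca)); first by rewrite ler_pM2r.
have : ca * z * A * 1 <= ca * z * A * tau by rewrite ler_pM2l// !mulr_gt0.
lra.
Qed.

Section Main.
Variables (lo hi : R) (K : set R) (F : set (R -> R)).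
Variables (lo' hi' : R) (K' : set R) (F' : set (R -> R)).
Variables (d d' e s : R).

Local Notation sz f := (f hi - f lo).
Local Notation sz' f := (f hi' - f lo').

(** One generation of the final tree. All constants are chosen before the pair [(f, f')], and the
    family of admissible pairs is stable under passing to the children. *)
Lemma sum_step : csystem lo hi K F -> csystem lo' hi' K' F' ->
  0 <= d -> 0 <= d' -> 0 < e -> e < d + d' -> d + d' < 1 -> 0 < s ->
  branching lo hi F d -> branching lo' hi' F' d' -> toggling lo hi F ->
  exists (A : R) (n : nat) (rho : R),
  [/\ s * (hi' - lo') <= A * (hi - lo), hi - lo <= A * (s * (hi' - lo')),
   0 < rho < 1, rho^-1 `^ e <= n%:R &
  forall f f', F f -> F' f' -> s * sz' f' <= A * sz f -> sz f <= A * (s * sz' f') ->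
  exists (g g' : 'I_n -> R -> R), [/\ forall i, F (g i), forall i, F' (g' i),
    forall i, [/\ s * sz' (f' \o g' i) <= A * sz (f \o g i),
      sz (f \o g i) <= A * (s * sz' (f' \o g' i)) &
      rho * (sz f + s * sz' f') <= sz (f \o g i) + s * sz' (f' \o g' i)] &
    forall i j, i != j ->
      f (g i hi) + s * f' (g' i hi') < f (g j lo) + s * f' (g' j lo') \/
      f (g j hi) + s * f' (g' j hi') < f (g i lo) + s * f' (g' i lo')]].
Proof.
move=> S S' d0 d'0 e0 edd dd1 s0 br br' tog.
have [sg1 /andP[sg10 sg11] tree] := branch_tree_exists S br d0.
have [sg2 /andP[sg20 sg21] tree'] := branch_tree_exists S' br' d'0.
pose sg := Num.min sg1 sg2.
have sg0 : 0 < sg by rewrite lt_min sg10 sg20.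
have sgle1 : sg <= sg1 by rewrite ge_min lexx.
have sgle2 : sg <= sg2 by rewrite ge_min lexx orbT.
pose th := (e + (d + d')) / 2.
have th0 : 0 < th by rewrite /th; lra.
have thd : th < d + d' by rewrite /th; lra.
have eth : e < th by rewrite /th; lra.
have sg11' : sg1 <= 1 by lra.
have sg21' : sg2 <= 1 by lra.
have [q [N [N' [q1 [N0 N'0 NN'] [i1 i2 i3] [cN cN'] qth]]]] :=
  scale_exists sg10 sg20 sg0 d0 d'0 sg11' sg21' th0 thd dd1.
have q0 : (0 < q)%N by apply: ltn_trans q1.
have Q0 : 0 < q%:R :> R by rewrite ltr0n.
have Q1 : 1 < q%:R :> R by rewrite ltr1n.
pose c := ((Num.truncn (31%:R / sg)).+1 * (Num.truncn (31%:R / sg)).+1 * 27 * q)%N.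
have [h [m [h1 m0 Hhm]]] := @block_exists q%:R th e c Q1 e0 eth.
have h0 : (0 < h)%N by apply: ltn_trans h1.
pose eps : R := q%:R ^- m.
have eps0 : 0 < eps by rewrite invr_gt0 exprn_gt0.
have eps1 : eps <= 1 by rewrite invf_le1 ?exprn_gt0// exprn_ege1// ltW.
have [u Fu Hu] := deep_distortion S br eps0.
have [u' Fu' Hu'] := deep_distortion S' br' eps0.
have [gam BT] := tree q N u Fu q0 i1 cN.
have [gam' BT'] := tree' q N' u' Fu' q0 i2 cN'.
have {}BT := branch_tree_le sgle1 (ltW (cs_size_gt0 S Fu)) BT.
have {}BT' := branch_tree_le sgle2 (ltW (cs_size_gt0 S' Fu')) BT'.
have D0 : 0 < hi - lo by rewrite subr_gt0 (cs_lt S).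
have D'0 : 0 < hi' - lo' by rewrite subr_gt0 (cs_lt S').
(* The first two terms admit the initial pair [(id, id)]; the third is the ratio preserved by
   [ratio_step]. *)
pose A := s * (hi' - lo') / (hi - lo) + (hi - lo) / (s * (hi' - lo')) + 12%:R / sg.
have A1 : 0 < s * (hi' - lo') / (hi - lo) by rewrite divr_gt0 ?mulr_gt0.
have A2 : 0 < (hi - lo) / (s * (hi' - lo')) by rewrite divr_gt0 ?mulr_gt0.
have A3 : 0 < 12%:R / sg by rewrite divr_gt0.
have A0 : 0 < A by rewrite /A !addr_gt0.
have eps20 : 0 < eps / 2 by rewrite divr_gt0.
have [ca ca0 Hadj] := adjust S tog Fu eps20.
have [C C0 HC] := cs_comp_bounds S'.
have v0 : 0 < ca / (A * C) by rewrite divr_gt0 ?mulr_gt0.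
have [v Fv Hv] := deep_branch S' br' v0.
pose k0 := sz' (v \o u') / C.
have szvu0 := cs_size_gt0 S' (cs_comp S' Fv Fu').
have k00 : 0 < k0 by rewrite divr_gt0.
pose mu := multiplicity q m sg.
have muE : mu = (c * m.+1)%N by rewrite /mu /multiplicity /c -!mulnA [(q * _)%N]mulnC.
have mu0 : (0 < mu)%N by rewrite muE !muln_gt0 q0.
pose nu := (N * N')%N.
have nu0 : (0 < nu)%N by rewrite muln_gt0 N0 N'0.
pose Omega := block N N' m.
have cardO : #|{: Omega}| = (nu ^ m)%N.
  by rewrite card_prod !card_tuple !card_ord expnMn.
have O0 : (0 < #|{: Omega}|)%N by rewrite cardO expn_gt0 nu0.
(* the gain of one round of [h] blocks beats the loss by a factor [2] *)
have gain : 2 * (2 * (mu * h)%N%:R) ^+ h * (q%:R ^+ (m * h)) `^ e * (#|{: Omega}| ^ 2)%N%:R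
    <= (#|{: Omega}| ^ h)%N%:R :> R.
  have -> : (#|{: Omega}| ^ h = nu ^ (m * (h - 2)) * #|{: Omega}| ^ 2)%N.
    by rewrite cardO -!expnM -expnD -mulnDr subnK.
  rewrite [in leRHS]natrM ler_pM2r; last by rewrite ltr0n expn_gt0 cardO expn_gt0 nu0.
  apply: (@le_trans _ _ (q%:R `^ (th * (m * (h - 2))%N%:R))).
    move: Hhm; rewrite -muE; apply: le_trans.
    by rewrite -(powR_mulrn (m * h) (ltW Q0)) -powRrM [_ * e]mulrC.
  rewrite powRrM powR_mulrn ?powR_ge0// natrX.
  by apply: lerXn2r; rewrite ?nnegrE ?powR_ge0 ?ler0n.
(* The cost of one adjustment, fixed before the number [M] of rounds. *)
pose K0 := k0 * sg / (4 * A * (1 + A) + k0 * sg).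
have KA0 : 0 < 4 * A * (1 + A) by rewrite !mulr_gt0// addr_gt0.
have kg0 : 0 < k0 * sg by rewrite mulr_gt0.
have K00 : 0 < K0 by rewrite divr_gt0// addr_gt0.
have K01 : K0 < 1.
  by rewrite ltr_pdivrMr ?addr_gt0// mul1r ltrDr.
pose Lc := (Num.truncn (16%:R / sg)).+2.
pose y : R := K0^-1 `^ e * (2 * Lc%:R).
have y0 : 0 <= y by rewrite mulr_ge0 ?powR_ge0 ?mulr_ge0.
pose M := (Num.truncn y).+1.
have yM : y <= 2 ^+ M.
  have /andP[_ yt] := truncn_itv y0; apply: le_trans (ltW yt) _.
  by rewrite -natrX ler_nat ltnW// ltn_expl.
pose r : R := q%:R ^- (h * M * m).
have r0 : 0 < r by rewrite invr_gt0 exprn_gt0.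
have r1 : r <= 1 by rewrite invf_le1 ?exprn_gt0// exprn_ege1// ltW.
pose rho := K0 * r.
have rho0 : 0 < rho by rewrite mulr_gt0.
have [k kq Hk] := good_slope S S' m q0 NN' h0 sg0 Fu Fu' BT BT' M.
pose tau : R := 1 + k%:R * q%:R ^- m.
have [tau1 tau2] : 1 <= tau /\ tau <= 2 by exact: slope_bounds.
(* The number of children has to be the same for all pairs, while the disjoint family depends on the
   pair: the least sufficient [n] is below the size of every such family. *)
have [n rn minn] : exists2 n : nat, rho^-1 `^ e <= n%:R &
    forall n', rho^-1 `^ e <= n'%:R -> (n <= n')%N.
  have ex : exists n : nat, rho^-1 `^ e <= n%:R.
    exists (Num.truncn (rho^-1 `^ e)).+1.
    by have /andP[_ /ltW] := truncn_itv (powR_ge0 rho^-1 e).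
  by case: (ex_minnP ex) => n h2 h3; exists n.
have rho1 : rho < 1 by apply: le_lt_trans K01; rewrite ler_piMr// ltW.
exists A, n, rho; split=> //.
- by rewrite -ler_pdivrMr// /A -addrA lerDl ltW// addr_gt0.
- by rewrite -ler_pdivrMr ?mulr_gt0// /A addrAC lerDr ltW// addr_gt0.
- by rewrite rho0.
move=> f f' Ff Ff' ratio1 ratio2.
have szf0 := cs_size_gt0 S Ff; have szf'0 := cs_size_gt0 S' Ff'.
have Fv' := cs_comp S' Ff' Fv.
have Lf'0 := cs_size_gt0 S' (cs_comp S' Fv' Fu').
pose Lf' := f' (v (u' hi')) - f' (v (u' lo')).
rewrite /= -/Lf' in Lf'0.
(* The size on the side of [K] for which the slope of the pair is exactly [tau]. *)
pose x := s * Lf' / tau.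
have tau0 : 0 < tau by apply: lt_le_trans tau1.
have x0 : 0 < x by rewrite divr_gt0 ?mulr_gt0.
have k0L : k0 * sz' f' <= Lf'.
  have [_ h2] := HC _ _ Fv' Fu'; have [_ h3] := HC _ _ Ff' (cs_comp S' Fv Fu').
  by rewrite /k0 -mulrAC ler_pdivrMr// mulrC [Lf' * C]mulrC.
have xca : x <= ca * sz f.
  have [h2 _] := HC _ _ Ff' Fv; have [h3 h4] := cs_nest S' Fv' Fu'.
  have h5 : Lf' <= C * sz' f' * sz' v by apply: le_trans h2; rewrite lerB.
  exact: adjusted_size Hv h5.
have [b Fb /andP[b1 b2]] := Hadj f x Ff x0 xca.
have Ffb := cs_comp S Ff Fb.
pose Lf := f (b (u hi)) - f (b (u lo)).
rewrite -/Lf in b1 b2.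
have Lf0 : 0 < Lf by apply: lt_le_trans b1.
have xtau : s * Lf' = x * tau by rewrite /x divfK ?gt_eqF.
have [th_slope L1 L2] := slope_transfer x0 tau1 tau2 eps0 eps1 xtau b1 b2.
have [D [dD cD]] := disjoint_sums S S' q0 N0 N'0 h0 sg0 Fu Fu' BT BT' Ffb Fv' s0 kq Hk Hu Hu' th_slope.
have nD : (n <= #|D|)%N.
  apply: minn; exact: (count_step K00 q0 mu0 h0 O0 gain yM (erefl _) cD).
pose W (i : 'I_n) := enum_val (widen_ord nD i).
have WD i : W i \in D by exact: enum_valP.
have Winj i j : i != j -> W i != W j.
  by apply: contra_neq => /enum_val_inj /(congr1 val) /= ij; exact: val_inj.
exists (fun i => b \o (u \o gam (word1 (W i)))), (fun i => v \o (u' \o gam' (word2 (W i)))).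
have G1 i := bt_in BT (word1 (W i)); have G2 i := bt_in BT' (word2 (W i)).
split.
- by move=> i; do 2 (apply: (cs_comp S) => //).
- by move=> i; do 2 (apply: (cs_comp S') => //).
- move=> i.
  have H1 := bt_size BT (word1 (W i)); have H2 := bt_size BT' (word2 (W i)).
  rewrite size_word1 size_tuple -/r in H1; rewrite size_word2 size_tuple -/r in H2.
  have /andP[p1 p2] := deep_ratio S Fu eps1 Hu Ffb (G1 i) H1.
  have /andP[p3 p4] := deep_ratio S' Fu' eps1 Hu' Fv' (G2 i) H2.
  rewrite /= -/Lf in p1 p2; rewrite /= -/Lf' in p3 p4.
  have gA : 12%:R / sg <= A by rewrite lerDr ltW// addr_gt0.
  exact: (ratio_step sg0 r0 A0 k00 s0 Lf0 Lf'0 szf0 gA p1 p2 p3 p4 L1 L2 ratio1 ratio2 k0L).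
- move=> i j ij; have /= := dD _ _ (WD i) (WD j) (Winj _ _ ij).
  by rewrite /sum_hi /sum_lo.
Qed.

End Main.
End SumOfSystems.

(** * Hausdorff dimension of systems and of their sums *)

Section DimensionOfSystems.
Variable R : realType.

Section Sum.
Variables (lo hi : R) (K : set R) (F : set (R -> R)).
Variables (lo' hi' : R) (K' : set R) (F' : set (R -> R)).
Variables (d d' e s : R).

Local Notation sz f := (f hi - f lo).
Local Notation sz' f := (f hi' - f lo').

(** The nodes of the tree are the pairs of branches of comparable sizes. [E] is allowed to be larger
    than the sum, since a system describes only the part of a Cantor set over one letter. *)
Lemma hausdorff_dim_sum_ge E : csystem lo hi K F -> csystem lo' hi' K' F' ->
  0 <= d -> 0 <= d' -> 0 < e -> e < d + d' -> d + d' < 1 -> 0 < s ->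
  branching lo hi F d -> branching lo' hi' F' d' -> toggling lo hi F ->
  compact E -> sum_scaled K s K' `<=` E -> (e%:E <= hausdorff_dim E)%E.
Proof.
move=> S S' d0 d'0 e0 edd dd1 s0 br br' tog cE KE.
have [A [n [rho [A1 A2 /andP[rho0 rho1] rn step]]]] :=
  sum_step S S' d0 d'0 e0 edd dd1 s0 br br' tog.
pose St := {p : (R -> R) * (R -> R) | [/\ F p.1, F' p.2,
  s * sz' p.2 <= A * sz p.1 & sz p.1 <= A * (s * sz' p.2)]}.
pose l (v : St) := (sval v).1 lo + s * (sval v).2 lo'.
pose r (v : St) := (sval v).1 hi + s * (sval v).2 hi'.
have /choice[ch Hch] (v : St) : exists c : 'I_n -> St,
  [/\ forall i, l v <= l (c i) /\ r (c i) <= r v,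
   forall i, rho * (r v - l v) <= r (c i) - l (c i) &
   forall i j, i != j -> r (c i) < l (c j) \/ r (c j) < l (c i)].
  case: v => -[f f'] /= [Ff Ff' r1 r2].
  have [g [g' [Fg Fg' Hg disj]]] := step f f' Ff Ff' r1 r2.
  have P i : [/\ F (f \o g i), F' (f' \o g' i),
      s * sz' (f' \o g' i) <= A * sz (f \o g i) & sz (f \o g i) <= A * (s * sz' (f' \o g' i))].
    by have [? ? _] := Hg i; split=> //; [exact: (cs_comp S)|exact: (cs_comp S')].
  exists (fun i => exist _ (f \o g i, f' \o g' i) (P i)); rewrite /l /r /=; split.
  - move=> i; have [a1 a2] := cs_nest S Ff (Fg i); have [b1 b2] := cs_nest S' Ff' (Fg' i).
    by split; apply: lerD => //; rewrite ler_pM2l.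
  - move=> i; have [_ _] := Hg i; rewrite /= => h; lra.
  - exact: disj.
have lr v : l v < r v.
  case: v => -[f f'] /= [Ff Ff' r1 r2]; rewrite /l /r /=.
  have := cs_size_gt0 S Ff; have := cs_size_gt0 S' Ff'; rewrite !subr_gt0 => h1 h2.
  by apply: ltrD => //; rewrite ltr_pM2l.
have meets v : exists x, E x /\ l v <= x <= r v.
  case: v => -[f f'] /= [Ff Ff' r1 r2]; rewrite /l /r /=.
  have [x Kx] := cs_nonempty S; have [y Ky] := cs_nonempty S'.
  exists (f x + s * f' y); split.
    by apply: KE; exists (f x); [exact: (cs_K S)|exists (f' y) => //; exact: (cs_K S')].
  have := cs_sub S Kx; have := cs_sub S' Ky; rewrite /= !in_itv /= => /andP[y1 y2] /andP[x1 x2].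
  by apply/andP; split; apply: lerD; rewrite ?ler_pM2l//;
    [apply: (cs_le S)|apply: (cs_le S')|apply: (cs_le S)|apply: (cs_le S')].
have P : [/\ F id, F' id, s * sz' id <= A * sz id & sz id <= A * (s * sz' id)].
  by split=> //; [exact: (cs_id S)|exact: (cs_id S')].
apply: (@hausdorff_dim_ge_tree _ St l r n ch rho E rho0 lr _ _ _ meets rho1 e (exist _ (id, id) P)) => //.
- by move=> v; have [] := Hch v.
- by move=> v; have [] := Hch v.
- by move=> v; have [] := Hch v.
Qed.

End Sum.

Lemma hausdorff_dim_system_ge lo hi K F d (E : set R) : csystem lo hi K F -> 0 < d ->
  branching lo hi F d -> compact E -> K `<=` E -> (d%:E <= hausdorff_dim E)%E.
Proof.
move=> S d0 [n [Phi [sg [sg0 FPhi disj size nd]]]] cE KE.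
pose St := {f : R -> R | F f}.
pose l (v : St) := sval v lo; pose r (v : St) := sval v hi.
have lohi := ltW (cs_lt S).
have P f i : F f -> F (f \o Phi i) by move=> Ff; apply: (cs_comp S).
pose ch (v : St) i : St := exist _ (sval v \o Phi i) (P _ i (svalP v)).
have sg1 : sg < 1.
  have [i] : exists i : 'I_n, True.
    case: n Phi FPhi disj size nd {P ch} => [|n] Phi _ _ _ nd; last by exists ord0.
    by move: nd; rewrite leNgt powR_gt0// invr_gt0.
  have /andP[h1 h2] := size id i (cs_id S); have := cs_lt S; rewrite -subr_gt0 => h3.
  rewrite -(ltr_pM2r h3); move: (le_trans h1 h2) h3 => /=; lra.
apply: (@hausdorff_dim_ge_tree _ St l r n ch sg E sg0 _ _ _ _ _ sg1 d (exist _ id (cs_id S))) => //.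
- by move=> [f Ff]; rewrite /l /r /= -subr_gt0; exact: (cs_size_gt0 S).
- by move=> [f Ff] i; exact: (cs_nest S Ff (FPhi i)).
- by move=> [f Ff] i; have /andP[] := size f i Ff.
- move=> [f Ff] i j ij; rewrite /l /r /=.
  have /andP[_ hi1] := cs_hi S (FPhi i); have /andP[lo1 _] := cs_lo S (FPhi i).
  have /andP[_ hi2] := cs_hi S (FPhi j); have /andP[lo2 _] := cs_lo S (FPhi j).
  have /andP[hi1' _] := cs_hi S (FPhi i); have /andP[_ lo1'] := cs_lo S (FPhi i).
  have /andP[hi2' _] := cs_hi S (FPhi j); have /andP[_ lo2'] := cs_lo S (FPhi j).
  by have [h|h] := disj i j ij; [left|right]; apply: (cs_incr S).
- move=> [f Ff]; have [x Kx] := cs_nonempty S; exists (f x); split.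
    by apply: KE; exact: (cs_K S).
  have := cs_sub S Kx; rewrite /= in_itv /= => /andP[x1 x2].
  by apply/andP; split; apply: (cs_le S).
Qed.

(** Conjugation by [x -> - x], which keeps branches increasing. It reduces negative [s] to positive
    [s], because [K + s K' = K + (- s) (- K')]. *)
Definition conj_opp (F : set (R -> R)) : set (R -> R) :=
  [set f | exists2 g, F g & f = fun x => - g (- x)].

Lemma csystem_opp lo hi K F : csystem lo hi K F ->
  csystem (- hi) (- lo) [set - x | x in K] (conj_opp F).
Proof.
move=> S; split.
- by rewrite ltrN2 (cs_lt S).
- move=> _ [x Kx <-]; have := cs_sub S Kx; rewrite /= !in_itv /= !lerN2 andbC//.
- by apply: continuous_compact (cs_compact S); apply: continuous_subspaceT => x; exact: opp_continuous.
- by have [x Kx] := cs_nonempty S; exists (- x), x.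
- by exists id; [exact: (cs_id S)|apply/funext => x; rewrite opprK].
- move=> _ _ [f Ff ->] [g Fg ->]; exists (f \o g); first exact: (cs_comp S).
  by apply/funext => x /=; rewrite opprK.
- move=> _ x [f Ff ->] /andP[x1 x2]; have := cs_in S Ff (x := - x).
  by rewrite !lerN2 [-x <= _]lerNl [_ <= -x]lerNr x1 x2 => /(_ isT)/andP[-> ->].
- move=> _ x y [f Ff ->] x1 xy y1; rewrite ltrN2; apply: (cs_incr S) => //.
  + by rewrite lerNr.
  + by rewrite ltrN2.
  + by rewrite lerNl.
- by move=> _ _ [f Ff ->] [x Kx <-]; rewrite opprK; exists (f x) => //; exact: (cs_K S).
- have [C C0 H] := cs_dist S; exists C => // _ x y x' y' [f Ff ->] h1 h2 h3 h4 h5 h6.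
  have := H f (- y) (- x) (- y') (- x') Ff.
  rewrite !ltrN2 [_ <= -y]lerNr [_ <= -y']lerNr [-x <= _]lerNl [-x' <= _]lerNl.
  by move=> /(_ h3 h2 h1 h6 h5 h4); rewrite !opprK ![- _ + _]addrC.
move=> eta eta0; have [dl dl0 H] := cs_dist0 S eta0; exists dl => //.
move=> _ z x y x' y' [f Ff ->] h1 h2 h3 h4 h5 h6 h7 h8 h9 h10.
have := H f (- (z + dl)) (- y) (- x) (- y') (- x') Ff.
rewrite !ltrN2 !lerN2 [_ <= -y]lerNr [_ <= -y']lerNr [-x <= _]lerNl [-x' <= _]lerNl.
rewrite opprD subrK !lerN2.
by move=> /(_ h3 h2 h1 h6 h5 h4 h8 h7 h10 h9); rewrite !opprK ![- _ + _]addrC.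
Qed.

Lemma branching_opp lo hi (F : set (R -> R)) d :
  branching lo hi F d -> branching (- hi) (- lo) (conj_opp F) d.
Proof.
move=> [n [Phi [sg [sg0 FPhi disj size nd]]]].
exists n, (fun i x => - Phi i (- x)), sg; split=> //.
- by move=> i; exists (Phi i).
- by move=> i j ij; rewrite !opprK !ltrN2; have [h|h] := disj i j ij; [right|left].
- by move=> _ i [f Ff ->]; rewrite !opprK ![- _ + _]addrC; exact: size.
Qed.

End DimensionOfSystems.

(** * Inverse branches of an expanding map *)

Lemma norm_between (R : realType) (x y z c e : R) : `|x - z| <= e -> `|y - z| <= e ->
  x <= c -> c <= y -> `|c - z| <= e.
Proof.
by rewrite !ler_norml => /andP[? ?] /andP[? ?] ? ?; apply/andP; split; lra.
Qed.

Section Words.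
Variables (R : realType) (r : \bar R) (g : expanding_map r).
Local Notation T := (alphabet g).
Local Notation lo := (lo (e := g)).
Local Notation hi := (hi (e := g)).

Definition letter_edge (a b : T) := (a, b) \in transitions g.
Local Notation edge := letter_edge.
Definition len (a : T) : R := hi a - lo a.

(** [h p] is the inverse of [g] on [I(p)], [L p] its log-derivative in absolute value, and [o p]
    tells whether it reverses orientation. The contraction rate [lam] holds after the affine
    identification of the letters with [[0, 1]], hence the factors [len]; [al] is the Hoelder
    exponent of [L]. *)
Record branches (h L : T * T -> R -> R) (o : T * T -> bool) (lam H0 al : R) : Prop := Branches {
  br_lam : 0 < lam < 1;
  br_H0 : 0 < H0;
  br_al : 0 < al;
  br_in : forall p x, p \in transitions g -> lo p.2 <= x <= hi p.2 -> lo2 p <= h p x <= hi2 p;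
  br_emap : forall p x, p \in transitions g -> lo p.2 <= x <= hi p.2 -> emap g (h p x) = x;
  br_emap_in : forall p x, p \in transitions g -> lo2 p <= x <= hi2 p ->
    lo p.2 <= emap g x <= hi p.2;
  br_can : forall p x, p \in transitions g -> lo2 p <= x <= hi2 p -> h p (emap g x) = x;
  br_mono : forall p x y, p \in transitions g -> lo p.2 <= x -> x < y -> y <= hi p.2 ->
    if o p then h p y < h p x else h p x < h p y;
  br_mvt : forall p x y, p \in transitions g -> lo p.2 <= x -> x < y -> y <= hi p.2 ->
    exists2 c, x <= c <= y & `|h p y - h p x| = expR (L p c) * (y - x);
  br_hol : forall p x y, p \in transitions g -> lo p.2 <= x <= hi p.2 -> lo p.2 <= y <= hi p.2 ->
    `|L p x - L p y| <= H0 * `|x - y| `^ al;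
  br_contr : forall p x, p \in transitions g -> lo p.2 <= x <= hi p.2 ->
    expR (L p x) * len p.2 <= lam * len p.1
}.

Lemma len_gt0 a : 0 < len a.
Proof. by rewrite subr_gt0 lo_lt_hi. Qed.

Definition len_ratio : R := \sum_(p : T * T) len p.1 / len p.2.

Lemma le_len_ratio a b : len a <= len_ratio * len b.
Proof.
rewrite -ler_pdivrMr ?len_gt0// /len_ratio (bigD1 (a, b))//= lerDl sumr_ge0// => p _.
by rewrite divr_ge0 ?ltW ?len_gt0.
Qed.

Variables (h L : T * T -> R -> R) (o : T * T -> bool) (lam H0 al : R).
Hypothesis br : branches h L o lam H0 al.

Fixpoint word_map (a : T) (w : seq T) (x : R) : R :=
  if w is b :: w' then h (a, b) (word_map b w' x) else x.
Local Notation hw := word_map.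

Fixpoint word_log_derive (a : T) (w : seq T) (x : R) : R :=
  if w is b :: w' then L (a, b) (hw b w' x) + word_log_derive b w' x else 0.
Local Notation lw := word_log_derive.

Fixpoint word_reversing (a : T) (w : seq T) : bool :=
  if w is b :: w' then o (a, b) (+) word_reversing b w' else false.
Local Notation ow := word_reversing.

Lemma hw_cat a w w' x : hw a (w ++ w') x = hw a w (hw (last a w) w' x).
Proof. by elim: w a => //= b w IH a; rewrite IH. Qed.

Lemma lw_cat a w w' x :
  lw a (w ++ w') x = lw a w (hw (last a w) w' x) + lw (last a w) w' x.
Proof. by elim: w a => [|b w IH] a /=; rewrite ?add0r// IH hw_cat addrA. Qed.

Lemma ow_cat a w w' : ow a (w ++ w') = ow a w (+) ow (last a w) w'.
Proof. by elim: w a => //= b w IH a; rewrite IH addbA. Qed.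

Lemma br_in1 p x : p \in transitions g -> lo p.2 <= x <= hi p.2 -> lo p.1 <= h p x <= hi p.1.
Proof.
move=> pB xI; have := br_in br pB xI => xI2.
have : h p x \in `[lo2 p, hi2 p] by rewrite in_itv.
by move/(subintervals pB); rewrite /= in_itv.
Qed.

Lemma hw_in a w x : path edge a w -> lo (last a w) <= x <= hi (last a w) ->
  lo a <= hw a w x <= hi a.
Proof.
elim: w a => //= b w IH a /andP[ab pw] xI.
by apply: (br_in1 (p := (a, b))) => //=; exact: IH.
Qed.

Lemma br_contr_dist p x y : p \in transitions g -> lo p.2 <= x <= hi p.2 ->
  lo p.2 <= y <= hi p.2 -> `|h p y - h p x| * len p.2 <= lam * len p.1 * `|y - x|.
Proof.
move=> pB; wlog xy : x y / x < y => [H xI yI|/andP[x1 x2] /andP[y1 y2]].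
  have [xy|yx|->] := ltgtP x y; first exact: H.
    by rewrite distrC [`|y - x|]distrC; exact: H.
  by rewrite !subrr normr0 mul0r mulr0.
have [c /andP[c1 c2] ->] := br_mvt br pB x1 xy y2.
rewrite [`|y - x|]gtr0_norm ?subr_gt0// mulrAC ler_pM2r ?subr_gt0//.
by apply: (br_contr br pB); rewrite (le_trans x1 c1) (le_trans c2 y2).
Qed.

(** The rates multiply only for distances measured relative to the intervals of the letters; the
    intermediate lengths then cancel. *)
Lemma hw_contr a w x y : path edge a w -> lo (last a w) <= x <= hi (last a w) ->
  lo (last a w) <= y <= hi (last a w) ->
  `|hw a w y - hw a w x| * len (last a w) <= lam ^+ size w * len a * `|y - x|.
Proof.
have /andP[lam0 _] := br_lam br.
elim: w a => [|b w IH] a /=; first by rewrite expr0 mul1r mulrC.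
move=> /andP[ab pw] xI yI; have := IH b pw xI yI.
have := br_contr_dist (p := (a, b)) ab (hw_in pw xI) (hw_in pw yI) => /=.
set Y := `|_ - _| => h1; set Z := `|_ - _| in h1 * => h2; rewrite -(ler_pM2r (len_gt0 b)).
have := ler_wpM2r (ltW (len_gt0 (last b w))) h1.
have la : 0 <= lam * len a by rewrite mulr_ge0 ?ltW ?len_gt0.
have := ler_wpM2l la h2; rewrite exprS; lra.
Qed.

Lemma hw_dist a w x y : path edge a w -> lo (last a w) <= x <= hi (last a w) ->
  lo (last a w) <= y <= hi (last a w) ->
  `|hw a w y - hw a w x| <= len_ratio * lam ^+ size w * `|y - x|.
Proof.
move=> pw xI yI; have /andP[lam0 _] := br_lam br.
have l0 := len_gt0 (last a w); rewrite -(ler_pM2r l0).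
apply: le_trans (hw_contr pw xI yI) _.
rewrite [leRHS]mulrAC ler_wpM2r//.
have := ler_wpM2l (exprn_ge0 (size w) (ltW lam0)) (le_len_ratio a (last a w)); lra.
Qed.

Lemma hw_mono a w x y : path edge a w -> lo (last a w) <= x -> x < y -> y <= hi (last a w) ->
  if ow a w then hw a w y < hw a w x else hw a w x < hw a w y.
Proof.
elim: w a => //= b w IH a /andP[ab pw] x1 xy y1.
have xI : lo (last b w) <= x <= hi (last b w) by rewrite x1 (le_trans (ltW xy)).
have yI : lo (last b w) <= y <= hi (last b w) by rewrite y1 (le_trans _ (ltW xy)).
have /andP[a1 a2] := hw_in pw xI; have /andP[b1 b2] := hw_in pw yI.
have := IH b pw x1 xy y1; case: (ow b w) => k.
  by have := br_mono br (p := (a, b)) ab b1 k a2; case: (o (a, b)).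
by have := br_mono br (p := (a, b)) ab a1 k b2; case: (o (a, b)).
Qed.

Lemma hw_inj a w x y : path edge a w -> lo (last a w) <= x <= hi (last a w) ->
  lo (last a w) <= y <= hi (last a w) -> hw a w x = hw a w y -> x = y.
Proof.
move=> pw /andP[x1 x2] /andP[y1 y2] E; have [xy|yx|//] := ltgtP x y.
  by have := hw_mono pw x1 xy y2; rewrite E ltxx if_same.
by have := hw_mono pw y1 yx x2; rewrite E ltxx if_same.
Qed.

(** Sum of the series of [H0 * (len_ratio * lam ^ n) ^ al], the oscillations of the log-derivatives
    along an orbit that starts from unit distance. *)
Definition distortion_const : R := H0 * len_ratio `^ al / (1 - lam `^ al).
Local Notation H1 := distortion_const.

Lemma len_ratio_gt0 : 0 < len_ratio.
Proof.
have /card_gt0P[a _] := alphabet_nonempty g; have := le_len_ratio a a.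
by move=> h1; rewrite -(pmulr_lgt0 _ (len_gt0 a)); apply: lt_le_trans h1; exact: len_gt0.
Qed.

Lemma lam_al : 0 < lam `^ al < 1.
Proof.
have /andP[lam0 lam1] := br_lam br; rewrite powR_gt0//=.
rewrite -[ltRHS](_ : 1 `^ al = 1); last by rewrite powR1.
by apply: gt0_ltr_powR; rewrite ?(br_al br)// nnegrE// ltW.
Qed.

Lemma distortion_const_gt0 : 0 < H1.
Proof.
have /andP[_ m1] := lam_al.
by rewrite divr_gt0 ?subr_gt0// mulr_gt0 ?(br_H0 br)// powR_gt0 ?len_ratio_gt0.
Qed.

(* The telescoping form of the geometric series bounding the distortion of a
   word of length [n]. *)
Let S n : R := H1 * (1 - (lam `^ al) ^+ n).

Let S_succ n (del x : R) : 0 <= x -> x <= len_ratio * lam ^+ n * del -> 0 <= del ->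
  H0 * x `^ al + S n * del `^ al <= S n.+1 * del `^ al.
Proof.
move=> x0 xd del0; have /andP[lam0 lam1] := br_lam br; have /andP[m0 m1] := lam_al.
have -> : S n.+1 = H0 * len_ratio `^ al * (lam `^ al) ^+ n + S n.
  rewrite /S /distortion_const exprS; field; rewrite gt_eqF// subr_gt0//.
rewrite mulrDl lerD2r -!mulrA ler_pM2l ?(br_H0 br)//.
have -> : (lam `^ al) ^+ n = (lam ^+ n) `^ al.
  by rewrite -(powR_mulrn n (powR_ge0 lam al)) -(powR_mulrn n (ltW lam0)) -!powRrM mulrC.
have l0 := ltW len_ratio_gt0; have p0 := exprn_ge0 n (ltW lam0).
rewrite -!powRM ?mulr_ge0//.
by apply: ge0_ler_powR; rewrite ?nnegrE ?(ltW (br_al br))// mulrA// !mulr_ge0.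
Qed.

Let S_le n (del : R) : S n * del `^ al <= H1 * del `^ al.
Proof.
rewrite ler_wpM2r ?powR_ge0// /S ler_piMr ?(ltW distortion_const_gt0)//.
by have /andP[m0 m1] := lam_al; rewrite lerBlDr lerDl exprn_ge0// ltW.
Qed.

Lemma lw_hol a w x y : path edge a w -> lo (last a w) <= x <= hi (last a w) ->
  lo (last a w) <= y <= hi (last a w) ->
  `|lw a w x - lw a w y| <= H1 * `|x - y| `^ al.
Proof.
move=> pw xI yI; apply: le_trans (S_le (size w) _).
elim: w a pw xI yI => [|b w IH] a /=; first by rewrite /S expr0 !subrr normr0 mulr0 mul0r.
move=> /andP[ab pw] xI yI.
have := S_succ (normr_ge0 _) (hw_dist pw yI xI) (normr_ge0 _); apply: le_trans.
rewrite opprD addrACA; apply: le_trans (ler_normD _ _) _; apply: lerD; last exact: IH.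
by apply: (br_hol br (p := (a, b))) => //; exact: hw_in.
Qed.

(** At each letter the mean value theorem gives an intermediate point, different from letter to
    letter. All of them are compared with the orbit of the single point [z], at distances decreasing
    geometrically. *)
Lemma hw_distortion a w x y z del : path edge a w -> lo (last a w) <= x <= hi (last a w) ->
  lo (last a w) <= y <= hi (last a w) -> lo (last a w) <= z <= hi (last a w) ->
  z - del <= x <= z + del -> z - del <= y <= z + del ->
  expR (lw a w z - H1 * del `^ al) * `|y - x| <= `|hw a w y - hw a w x|
    <= expR (lw a w z + H1 * del `^ al) * `|y - x|.
Proof.
move=> pw xI yI zI xd yd; have del0 : 0 <= del by move: xd => /andP[]; lra.
suff : expR (lw a w z - S (size w) * del `^ al) * `|y - x| <= `|hw a w y - hw a w x|
    <= expR (lw a w z + S (size w) * del `^ al) * `|y - x|.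
  have := S_le (size w) del => h1 /andP[h2 h3]; apply/andP; split.
    by apply: le_trans h2; rewrite ler_wpM2r// ler_expR; lra.
  by apply: le_trans h3 _; rewrite ler_wpM2r// ler_expR; lra.
elim: w a pw xI yI zI => [|b w IH] a /=.
  by rewrite /S expr0 !subrr mulr0 mul0r addr0 subr0 expR0 mul1r lexx.
move=> /andP[ab pw] xI yI zI; have /andP[i1 i2] := IH b pw xI yI zI.
have xI' := hw_in pw xI; have yI' := hw_in pw yI; have zI' := hw_in pw zI.
set X := hw b w x in i1 i2 xI' *; set Y := hw b w y in i1 i2 yI' *; set Z := hw b w z in zI' *.
have dist u : z - del <= u <= z + del -> lo (last b w) <= u <= hi (last b w) ->
    `|hw b w u - Z| <= len_ratio * lam ^+ size w * del.
  move=> ud uI; apply: le_trans (hw_dist pw zI uI) _.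
  rewrite ler_wpM2l//; last by rewrite ler_norml; move: ud => /andP[]; lra.
  have /andP[lam0 _] := br_lam br.
  by rewrite mulr_ge0 ?exprn_ge0// ltW// len_ratio_gt0.
have dX : `|X - Z| <= _ := dist x xd xI; have dY : `|Y - Z| <= _ := dist y yd yI.
set e := len_ratio * lam ^+ size w * del in dX dY.
suff [c cE cd] : exists2 c, `|h (a, b) Y - h (a, b) X| = expR (L (a, b) c) * `|Y - X| &
    `|L (a, b) c - L (a, b) Z| <= H0 * e `^ al.
  have SS := S_succ (le_trans (normr_ge0 _) dX) (lexx _) del0; rewrite -/e in SS.
  move: cd; rewrite cE ler_norml => /andP[c1 c2]; apply/andP; split.
    apply: (@le_trans _ _ (expR (L (a, b) c) * (expR (lw b w z - S (size w) * del `^ al) * `|y - x|))).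
      by rewrite mulrA -expRD ler_wpM2r// ler_expR; lra.
    by rewrite ler_pM2l ?expR_gt0.
  apply: (@le_trans _ _ (expR (L (a, b) c) * (expR (lw b w z + S (size w) * del `^ al) * `|y - x|))).
    by rewrite ler_pM2l ?expR_gt0.
  by rewrite mulrA -expRD ler_wpM2r// ler_expR; lra.
have close c : `|c - Z| <= e -> lo b <= c <= hi b ->
    `|L (a, b) c - L (a, b) Z| <= H0 * e `^ al.
  move=> cd cI; apply: le_trans (br_hol br (p := (a, b)) ab cI zI') _.
  rewrite ler_pM2l ?(br_H0 br)//; apply: ge0_ler_powR; rewrite ?nnegrE ?(ltW (br_al br))//.
  exact: le_trans cd.
move: (xI') (yI') => /andP[x1 x2] /andP[y1 y2].
have [xy|yx|E] := ltgtP X Y.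
- have [c /andP[c1 c2] cE] := br_mvt br (p := (a, b)) ab x1 xy y2.
  exists c; first by rewrite cE [`|Y - X|]gtr0_norm// subr_gt0.
  by apply: close; [exact: (norm_between dX dY)|rewrite (le_trans x1 c1) (le_trans c2 y2)].
- have [c /andP[c1 c2] cE] := br_mvt br (p := (a, b)) ab y1 yx x2.
  exists c; first by rewrite distrC cE distrC [`|X - Y|]gtr0_norm// subr_gt0.
  by apply: close; [exact: (norm_between dY dX)|rewrite (le_trans y1 c1) (le_trans c2 x2)].
- exists X; first by rewrite E !subrr normr0 mulr0.
  by apply: close.
Qed.

End Words.

Lemma lipschitz_within_continuous (R : realType) (f : R -> R) (a b C : R) :
  (forall x y, a <= x <= b -> a <= y <= b -> `|f y - f x| <= C * `|y - x|) ->
  {within `[a, b], continuous f}.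
Proof.
move=> lip; apply/subspace_continuousP => x; rewrite /= in_itv /= => xI.
have C0 : 0 < `|C| + 1 by rewrite ltr_wpDl.
apply/cvgrPdist_le => e e0.
near=> y; have yI : a <= y <= b.
  have : `[a, b]%classic y by near: y; exact: withinT.
  by rewrite /= in_itv.
have yx : `|y - x| <= e / (`|C| + 1).
  rewrite distrC; near: y; apply: cvg_within.
  by apply/nbhs_ballP; exists (e / (`|C| + 1)) => [|z /ltW//]; rewrite /= divr_gt0.
rewrite distrC; apply: le_trans (lip _ _ xI yI) _.
apply: (@le_trans _ _ ((`|C| + 1) * `|y - x|)).
  by rewrite ler_wpM2r// (le_trans (ler_norm C))// lerDl.
by rewrite mulrC -ler_pdivlMr.
Unshelve. all: end_near. Qed.

(** * The Cantor set and its system of loops *)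

Section Cantor.
Variables (R : realType) (r : \bar R) (g : expanding_map r).
Local Notation T := (alphabet g).
Local Notation lo := (lo (e := g)).
Local Notation hi := (hi (e := g)).
Local Notation edge := (@letter_edge R r g).
Local Notation K := (cantor_set g).

(** Mixing, applied to the cylinders of the sequences with value [a], respectively [b], at 0, gives
    an admissible sequence that leads from [a] to [b]. *)
Lemma connect_letters (a b : T) : exists w, [/\ path edge a w, last a w = b & (0 < size w)%N].
Proof.
pose S := subshift (transitions g).
pose U (c : T) : set (bi_seq T) := [set x | x 0 = c].
have oU c : open (U c).
  suff oc : @open (bi_seq T) (@proj int (fun _ => discrete_topology T) 0 @^-1` [set c]) by exact: oc.
  by apply: open_comp; [move=> ? _; exact: proj_continuous|exact: discrete_open].
have SU c : S `&` U c !=set0.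
  have [x Sx [i xi]] := all_letters_used (e := g) c.
  exists (fun j => x (j + i)); split; last by rewrite /U /= add0r.
  by move=> j /=; rewrite -addrA [1 + i]addrC addrA; exact: Sx.
have [N HN] := subshift_mixing (e := g) (oU a) (oU b) (SU a) (SU b).
(* The time [N + 1] instead of [N] makes the word nonempty. *)
have [_ [[x [Sx xa] <-] [_ xb]]] := HN N.+1 (leqnSn N).
have shiftE n (y : bi_seq T) j : iter n (@seq_shift T) y j = y (j + n%:Z).
  by elim: n y j => [|n IH] y j; rewrite ?addr0// iterS /seq_shift IH -addrA -PoszD add1n.
have {}xb : iter N.+1 (@seq_shift T) x 0 = b by exact: xb.
rewrite shiftE add0r in xb.
have pth n k : path edge (x k%:Z) (mkseq (fun i => x (k + i.+1)%N%:Z) n) /\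
    last (x k%:Z) (mkseq (fun i => x (k + i.+1)%N%:Z) n) = x (k + n)%N%:Z.
  elim: n k => [|n IH] k; first by rewrite addn0.
  have mkS (f : nat -> T) m : mkseq f m.+1 = f 0%N :: mkseq (fun i => f i.+1) m.
    by rewrite /mkseq /= (iotaDl 1 0 m) -map_comp.
  have E : mkseq (fun i => x (k + i.+2)%N%:Z) n = mkseq (fun i => x (k.+1 + i.+1)%N%:Z) n.
    by apply: eq_map => i; rewrite addSnnS.
  rewrite mkS E /=.
  have [IH1 IH2] := IH k.+1; rewrite addn1 IH1 IH2 addSnnS; split=> //.
  by rewrite andbT /letter_edge; have := Sx k%:Z; rewrite -PoszD addn1.
have [p1 p2] := pth N.+1 0%N.
exists (mkseq (fun i => x (0 + i.+1)%N%:Z) N.+1); rewrite -xa; split=> //.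
  by rewrite p2.
Qed.

Variables (h L : T * T -> R -> R) (o : T * T -> bool) (lam H0 al : R).
Hypothesis br : branches h L o lam H0 al.
Local Notation hw := (word_map h).
Local Notation lw := (word_log_derive h L).
Local Notation ow := (word_reversing o).
Local Notation H1 := (distortion_const g lam H0 al).

Lemma letter_uniq a b x : lo a <= x <= hi a -> lo b <= x <= hi b -> a = b.
Proof.
move=> xa xb; apply: (intervals_disjoint (e := g)) => //.
by exists x; rewrite /= !in_itv.
Qed.

Lemma edge_uniq p q x : p \in transitions g -> q \in transitions g ->
  lo2 p <= x <= hi2 p -> lo2 q <= x <= hi2 q -> p = q.
Proof.
move=> pB qB xp xq; apply: (subintervals_disjoint (e := g)) => //.
by exists x; rewrite /= !in_itv.
Qed.

Lemma edomP x : edom g x <-> exists2 p, p \in transitions g & lo2 p <= x <= hi2 p.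
Proof.
split=> [[p pB]|[p pB xp]]; first by rewrite /= in_itv; exists p.
by exists p => //; rewrite /= in_itv.
Qed.

Lemma cantor_edom x : K x -> exists2 p, p \in transitions g & lo2 p <= x <= hi2 p.
Proof. by move=> Kx; apply/edomP; exact: (Kx 0%N I). Qed.

Lemma cantor_emap x : K x -> K (emap g x).
Proof. by move=> Kx n _; have := Kx n.+1 I; rewrite /= -iterS iterSr. Qed.

Lemma cantor_h p y : p \in transitions g -> lo p.2 <= y <= hi p.2 -> K y -> K (h p y).
Proof.
move=> pB yI Ky [|n] _.
  by apply/edomP; exists p => //; exact: (br_in br).
by rewrite /preimage /= -iterS iterSr (br_emap br)//; exact: Ky.
Qed.

Lemma cantor_hw a w y : path edge a w -> lo (last a w) <= y <= hi (last a w) -> K y ->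
  K (hw a w y).
Proof.
elim: w a => //= b w IH a /andP[ab pw] yI Ky.
by apply: cantor_h => //=; [exact: (hw_in br)|exact: IH].
Qed.

Lemma cantor_word n x : K x -> exists a w, [/\ path edge a w, size w = n,
  lo (last a w) <= iter n (emap g) x <= hi (last a w), K (iter n (emap g) x)
  & x = hw a w (iter n (emap g) x)].
Proof.
elim: n x => [|n IH] x Kx.
  have [[a b] pB xp] := cantor_edom Kx; exists a, [::]; split=> //=.
  have : x \in `[lo2 (a, b), hi2 (a, b)] by rewrite in_itv.
  by move/(subintervals pB); rewrite /= in_itv.
have [[a b] pB xp] := cantor_edom Kx.
have [c [w [pw sw yI Ky E]]] := IH _ (cantor_emap Kx).
have := br_emap_in br pB xp => /= xI.
have cb : c = b.
  apply: (letter_uniq _ xI); rewrite E; exact: (hw_in br).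
subst c; exists a, (b :: w); rewrite -iterSr in Ky E yI; rewrite /= sw; split=> //.
- by rewrite pw andbT.
by rewrite -iterS -E (br_can br pB xp).
Qed.

Lemma iter_hw a w w' y : path edge a (w ++ w') ->
  lo (last a (w ++ w')) <= y <= hi (last a (w ++ w')) ->
  iter (size w) (emap g) (hw a (w ++ w') y) = hw (last a w) w' y.
Proof.
elim: w a => //= b w IH a /andP[ab pw] yI.
rewrite -iterS iterSr (br_emap br (p := (a, b)))//; first exact: IH.
exact: (hw_in br).
Qed.

Lemma edom_word a w y : path edge a w -> lo (last a w) <= y <= hi (last a w) ->
  (0 < size w)%N -> edom g (iter (size w).-1 (emap g) (hw a w y)).
Proof.
case/lastP: w => //= w b; rewrite size_rcons -cats1 => pw yI _ /=.
rewrite iter_hw//=; move: pw yI; rewrite cat_path last_cat /= andbT => /andP[_ ab] yI.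
by apply/edomP; exists (last a w, b) => //; exact: (br_in br).
Qed.

Lemma hw_continuous a w : path edge a w ->
  {within `[lo (last a w), hi (last a w)], continuous (hw a w)}.
Proof.
move=> pw; apply: (@lipschitz_within_continuous _ _ _ _ (len_ratio g * lam ^+ size w)).
by move=> x y xI yI; exact: (hw_dist br).
Qed.

(** A loop at [a] maps [I(a)] continuously into itself and has a fixed point. The orbit of that
    point under [g] is periodic and follows the letters of the loop, so it never leaves the
    domain. *)
Lemma cantor_nonempty a : exists2 x, K x & lo a <= x <= hi a.
Proof.
have [w [pw lw w0]] := connect_letters a a.
have loI : lo a <= lo a <= hi a by rewrite lexx ltW// lo_lt_hi.
have hiI : lo a <= hi a <= hi a by rewrite lexx ltW// lo_lt_hi.
have [c cI fc] : exists2 c, c \in `[lo a, hi a] & hw a w c - c = 0.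
  apply: (@IVT _ (fun x => hw a w x - x) (lo a) (hi a)).
  - by rewrite ltW// lo_lt_hi.
  - have := hw_continuous pw; rewrite lw => hc x.
    by apply: continuousB; [exact: hc|apply: continuous_subspaceT => ?].
  have := hw_in br pw (x := lo a); have := hw_in br pw (x := hi a); rewrite lw.
  move=> /(_ hiI)/andP[_ h1] /(_ loI)/andP[h2 _].
  by rewrite ge_min le_max !subr_ge0 !subr_le0 h1 h2 orbT.
rewrite in_itv /= in cI; move/eqP: fc; rewrite subr_eq0 => /eqP fc.
exists c => //.
have per : iter (size w) (emap g) c = c.
  have := @iter_hw a w [::] c; rewrite cats0 /= lw fc; exact.
have perk k n : iter (n + k * size w) (emap g) c = iter n (emap g) c.
  by elim: k => [|k IH]; rewrite ?addn0// mulSn [(size w + _)%N]addnC addnA iterD per IH.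
have small n : (n < size w)%N -> edom g (iter n (emap g) c).
  move=> nw; have sz : size (take n.+1 w) = n.+1 by rewrite size_takel.
  rewrite -[in X in iter _ _ X]fc -[w](cat_take_drop n.+1).
  have pw' := pw; rewrite -{1}[w](cat_take_drop n.+1) cat_path in pw'.
  case/andP: pw' => p1 p2; rewrite hw_cat.
  have := edom_word (y := hw (last a (take n.+1 w)) (drop n.+1 w) c) p1; rewrite sz.
  by apply=> //; apply: (hw_in br) => //; rewrite -last_cat cat_take_drop lw.
move=> n _; rewrite /preimage /= (divn_eq n (size w)) addnC perk.
by apply: small; rewrite ltn_mod.
Qed.

(** [K] is the intersection over [n] of the images of the intervals under the words of length [n],
    and each stage is a finite union of compact sets. *)
Lemma cantor_compact : compact K.
Proof.
pose E n : set R := \bigcup_(p in [set p : T * n.-tuple T | path edge p.1 p.2])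
  (hw p.1 p.2 @` `[lo (last p.1 p.2), hi (last p.1 p.2)]).
have EK : K = \bigcap_n E n.
  apply/seteqP; split=> [x Kx n _|x Ex].
    have [a [w [pw sw yI Ky Ew]]] := cantor_word n Kx.
    have /eqP sw' := sw; exists (a, Tuple sw') => //=.
    by exists (iter n (emap g) x) => //; rewrite /= in_itv.
  move=> n _; have [[a w] /= pw [y yI <-]] := Ex n.+1 I.
  rewrite /= in_itv /= in yI.
  have := edom_word pw yI; rewrite size_tuple; exact.
have cE n (p : T * n.-tuple T) : path edge p.1 p.2 ->
    compact (hw p.1 p.2 @` `[lo (last p.1 p.2), hi (last p.1 p.2)]).
  move=> pp; apply: continuous_compact; last exact: segment_compact.
  exact: hw_continuous.
have clE n : closed (E n).
  apply: closed_bigcup => [|p /= pp]; first exact: finite_finset.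
  by apply: compact_closed; [exact: Rhausdorff|exact: cE].
have cE0 : compact (E 0%N).
  have -> : E 0%N = \big[setU/set0]_(p <- enum {: T * 0.-tuple T} | path edge p.1 p.2)
     (hw p.1 p.2 @` `[lo (last p.1 p.2), hi (last p.1 p.2)]).
    rewrite -bigcup_seq_cond; apply: eq_bigcupl; split=> p /=; first by rewrite mem_enum.
    by case/andP.
  by apply: bigsetU_compact => p pp; exact: cE.
rewrite EK; apply: (subclosed_compact _ cE0); last by move=> x; exact.
by apply: closed_bigI => n _; exact: clE.
Qed.

(** Returning to [a] makes these branches composable, and preserving orientation makes them
    increasing, as [csystem] demands. *)
Definition loops a : set (R -> R) :=
  [set f | exists w, [/\ path edge a w, last a w = a, ow a w = false & f = hw a w]].

Lemma small_distortion (eta : R) : 0 < eta -> exists2 d : R, 0 < d & expR (2 * H1 * d `^ al) <= 1 + eta.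
Proof.
move=> eta0; have H10 : 0 < H1 by exact: (distortion_const_gt0 br).
have l0 : 0 < ln (1 + eta) by rewrite ln_gt0//; lra.
have H20 : 0 < 2 * H1 by apply: mulr_gt0.
move: (2 * H1) H20 => H2 H20.
exists ((ln (1 + eta) / H2) `^ al^-1); first by apply: powR_gt0; exact: divr_gt0.
rewrite -powRrM mulVf ?gt_eqF ?(br_al br)// powRr1 ?divr_ge0 ?(ltW l0) ?(ltW H20)//.
by rewrite mulrC divfK ?gt_eqF// lnK// posrE; lra.
Qed.

Lemma loop_mono a f x y : loops a f -> lo a <= x -> x < y -> y <= hi a -> f x < f y.
Proof.
move=> [w [pw lw ow0 ->]] x1 xy y1.
by have := hw_mono br pw (x := x) (y := y); rewrite lw ow0; exact.
Qed.

Lemma loop_distortion a f x y x' y' z del : loops a f ->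
  lo a <= x -> x < y -> y <= hi a -> lo a <= x' -> x' < y' -> y' <= hi a ->
  lo a <= z <= hi a -> z - del <= x -> y <= z + del -> z - del <= x' -> y' <= z + del ->
  (f y - f x) * (y' - x') <= expR (2 * H1 * del `^ al) * (f y' - f x') * (y - x).
Proof.
move=> Ff h1 h2 h3 h4 h5 h6 zI h7 h8 h9 h10.
have fxy := loop_mono Ff h1 h2 h3; have fxy' := loop_mono Ff h4 h5 h6.
move: Ff => [w [pw lwa ow0 fE]].
have := hw_distortion br pw (x := x) (y := y) (z := z) (del := del).
have := hw_distortion br pw (x := x') (y := y') (z := z) (del := del).
rewrite lwa -fE !ger0_norm ?subr_ge0 ?(ltW h5) ?(ltW h2) ?(ltW fxy) ?(ltW fxy')//.
move=> A1 A2; have {A1} /andP[A1 _] : expR (lw a w z - H1 * del `^ al) * (y' - x') <= f y' - f x' <=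
  expR (lw a w z + H1 * del `^ al) * (y' - x').
  by apply: A1; rewrite ?h4 ?h6 ?h9 ?h10 ?(le_trans h4 (ltW h5)) ?(le_trans (ltW h5) h6)
    ?(le_trans (ltW h5) h10) ?(le_trans h9 (ltW h5)).
have {A2} /andP[_ A2] : expR (lw a w z - H1 * del `^ al) * (y - x) <= f y - f x <=
  expR (lw a w z + H1 * del `^ al) * (y - x).
  by apply: A2; rewrite ?h1 ?h3 ?h7 ?h8 ?(le_trans h1 (ltW h2)) ?(le_trans (ltW h2) h3)
    ?(le_trans (ltW h2) h8) ?(le_trans h7 (ltW h2)).
have p1 : 0 < y' - x' by lra. have p2 : 0 < y - x by lra.
apply: (@le_trans _ _ (expR (lw a w z + H1 * del `^ al) * (y - x) * (y' - x'))).
  by rewrite ler_pM2r.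
have -> : lw a w z + H1 * del `^ al = 2 * H1 * del `^ al + (lw a w z - H1 * del `^ al) by ring.
rewrite expRD [leLHS]mulrAC ler_pM2r//.
rewrite -[leLHS]mulrA.
rewrite ler_pM2l ?expR_gt0//.
Qed.

Lemma loops_csystem a : csystem (lo a) (hi a) (K `&` `[lo a, hi a]) (loops a).
Proof.
split.
- exact: lo_lt_hi.
- by move=> x [].
- by apply: compact_closedI; [exact: cantor_compact|exact: interval_closed].
- by have [x Kx xI] := cantor_nonempty a; exists x; split=> //=; rewrite in_itv.
- by exists [::].
- move=> _ _ [w [pw lw ow0 ->]] [w' [pw' lw' ow0' ->]]; exists (w ++ w').
  rewrite cat_path last_cat lw pw pw' lw' ow_cat ow0 lw ow0'; split=> //.
  by apply/funext => x /=; rewrite hw_cat lw.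
- by move=> _ x [w [pw lw ow0 ->]] xI; apply: (hw_in br); rewrite ?lw.
- by move=> f x y Ff; exact: loop_mono.
- move=> _ x [w [pw lw ow0 ->]] [Kx]; rewrite /= in_itv /= => xI.
  split; first by apply: cantor_hw; rewrite ?lw.
  by rewrite /= in_itv /=; apply: (hw_in br); rewrite ?lw.
- exists (expR (2 * H1 * (len a) `^ al)); first exact: expR_gt0.
  move=> f x y x' y' Ff h1 h2 h3 h4 h5 h6.
  have ll := lo_lt_hi a.
  by apply: (loop_distortion (z := lo a) Ff) => //; rewrite /len ?lexx/= ?(ltW ll)//; lra.
move=> eta eta0; have [d d0 Hd] := small_distortion eta0; exists d => //.
move=> f z x y x' y' Ff h1 h2 h3 h4 h5 h6 h7 h8 h9 h10.
have fxy' := loop_mono Ff h4 h5 h6.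
apply: (@le_trans _ _ (expR (2 * H1 * d `^ al) * (f y' - f x') * (y - x))).
  (* The point [z] of the statement may lie outside [I(a)]; the smaller left end serves as reference
     point instead. *)
  apply: (loop_distortion (z := Num.min x x') Ff) => //.
  - by rewrite le_min h1 h4/= ge_min (le_trans (ltW h2) h3).
  - by rewrite lerBlDr ge_min lerDl (ltW d0).
  - by rewrite -lerBlDr le_min !lerBlDr; apply/andP; split; lra.
  - by rewrite lerBlDr ge_min lerDl (ltW d0) orbT.
  - by rewrite -lerBlDr le_min !lerBlDr; apply/andP; split; lra.
by rewrite ler_pM2r ?subr_gt0// ler_pM2r ?subr_gt0.
Qed.

End Cantor.

Lemma finite_lower_bound (R : realType) (I : finType) (P : I -> R) :
  (forall i, 0 < P i) -> exists2 c : R, 0 < c & forall i, c <= P i.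
Proof.
move=> P0; pose s := 1 + \sum_i (P i)^-1.
have s0 : 0 < s by rewrite ltr_wpDr ?sumr_ge0// => i _; rewrite invr_ge0 ltW.
exists s^-1; first by rewrite invr_gt0.
move=> i; rewrite -[P i]invrK lef_pV2 ?posrE ?invr_gt0// /s (bigD1 i)//= addrCA lerDl.
by rewrite addr_ge0// sumr_ge0// => j _; rewrite invr_ge0 ltW.
Qed.

Lemma small_expr (R : realType) (lam x : R) : 0 < lam < 1 -> 0 < x ->
  exists N, lam ^+ N < x.
Proof.
move=> /andP[lam0 lam1] x0.
have : (fun n => lam ^+ n) @ \oo --> (0 : R) by apply: cvg_expr; rewrite gtr0_norm.
move=> /cvgrPdist_lt /(_ x x0)[N _ HN]; exists N.
by have := HN N (leqnn N); rewrite /= sub0r normrN gtr0_norm// exprn_gt0.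
Qed.

Lemma pigeonhole_filter (X : eqType) (I : finType) (key : X -> I) (s : seq X) :
  (0 < #|I|)%N -> exists k, (size s <= #|I| * size [seq x <- s | key x == k])%N.
Proof.
move=> I0; have [//|H] := pselect (exists k, (size s <= #|I| * size [seq x <- s | key x == k])%N).
exfalso; have Hk k : (#|I| * size [seq x <- s | key x == k] < size s)%N.
  by rewrite ltnNge; apply/negP => h; apply: H; exists k.
have : (\sum_(k : I) #|I| * size [seq x <- s | key x == k] < \sum_(k : I) size s)%N.
  case/card_gt0P: I0 => k0 _; rewrite (bigD1 k0)//= [ltnRHS](bigD1 k0)//=.
  by rewrite -addSn leq_add// leq_sum// => k _; exact: ltnW.
rewrite -big_distrr /= sum_nat_const ltn_pmul2l// ltnNge => /negP; apply.
rewrite -sum1_size (partition_big key predT)//=; apply: leq_sum => k _.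
by rewrite size_filter -sum1_count leqnn.
Qed.

(** * Branching loops at exponents below the box dimension *)

Section Branching.
Variables (R : realType) (r : \bar R) (g : expanding_map r).
Local Notation T := (alphabet g).
Local Notation lo := (lo (e := g)).
Local Notation hi := (hi (e := g)).
Local Notation edge := (@letter_edge R r g).
Local Notation K := (cantor_set g).
Variables (h L : T * T -> R -> R) (o : T * T -> bool) (lam H0 al : R).
Hypothesis br : branches h L o lam H0 al.
Local Notation hw := (word_map h).
Local Notation lw := (word_log_derive h L).
Local Notation ow := (word_reversing o).
Local Notation H1 := (distortion_const g lam H0 al).
Local Notation loops := (@loops R r g h o).

Definition word_size a w : R := `|hw a w (hi (last a w)) - hw a w (lo (last a w))|.
Local Notation sw := word_size.

Lemma lo_in a : lo a <= lo a <= hi a.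
Proof. by rewrite lexx ltW// lo_lt_hi. Qed.

Lemma hi_in a : lo a <= hi a <= hi a.
Proof. by rewrite lexx ltW// lo_lt_hi. Qed.

Lemma sw_gt0 a w : path edge a w -> 0 < sw a w.
Proof.
move=> pw; rewrite normr_gt0 subr_eq0; apply/eqP => E.
have := hw_inj br pw (hi_in _) (lo_in _) E; have := lo_lt_hi (last a w) => l E'.
by rewrite E' ltxx in l.
Qed.

Lemma sw_contr a w : path edge a w -> sw a w <= lam ^+ size w * len a.
Proof.
move=> pw; rewrite -(ler_pM2r (len_gt0 (last a w))).
have := hw_contr br pw (lo_in _) (hi_in _).
by rewrite [`|hi _ - lo _|]gtr0_norm// len_gt0.
Qed.

(** Multiplicativity of sizes up to a constant, for words between arbitrary letters and of either
    orientation. *)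
Lemma sw_cat : exists2 C : R, 0 < C & forall a w w', path edge a (w ++ w') ->
  sw a (w ++ w') * len (last a w) <= C * sw a w * sw (last a w) w' /\
  sw a w * sw (last a w) w' <= C * sw a (w ++ w') * len (last a w).
Proof.
pose Lm : R := \sum_a len (g := g) a.
have LmP (a : T) : len a <= Lm.
  by rewrite /Lm (bigD1 a)//= lerDl sumr_ge0// => b _; rewrite ltW// len_gt0.
exists (expR (2 * (H1 * Lm `^ al))); first exact: expR_gt0.
move=> a w w'; rewrite cat_path => /andP[pw pw'].
set b := last a w; pose P := hw b w' (lo (last b w')); pose Q := hw b w' (hi (last b w')).
have PI : lo b <= P <= hi b by apply: (hw_in br) => //; exact: lo_in.
have QI : lo b <= Q <= hi b by apply: (hw_in br) => //; exact: hi_in.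
have E : sw a (w ++ w') = `|hw a w Q - hw a w P| by rewrite /word_size last_cat !hw_cat.
have bI y : lo b <= y <= hi b -> lo b - Lm <= y <= lo b + Lm.
  by move=> /andP[y1 y2]; have := LmP b; have := len_gt0 b; rewrite /len; move=> ? ?; apply/andP; split; lra.
have := hw_distortion br pw PI QI (lo_in b) (bI _ PI) (bI _ QI).
have := hw_distortion br pw (lo_in b) (hi_in b) (lo_in b) (bI _ (lo_in b)) (bI _ (hi_in b)).
rewrite -E -/(sw a w) -/(sw b w') [`|hi b - _|]gtr0_norm ?len_gt0// -/(len b).
set X := H1 * Lm `^ al; set l := lw a w (lo b) => /andP[s1 s2] /andP[s3 s4].
have e0 : 0 < expR (2 * X) := expR_gt0 _.
have EX : expR (l + X) = expR (2 * X) * expR (l - X) by rewrite -expRD; congr expR; ring.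
have wb := ltW (len_gt0 b); have wb' := ltW (sw_gt0 pw').
split.
  have := ler_wpM2r wb s4; have := ler_wpM2r wb' (ler_wpM2l (ltW e0) s1); rewrite EX; lra.
have := ler_wpM2r wb' s2; have := ler_wpM2r wb (ler_wpM2l (ltW e0) s3); rewrite EX; lra.
Qed.

Lemma sw_rcons : exists2 c : R, 0 < c <= 1 & forall a w b, path edge a (rcons w b) ->
  c * sw a w <= sw a (rcons w b).
Proof.
have [C C0 HC] := sw_cat.
pose P (p : T * T) : R := if edge p.1 p.2 then sw p.1 [:: p.2] / (C * len p.1) else 1.
have P0 p : 0 < P p.
  rewrite /P; case: ifP => // pe; rewrite divr_gt0 ?mulr_gt0 ?len_gt0//.
  by apply: sw_gt0; rewrite /= pe.
have [c c0 cP] := finite_lower_bound P0.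
exists (Num.min c 1); first by rewrite lt_min c0 ltr01 ge_min lexx orbT.
move=> a w b; rewrite -cats1 => pw; have [_ h2] := HC _ _ _ pw.
move: (pw); rewrite cat_path /= andbT => /andP[pw1 eb].
apply: (@le_trans _ _ (P (last a w, b) * sw a w)).
  by rewrite ler_wpM2r ?(ltW (sw_gt0 pw1))// (le_trans _ (cP _))// ge_min lexx.
rewrite /P /= eb mulrAC ler_pdivrMr ?mulr_gt0 ?len_gt0//; move: h2; lra.
Qed.

(** The extensions of [w] stopped when their size first drops below [e]. The argument [n] only
    bounds the depth: [stops_cover] shows that nothing is lost once [lam ^ n] is small. *)
Fixpoint stops (e : R) (a : T) (n : nat) (w : seq T) : seq (seq T) :=
  if sw a w < e then [:: w] else
  if n is n'.+1 then
    flatten [seq stops e a n' (rcons w b) | b <- enum T & edge (last a w) b]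
  else [::].

Lemma stopsP e a n w v (c : R) : (forall w b, path edge a (rcons w b) ->
    c * sw a w <= sw a (rcons w b)) -> path edge a w -> 0 < c -> c * e <= sw a w ->
  v \in stops e a n w ->
  [/\ path edge a v, exists u, v = w ++ u, sw a v < e & c * e <= sw a v].
Proof.
move=> Hc pw c0; elim: n w pw => [|n IH] w pw cw /=; case: ifP => we.
- by rewrite inE => /eqP ->; split=> //; exists [::]; rewrite cats0.
- by [].
- by rewrite inE => /eqP ->; split=> //; exists [::]; rewrite cats0.
move=> /flatten_mapP[b]; rewrite mem_filter => /andP[eb _] vs.
have pb : path edge a (rcons w b) by rewrite rcons_path pw.
have cb : c * e <= sw a (rcons w b).
  by apply: le_trans (Hc _ _ pb); rewrite ler_pM2l// leNgt we.
have [p1 [u E] p3 p4] := IH (rcons w b) pb cb vs.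
by split=> //; exists (b :: u); rewrite E cat_rcons.
Qed.

Lemma stops_path e a n w v : path edge a w -> v \in stops e a n w ->
  path edge a v /\ exists u, v = w ++ u.
Proof.
elim: n w => [|n IH] w pw /=; case: ifP => we.
- by rewrite inE => /eqP ->; split=> //; exists [::]; rewrite cats0.
- by [].
- by rewrite inE => /eqP ->; split=> //; exists [::]; rewrite cats0.
move=> /flatten_mapP[b]; rewrite mem_filter => /andP[eb _] vs.
have pb : path edge a (rcons w b) by rewrite rcons_path pw.
have [p1 [u E]] := IH _ pb vs.
by split=> //; exists (b :: u); rewrite E cat_rcons.
Qed.

(** Two distinct stopped words part at some letter, and the intervals of distinct edges are
    disjoint; the common part is injective. *)
Lemma stops_disjoint e a n w v v' y y' : path edge a w -> v \in stops e a n w ->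
  v' \in stops e a n w -> v != v' -> lo (last a v) <= y <= hi (last a v) ->
  lo (last a v') <= y' <= hi (last a v') -> hw a v y <> hw a v' y'.
Proof.
elim: n w => [|n IH] w pw /=; case: ifP => // we.
- by rewrite !inE => /eqP -> /eqP ->; rewrite eqxx.
- by rewrite !inE => /eqP -> /eqP ->; rewrite eqxx.
move=> /flatten_mapP[b]; rewrite mem_filter => /andP[eb _] vs.
move=> /flatten_mapP[b']; rewrite mem_filter => /andP[eb' _] vs' vv' yI yI' E.
have pb : path edge a (rcons w b) by rewrite rcons_path pw.
have pb' : path edge a (rcons w b') by rewrite rcons_path pw.
have [bb|bb] := eqVneq b b'; first by subst b'; exact: (IH (rcons w b) pb vs vs' vv' yI yI' E).
have [pv [u vE]] := stops_path pb vs; have [pv' [u' vE']] := stops_path pb' vs'.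
move: pv pv' yI yI' E; rewrite vE vE' !cat_rcons !cat_path /= !last_cat /=.
move=> /and3P[_ _ pu] /and3P[_ _ pu'] yI yI'; rewrite !hw_cat /=.
have uI := hw_in br pu yI; have uI' := hw_in br pu' yI'.
move=> /(hw_inj br pw (br_in1 br (p := (_, _)) eb uI) (br_in1 br (p := (_, _)) eb' uI')) E.
have h1 := br_in br (p := (_, _)) eb uI; have h2 := br_in br (p := (_, _)) eb' uI'.
rewrite E in h1; have := edge_uniq eb eb' h1 h2 => -[bE].
by rewrite bE eqxx in bb.
Qed.

Lemma stops_cover e a n w y : path edge a w -> lam ^+ (size w + n) * len a < e ->
  lo (last a w) <= y <= hi (last a w) -> K y -> exists2 v, v \in stops e a n w &
  exists2 y', lo (last a v) <= y' <= hi (last a v) & hw a w y = hw a v y'.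
Proof.
elim: n w y => [|n IH] w y pw small yI Ky /=; case: ifP => we.
- by exists w; rewrite ?inE//; exists y.
- by move: we; rewrite (le_lt_trans (sw_contr pw))// -[size w]addn0.
- by exists w; rewrite ?inE//; exists y.
have [[c b] pB yp] := cantor_edom Ky.
have cE : c = last a w.
  apply: (letter_uniq _ yI); rewrite -(br_can br pB yp); apply: (br_in1 br pB).
  exact: (br_emap_in br).
subst c; have pb : path edge a (rcons w b) by rewrite rcons_path pw.
have [|||v vs [y' yI' E]] := IH (rcons w b) (emap g y) pb.
- by rewrite size_rcons addSnnS.
- by rewrite last_rcons; exact: (br_emap_in br pB yp).
- exact: cantor_emap.
exists v; first by apply/flatten_mapP; exists b => //; rewrite mem_filter mem_enum andbT; exact: pB.
by exists y' => //; rewrite -E -cats1 hw_cat /= (br_can br pB yp).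
Qed.

Lemma loop_ivt a f y : loops a f -> f (lo a) <= y <= f (hi a) ->
  exists2 x, lo a <= x <= hi a & f x = y.
Proof.
move=> Ff /andP[y1 y2]; have fl := loop_mono br Ff (lexx _) (lo_lt_hi a) (lexx _).
have [w [pw lwa ow0 fE]] := Ff.
have [||x] := @IVT _ f (lo a) (hi a) y (ltW (lo_lt_hi a)).
- by have := hw_continuous br pw; rewrite lwa -fE.
- by rewrite ge_min y1/= le_max y2 orbT.
by rewrite in_itv; exists x.
Qed.

Lemma loops_disjoint a f f' : loops a f -> loops a f' ->
  (forall y y', lo a <= y <= hi a -> lo a <= y' <= hi a -> f y <> f' y') ->
  f (hi a) < f' (lo a) \/ f' (hi a) < f (lo a).
Proof.
move=> Ff Ff' H; have [|h1] := ltP (f (hi a)) (f' (lo a)); first by left.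
have [|h2] := ltP (f' (hi a)) (f (lo a)); first by right.
have [h3|h3] := leP (f (lo a)) (f' (lo a)).
  have [|x xI E] := loop_ivt Ff (y := f' (lo a)); first by rewrite h3.
  by case: (H _ _ xI (lo_in a) E).
have [|x xI E] := loop_ivt Ff' (y := f (lo a)); first by rewrite (ltW h3).
by case: (H _ _ (lo_in a) xI); rewrite E.
Qed.

(* A reversing extension is corrected by a reversing loop, if there is one. *)
Lemma word_to_loop a : exists pre : T -> seq T, exists post : T * T * bool -> seq T,
  exists2 k : R, 0 < k & forall b w,
  path edge b w -> let v := pre b ++ (w ++ post (b, last b w, ow b w)) in
  [/\ path edge a v, last a v = a, ow a v = false,
      (path edge a (pre b) /\ last a (pre b) = b) & k * sw b w <= sw a v].
Proof.
have [C C0 HC] := sw_cat.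
have /choice[pre Hpre] (b : T) := connect_letters a b.
have /choice[post0 Hpost] (c : T) := connect_letters c a.
have [u0 [pu lu] rev] : exists2 u0, path edge a u0 /\ last a u0 = a &
    (forall w, path edge a w -> last a w = a -> ow a w -> ow a u0).
  have [[u [pu lu ou]]|none] := pselect (exists u, [/\ path edge a u, last a u = a & ow a u]).
    by exists u.
  by exists [::] => // w pw lw ow; exfalso; apply: none; exists w.
pose post (p : T * T * bool) := post0 p.1.2 ++
  (if ow a (pre p.1.1) (+) (p.2 (+) ow p.1.2 (post0 p.1.2)) then u0 else [::]).
have ppost p : path edge p.1.2 (post p) /\ last p.1.2 (post p) = a.
  have [p1 p2 _] := Hpost p.1.2.
  by rewrite /post cat_path last_cat p1 p2; case: ifP.
pose P (p : T * T * bool) := sw a (pre p.1.1) / (C * len p.1.1) *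
  (sw p.1.2 (post p) / (C * len p.1.2)).
have P0 p : 0 < P p.
  have [p1 p2 _] := Hpre p.1.1; have [p3 p4] := ppost p.
  by rewrite mulr_gt0 ?divr_gt0 ?mulr_gt0 ?len_gt0 ?sw_gt0.
have [k k0 kP] := finite_lower_bound P0.
exists pre, post, k => // b w pw /=; set c := last b w; set p := (b, c, ow b w).
have [p1 p2 _] := Hpre b; have [p3 p4] := ppost p; have [p5 p6 _] := Hpost c.
have pv : path edge b (w ++ post p) by rewrite cat_path pw p3.
have pav : path edge a (pre b ++ (w ++ post p)) by rewrite cat_path p1 p2 pv.
split=> //.
- by rewrite last_cat p2 last_cat p4.
- rewrite ow_cat p2 ow_cat -/c /post /p /= ow_cat p6 /=.
  have [e|e] := boolP (ow a (pre b) (+) (ow b w (+) ow c (post0 c))).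
    have -> : ow a u0.
      apply: (rev (pre b ++ (w ++ post0 c))).
      - by rewrite cat_path p1 p2 cat_path pw p5.
      - by rewrite last_cat p2 last_cat p6.
      - by rewrite ow_cat p2 ow_cat.
    by move: e; case: (ow a _); case: (ow b w); case: (ow c _).
  by move: e; case: (ow a _); case: (ow b w); case: (ow c _).
apply: (@le_trans _ _ (P p * sw b w)); first by rewrite ler_wpM2r// ltW// sw_gt0.
have [_ h1] := HC _ _ _ pav; have [_ h2] := HC _ _ _ pv.
rewrite p2 in h1; rewrite -/c in h2.
rewrite /P /= mulf_div mulrAC ler_pdivrMr ?mulr_gt0 ?len_gt0//.
have s1 := ltW (sw_gt0 p1); have := ler_wpM2l s1 h2.
have Cl : 0 <= C * len c by rewrite mulr_ge0 ?ltW ?len_gt0.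
have := ler_wpM2r Cl h1; rewrite -/p; lra.
Qed.

Lemma hw_dist_sw a w x y : path edge a w -> lo (last a w) <= x <= hi (last a w) ->
  lo (last a w) <= y <= hi (last a w) -> `|hw a w x - hw a w y| <= sw a w.
Proof.
move=> pw xI yI; set b := last a w in xI yI *.
have mono u v : lo b <= u -> u <= v -> v <= hi b ->
    if ow a w then hw a w v <= hw a w u else hw a w u <= hw a w v.
  move=> u1 uv v1; have [E|ne] := eqVneq u v; first by rewrite E lexx if_same.
  have := hw_mono br pw (x := u) (y := v) u1; rewrite lt_neqAle ne uv => /(_ isT v1).
  by case: ifP => _ /ltW.
have l := ltW (lo_lt_hi b); move: xI yI => /andP[x1 x2] /andP[y1 y2]; rewrite /word_size -/b.
have := mono _ _ (lexx _) x1 x2; have := mono _ _ x1 x2 (lexx _).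
have := mono _ _ (lexx _) y1 y2; have := mono _ _ y1 y2 (lexx _); have := mono _ _ (lexx _) l (lexx _).
move: (hw a w x) (hw a w y) (hw a w (lo b)) (hw a w (hi b)) => X Y P Q.
case: (ow a w) => k1 k2 k3 k4 k5.
  by rewrite [leRHS]ler0_norm ?subr_le0// ler_norml; apply/andP; split; lra.
by rewrite [leRHS]ger0_norm ?subr_ge0// ler_norml; apply/andP; split; lra.
Qed.

Lemma loop_ratio (C : R) a u v (x : R) :
  (forall a w w', path edge a (w ++ w') ->
    sw a (w ++ w') * len (last a w) <= C * sw a w * sw (last a w) w' /\
    sw a w * sw (last a w) w' <= C * sw a (w ++ w') * len (last a w)) ->
  path edge a u -> last a u = a -> ow a u = false ->
  path edge a v -> last a v = a -> ow a v = false ->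
  0 < C -> x * (C * len a) <= sw a v -> sw a v * (2 * C) <= len a ->
  x * (hw a u (hi a) - hw a u (lo a)) <=
    hw a u (hw a v (hi a)) - hw a u (hw a v (lo a)) <= (hw a u (hi a) - hw a u (lo a)) / 2.
Proof.
move=> HC pu lu ou pv lv ov C0 xv v2; have uv : path edge a (u ++ v) by rewrite cat_path pu lu.
have [h1 h2] := HC _ _ _ uv; rewrite lu in h1 h2.
have lp f : loops a f -> `|f (hi a) - f (lo a)| = f (hi a) - f (lo a).
  by move=> Lf; rewrite gtr0_norm// subr_gt0 (loop_mono br Lf)// lo_lt_hi.
have su : sw a u = hw a u (hi a) - hw a u (lo a) by rewrite /word_size lu lp//; exists u.
have suv : sw a (u ++ v) = hw a u (hw a v (hi a)) - hw a u (hw a v (lo a)).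
  rewrite /word_size last_cat lu lv lp; first by rewrite !hw_cat lu.
  by exists (u ++ v); rewrite last_cat ow_cat lu ou.
rewrite -su -suv; have l0 := len_gt0 a; have su0 := ltW (sw_gt0 pu).
apply/andP; split; rewrite -(ler_pM2r l0).
  rewrite -(ler_pM2r C0); have := ler_wpM2l su0 xv; lra.
have := ler_wpM2l su0 v2; lra.
Qed.

(** Needed for Cantor sets of dimension 0, which have no positive exponent below their dimension: at
    exponent 0 one small loop is enough. *)
Lemma branching_zero a : branching (lo a) (hi a) (loops a) 0.
Proof.
have [C C0 HC] := sw_cat; have [w [pw lwa w0]] := connect_letters a a.
have /andP[lam0 lam1] := br_lam br.
have C20 : 0 < (2 * C)^-1 by rewrite invr_gt0 mulr_gt0.
have [N HN] := small_expr (br_lam br) C20.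
have [v [pv lv ov sv]] : exists v, [/\ path edge a v, last a v = a, ow a v = false & (N <= size v)%N].
  (* Iterating a loop an even number of times restores the orientation. *)
  have Hk k : exists v, [/\ path edge a v, last a v = a, ow a v = odd k && ow a w & (k <= size v)%N].
    elim: k => [|k [v [pv lv ov sv]]]; first by exists [::].
    exists (w ++ v); rewrite cat_path pw lwa last_cat lwa ow_cat lwa ov size_cat; split=> //.
      by rewrite /=; case: (odd k); case: (ow a w).
    by rewrite -add1n leq_add.
  have [v [pv lv ov sv]] := Hk (N.*2); exists v; split=> //; first by rewrite ov odd_double.
  by apply: leq_trans sv; rewrite -addnn leq_addr.
exists 1%N, (fun _ => hw a v), (sw a v / (C * len a)); split.
- by rewrite divr_gt0 ?sw_gt0 ?mulr_gt0 ?len_gt0.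
- by move=> _; exists v.
- by move=> i j; rewrite !ord1 eqxx.
- move=> _ _ [u [pu lu ou ->]]; apply: (@loop_ratio C _ _ _ _ HC pu lu ou pv lv ov C0).
    by rewrite divfK// gt_eqF// mulr_gt0 ?len_gt0.
  rewrite -ler_pdivlMr ?mulr_gt0//; apply: le_trans (sw_contr pv) _.
  rewrite mulrC ler_pM2l ?len_gt0//; apply: le_trans (ltW HN).
  by apply: ler_wiXn2l; rewrite ?(ltW lam0) ?(ltW lam1).
by rewrite powRr0.
Qed.

(** A single scale [e] suffices at which [K] needs more than [e ^- d1] balls, [d1 > d]. The words
    stopped at size [e] cover [K]; a fixed proportion of them share their end letters and
    orientation and are closed into loops by the same prefix and suffix. The constants are absorbed
    by the gap between [d] and [d1]. *)
Lemma branching_loops a d : 0 < d -> (d%:E < upper_box_dim K)%E ->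
  branching (lo a) (hi a) (loops a) d.
Proof.
move=> d0 dK; have [C C0 HC] := sw_cat.
have [d1 d1d d1K] : exists2 d1, d < d1 & ~ (upper_box_dim K <= d1%:E)%E.
  case E : (upper_box_dim K) dK => [x||] // dx.
    by rewrite lte_fin in dx; exists ((d + x) / 2); rewrite ?lee_fin; lra.
  by exists (d + 1); [lra|rewrite leye_eq].
have Hbig e0 : 0 < e0 -> exists e, [/\ 0 < e, e < e0 &
    forall n, ball_cover K e n -> e^-1 `^ d1 < n%:R].
  move=> e00; have [//|H] := pselect (exists e, [/\ 0 < e, e < e0 &
    forall n, ball_cover K e n -> e^-1 `^ d1 < n%:R]).
  exfalso; apply: d1K; apply: upper_box_dim_le; exists e0 => // e ep ee.
  have [//|H'] := pselect (exists2 n, ball_cover K e n & n%:R <= e^-1 `^ d1).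
  exfalso; apply: H; exists e; split=> // n cn; rewrite ltNge; apply/negP => h1.
  by apply: H'; exists n.
have [pre [post [k k0 Hw]]] := word_to_loop a.
have [c1 /andP[c10 c11] Hc] := sw_rcons.
have l0 (b : T) : 0 < len b := len_gt0 b.
have [lm lm0 lmP] := finite_lower_bound l0.
(* [k] is the loss in closing a word into a loop, [c1] the loss at stopping, and [C * len a] the
   loss in composing with another loop. *)
pose c2 := k * c1 / (C * len a).
have c20 : 0 < c2 by rewrite divr_gt0 ?mulr_gt0.
pose keys := #|{: T * T * bool}|.
have dd : 0 < d1 - d by lra.
have [e1 e10 He1] := powR_inv_large (c2^-1 `^ d * keys%:R) dd.
pose lr := len_ratio g.
have lr0 : 0 < lr by exact: (len_ratio_gt0).
(* Below this scale each loop at least halves the size of any branch that it follows. *)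
pose e2 := len a / (2 * C * lr).
have e20 : 0 < e2 by rewrite divr_gt0 ?mulr_gt0.
have [|e [ep ee He]] := Hbig (Num.min (Num.min lm e1) e2).
  by rewrite !lt_min lm0 e10.
move: ee; rewrite !lt_min => /andP[/andP[elm ee1] ee2].
have [N HN] : exists N, forall b : T, lam ^+ N * len b < e.
  have el (b : T) : 0 < e / len b by rewrite divr_gt0.
  have [x x0 Hx] := finite_lower_bound el; have [N HN] := small_expr (br_lam br) x0.
  by exists N => b; rewrite -ltr_pdivlMr//; exact: lt_le_trans (Hx b).
pose s := undup (flatten [seq [seq (b, v) | v <- stops e b N [::]] | b <- enum T]).
have sP b v : (b, v) \in s = (v \in stops e b N [::]).
  rewrite mem_undup; apply/flatten_mapP/idP => [[b' _ /mapP[v' vs [-> ->]]]//|vs].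
  by exists b; rewrite ?mem_enum//; apply/mapP; exists v.
have cov : ball_cover K e (size s).
  exists (fun i => hw (tnth (in_tuple s) i).1 (tnth (in_tuple s) i).2
      (lo (last (tnth (in_tuple s) i).1 (tnth (in_tuple s) i).2))) => x Kx.
  have [[b b'] pB xp] := cantor_edom Kx.
  have xI : lo b <= x <= hi b.
    have : x \in `[lo2 (b, b'), hi2 (b, b')] by rewrite in_itv.
    by move/(subintervals pB); rewrite /= in_itv.
  have [|v vs [y yI xE]] := @stops_cover e b N [::] x isT _ xI Kx; first exact: HN.
  have vs' : (b, v) \in in_tuple s by rewrite /= sP.
  have [i iE] := tnthP _ _ vs'; exists i => //=; rewrite -iE /= /ball /=.
  have [//|pv _ vse _] := stopsP (w := [::]) (fun w b' => Hc b w b') isT c10 _ vs.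
    rewrite /word_size /= gtr0_norm ?len_gt0//; apply: (le_trans _ (lmP b)).
    by apply: (le_trans _ (ltW elm)); rewrite ler_piMl// ltW.
  by move: xE => /= ->; apply: le_lt_trans vse; apply: hw_dist_sw => //; exact: lo_in.
(* Words with equal end letters and orientation receive the same prefix and suffix, so their loops
   stay disjoint. *)
have [key Hkey] : exists key, (size s <= keys * size
    [seq p <- s | (p.1, last p.1 p.2, ow p.1 p.2) == key])%N.
  by apply: pigeonhole_filter; apply/card_gt0P; exists (a, a, true).
move: key Hkey => [[b0 b1] q]; set s' := [seq p <- s | _] => Hkey.
pose n := size s'.
have s'P i : (i < n)%N -> let p := nth (a, [::]) s' i in
   [/\ p = (b0, p.2), p.2 \in stops e b0 N [::], last b0 p.2 = b1 & ow b0 p.2 = q].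
  move=> im /=; have := mem_nth (a, [::]) im; case: (nth _ _ _) => b v.
  by rewrite mem_filter /= sP => /andP[/eqP[-> <- <-] vs].
pose W i := (nth (a, [::]) s' i).2.
have WP (i : 'I_n) : [/\ W i \in stops e b0 N [::], last b0 (W i) = b1, ow b0 (W i) = q,
    path edge b0 (W i) & sw b0 (W i) < e /\ c1 * e <= sw b0 (W i)].
  have /= [_ ws l1 o1] := s'P i (ltn_ord i).
  have [//|pv _ vse vse'] := stopsP (w := [::]) (fun w b' => Hc b0 w b') isT c10 _ ws.
    rewrite /word_size /= gtr0_norm ?len_gt0//; apply: (le_trans _ (lmP b0)).
    by apply: (le_trans _ (ltW elm)); rewrite ler_piMl// ltW.
  by split.
pose V (i : 'I_n) := pre b0 ++ (W i ++ post (b0, b1, q)).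
have VP i : [/\ path edge a (V i), last a (V i) = a, ow a (V i) = false,
      path edge a (pre b0) /\ last a (pre b0) = b0 & k * sw b0 (W i) <= sw a (V i)].
  by have [_ lE oE pw _] := WP i; rewrite /V; have := Hw b0 _ pw; rewrite lE oE.
exists n, (fun i => hw a (V i)), (c2 * e); split.
- by rewrite mulr_gt0.
- by move=> i; have [p1 p2 p3 _ _] := VP i; exists (V i).
- move=> i j ij; have [p1 p2 p3 [p4 p4'] _] := VP i; have [q1 q2 q3 _ _] := VP j.
  apply: loops_disjoint; [by exists (V i)|by exists (V j)|move=> y y' yI yI' E].
  have [w1 l1 o1 pw1 _] := WP i; have [w2 l2 o2 pw2 _] := WP j.
  have Wij : W i != W j.
    apply: contra_neq ij => E'; apply: val_inj; apply/eqP.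
    have us : uniq s' by rewrite filter_uniq// undup_uniq.
    rewrite -(nth_uniq (a, [::]) _ _ us) ?ltn_ord//.
    have [-> _ _ _] := s'P i (ltn_ord i); have [-> _ _ _] := s'P j (ltn_ord j).
    by apply/eqP; congr pair.
  move: p1 q1 p2 q2 E; rewrite /V !cat_path p4 p4' !last_cat p4' l1 l2 pw1 pw2 /=.
  move=> pp _ lp _; rewrite !hw_cat p4' l1 l2.
  have Y1 : lo b1 <= hw b1 (post (b0, b1, q)) y <= hi b1 by apply: (hw_in br); rewrite ?lp.
  have Y2 : lo b1 <= hw b1 (post (b0, b1, q)) y' <= hi b1 by apply: (hw_in br); rewrite ?lp.
  move=> /(hw_inj br p4); rewrite p4' => E.
  apply: (stops_disjoint (w := [::]) isT w1 w2 Wij _ _ (E _ _)); rewrite ?l1 ?l2//.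
    by apply: (hw_in br); rewrite ?l1.
  by apply: (hw_in br); rewrite ?l2.
- move=> _ i [u [pu lu ou ->]]; have [p1 p2 p3 [p4 p4'] szV] := VP i.
  have [w1 l1 o1 pw1 [sw1 sw2]] := WP i.
  have pV : path edge b0 (W i ++ post (b0, b1, q)).
    by move: p1; rewrite /V cat_path p4'; case/andP.
  apply: (@loop_ratio C _ _ _ (c2 * e) HC pu lu ou p1 p2 p3 C0).
    rewrite /c2 mulrAC divfK ?gt_eqF ?mulr_gt0//.
    by apply: le_trans szV; rewrite -mulrA ler_pM2l.
  apply: (@le_trans _ _ (lr * e * (2 * C))); last first.
    have := ltW ee2; rewrite /e2 ler_pdivlMr ?mulr_gt0//; lra.
  rewrite ler_pM2r ?mulr_gt0//.
  have := hw_dist br p4 (x := hw b0 (W i ++ post (b0, b1, q)) (lo a))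
     (y := hw b0 (W i ++ post (b0, b1, q)) (hi a)).
  have lE : last b0 (W i ++ post (b0, b1, q)) = a by move: p2; rewrite /V last_cat p4'.
  have k1 := hw_in br pV (x := lo a); have k2 := hw_in br pV (x := hi a).
  rewrite lE in k1 k2; rewrite p4' => /(_ (k1 (lo_in a)) (k2 (hi_in a))).
  rewrite /word_size p2 /V !hw_cat p4' -!hw_cat => h1; apply: le_trans h1 _.
  have /andP[lam0 lam1] := br_lam br.
  apply: ler_pM => //; first by rewrite mulr_ge0 ?exprn_ge0 ?(ltW lam0)// ltW.
    by rewrite ler_piMr ?(ltW lr0)// exprn_ile1 ?(ltW lam0) ?(ltW lam1).
  have [pp lpp] : path edge b1 (post (b0, b1, q)) /\ last b1 (post (b0, b1, q)) = a.
    by move: pV lE; rewrite cat_path last_cat l1 => /andP[_ ->] ->.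
  apply: le_trans (ltW sw1); rewrite !hw_cat; apply: hw_dist_sw => //; rewrite ?l1.
    by apply: (hw_in br) => //; rewrite lpp; exact: hi_in.
  by apply: (hw_in br) => //; rewrite lpp; exact: lo_in.
rewrite invfM powRM ?invr_ge0 ?(ltW c20) ?(ltW ep)//.
have h2 := He _ cov; have h1 := He1 _ ep ee1.
have E : e^-1 `^ d1 = e^-1 `^ (d1 - d) * e^-1 `^ d by rewrite -powRD_gt0 ?invr_gt0// subrK.
rewrite E in h2.
have h3 : (size s)%:R <= keys%:R * n%:R :> R by rewrite -natrM ler_nat.
have e0 : 0 < e^-1 `^ d by apply: powR_gt0; rewrite invr_gt0.
have keys0 : 0 < keys%:R :> R by rewrite ltr0n; apply/card_gt0P; exists (a, a, true).
rewrite -(ler_pM2l keys0); apply: le_trans h3; apply: le_trans (ltW h2).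
by rewrite mulrA ler_pM2r// mulrC.
Qed.

End Branching.

(** * One-sided derivatives *)

Section OneSidedCalculus.
Variable R : realType.
Implicit Types (D : set R) (f h : R -> R).

Definition quotient_lim D f x (l : R) := forall e : R, 0 < e ->
  exists2 d : R, 0 < d & forall y, D y -> y != x -> `|y - x| < d -> `|quotient f x y - l| <= e.

Definition clusters_at D (x : R) := forall d : R, 0 < d -> exists y, [/\ D y, y != x & `|y - x| < d].

Lemma quotient_limP D f x l : quotient f x @ within D x^' --> l <-> quotient_lim D f x l.
Proof.
split=> [/cvgrPdist_le H e e0|H].
  have /nbhs_ballP[d /= d0 Hd] := H e e0; exists d => // y Dy yx yd; rewrite distrC.
  by apply: Hd => //; rewrite /ball /= distrC.
apply/cvgrPdist_le => e e0; have [d d0 Hd] := H e e0.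
apply/nbhs_ballP; exists d => // y /=; rewrite /ball /= => yd yx Dy.
by rewrite distrC Hd// distrC.
Qed.

Lemma derivable_onP D f x : derivable_on D f -> D x -> quotient_lim D f x (derive_on D f x).
Proof. by move=> df Dx; apply/quotient_limP; exact: df. Qed.

Lemma quotient_lim_uniq D f x l l' : clusters_at D x ->
  quotient_lim D f x l -> quotient_lim D f x l' -> l = l'.
Proof.
move=> acc Hl Hl'; apply/eqP; rewrite -subr_eq0 -normr_le0 leNgt; apply/negP => e0.
have e30 : 0 < `|l - l'| / 3 by rewrite divr_gt0.
have [d d0 Hd] := Hl _ e30; have [d' d'0 Hd'] := Hl' _ e30.
have [|y [Dy yx]] := acc (Num.min d d'); first by rewrite lt_min d0.
rewrite lt_min => /andP[y1 y2]; have := Hd y Dy yx y1; have := Hd' y Dy yx y2.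
have := ler_distD (quotient f x y) l l'; rewrite [`|l - quotient _ _ _|]distrC.
lra.
Qed.

Lemma derive_onE D f x l : clusters_at D x -> quotient_lim D f x l -> derive_on D f x = l.
Proof.
move=> acc Hl; apply: (quotient_lim_uniq acc _ Hl); apply/quotient_limP.
by apply: (cvgP l); apply/quotient_limP.
Qed.

Lemma derivable_on_from D f f' : (forall x, D x -> quotient_lim D f x (f' x)) -> derivable_on D f.
Proof. by move=> H x Dx; apply: (cvgP (f' x)); apply/quotient_limP; exact: H. Qed.

Lemma within_continuousP D f : {within D, continuous f} <->
  forall x, D x -> forall e, 0 < e -> exists2 d, 0 < d &
    forall y, D y -> `|y - x| < d -> `|f y - f x| <= e.
Proof.
split=> [/subspace_continuousP H x Dx e e0|H].
  have /cvgrPdist_le /(_ e e0) /nbhs_ballP[d /= d0 Hd] := H x Dx.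
  by exists d => // y Dy yd; rewrite distrC; apply: Hd => //; rewrite /ball /= distrC.
apply/subspace_continuousP => x Dx; apply/cvgrPdist_le => e e0.
have [d d0 Hd] := H x Dx e e0; apply/nbhs_ballP; exists d => // y /=; rewrite /ball /= => yd Dy.
by rewrite distrC Hd// distrC.
Qed.

Lemma itv_clusters_at (a b x : R) : a < b -> a <= x <= b -> clusters_at `[a, b] x.
Proof.
move=> ab /andP[ax xb] d d0; have [xb'|bx] := ltP x b.
  exists (x + Num.min d (b - x) / 2).
  have m0 : 0 < Num.min d (b - x) by rewrite lt_min d0 subr_gt0.
  have m1 : Num.min d (b - x) <= d by rewrite ge_min lexx.
  have m2 : Num.min d (b - x) <= b - x by rewrite ge_min lexx orbT.
  split; first by rewrite /= in_itv /=; apply/andP; split; lra.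
    by apply/eqP; lra.
  by rewrite addrC addKr gtr0_norm; lra.
exists (x - Num.min d (x - a) / 2).
have m0 : 0 < Num.min d (x - a) by rewrite lt_min d0 subr_gt0 (lt_le_trans ab).
have m1 : Num.min d (x - a) <= d by rewrite ge_min lexx.
have m2 : Num.min d (x - a) <= x - a by rewrite ge_min lexx orbT.
split; first by rewrite /= in_itv /=; apply/andP; split; lra.
  by apply/eqP; lra.
rewrite (_ : x - Num.min d (x - a) / 2 - x = - (Num.min d (x - a) / 2)); last by ring.
by rewrite normrN gtr0_norm; lra.
Qed.

Lemma is_deriveP f (x l : R) : is_derive x 1 f l <-> quotient_lim setT f x l.
Proof.
have E y : y != x -> (y - x)^-1 *: (f ((y - x) *: 1 + x) - f x) = quotient f x y.
  by move=> yx; rewrite /quotient /GRing.scale /= mulr1 subrK mulrC.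
split=> [[df dv]|H].
  move=> e e0; have /cvgrPdist_le /(_ e e0) /nbhs_ballP[d /= d0 Hd] : (fun t => t^-1 *: (f (t *: 1 + x) - f x)) @ 0^' --> l.
    by rewrite -dv.
  exists d => // y _ yx yd; rewrite distrC -E//; apply: Hd.
    by rewrite /ball /= sub0r normrN.
  by rewrite subr_eq0.
have C : (fun t => t^-1 *: (f (t *: 1 + x) - f x)) @ 0^' --> l.
  apply/cvgrPdist_le => e e0; have [d d0 Hd] := H e e0.
  apply/nbhs_ballP; exists d => // t /=; rewrite /ball /= sub0r normrN => td t0.
  have tx : x + t != x by rewrite -subr_eq0 addrC addKr.
  have := E (x + t) tx; rewrite addrC addKr addrC => ->.
  by rewrite distrC Hd// addrC addKr.
by split; [exact: (cvgP l)|exact: cvg_lim].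
Qed.

Lemma quotient_lim_sub D D' f x l : D' `<=` D -> quotient_lim D f x l -> quotient_lim D' f x l.
Proof. by move=> DD H e e0; have [d d0 Hd] := H e e0; exists d => // y /DD; exact: Hd. Qed.

Lemma quotient_lim_local D D' f x l (r : R) : 0 < r ->
  (forall y, D y -> `|y - x| < r -> D' y) -> quotient_lim D' f x l -> quotient_lim D f x l.
Proof.
move=> r0 DD H e e0; have [d d0 Hd] := H e e0; exists (Num.min d r); first by rewrite lt_min d0.
by move=> y Dy yx; rewrite lt_min => /andP[yd yr]; apply: Hd => //; exact: DD.
Qed.

Lemma quotient_lim_continuous D f x l : quotient_lim D f x l ->
  forall e, 0 < e -> exists2 d, 0 < d & forall y, D y -> `|y - x| < d -> `|f y - f x| <= e.
Proof.
move=> H e e0; have [d d0 Hd] := H 1 ltr01; have c0 : 0 < `|l| + 1 by rewrite ltr_wpDl.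
exists (Num.min d (e / (`|l| + 1))); first by rewrite lt_min d0 divr_gt0.
move=> y Dy; rewrite lt_min => /andP[yd ye]; have [->|yx] := eqVneq y x; first by rewrite subrr normr0 ltW.
have := Hd y Dy yx yd; set q := quotient _ _ _ => hq.
have -> : f y - f x = q * (y - x) by rewrite /q /quotient divfK// subr_eq0.
rewrite normrM; have hq' : `|q| <= `|l| + 1.
  have := ler_normD (q - l) l; rewrite subrK; lra.
apply: le_trans (ler_wpM2r (normr_ge0 _) hq') _.
by rewrite mulrC -ler_pdivlMr// ltW.
Qed.

Lemma interval_mvt (a b : R) f x y : derivable_on `[a, b] f ->
  a <= x -> x < y -> y <= b -> exists2 c, x <= c <= y &
  f y - f x = derive_on `[a, b] f c * (y - x).
Proof.
move=> df ax xy yb.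
have [||c] := @MVT R f (derive_on `[a, b] f) x y xy.
- move=> z; rewrite in_itv /= => /andP[xz zy]; apply/is_deriveP.
  have zI : `[a, b]%classic z by rewrite /= in_itv /=; apply/andP; split; lra.
  apply: (quotient_lim_local (r := Num.min (z - x) (y - z))) (derivable_onP df zI).
    by rewrite lt_min !subr_gt0 xz.
  move=> t _; rewrite lt_min => /andP[]; rewrite !ltr_norml => /andP[t1 t2] /andP[t3 t4].
  by rewrite /= in_itv /=; apply/andP; split; lra.
- apply/within_continuousP => z; rewrite /= in_itv /= => /andP[xz zy] e e0.
  have zI : `[a, b]%classic z by rewrite /= in_itv /=; apply/andP; split; lra.
  have [d d0 Hd] := quotient_lim_continuous (derivable_onP df zI) e0.
  exists d => // t; rewrite /= in_itv /= => /andP[t1 t2]; apply: Hd.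
  by rewrite /= in_itv /=; apply/andP; split; lra.
by rewrite in_itv /= => /andP[c1 c2] E; exists c => //; rewrite !ltW.
Qed.

Lemma Cr_on_C1 (a b : R) (r : \bar R) f : (1 < r)%E -> Cr_on `[a, b] r f ->
  derivable_on `[a, b] f /\ {within `[a, b], continuous derive_on `[a, b] f}.
Proof.
have C1 n : (0 < n)%N -> Cn_on `[a, b] n f ->
    derivable_on `[a, b] f /\ {within `[a, b], continuous derive_on `[a, b] f}.
  by move=> n0 [d c]; split; [exact: (d 0%N)|exact: (c 1%N)].
case: r => [r||]//= r1; last by move=> /(_ 1%N); exact: C1.
move=> [H _]; apply: C1 H; rewrite lte_fin in r1.
have /andP[_] := truncn_itv (ltW (lt_trans ltr01 r1)).
by case: (Num.truncn r) => // r1'; have := lt_trans r1 r1'; rewrite ltxx.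
Qed.

Lemma Cn_on_lipschitz (a b : R) f : a < b -> Cn_on `[a, b] 2 f ->
  exists2 C, 0 < C & forall x y, a <= x <= b -> a <= y <= b ->
    `|derive_on `[a, b] f x - derive_on `[a, b] f y| <= C * `|x - y| `^ 1.
Proof.
move=> ab [d c]; have c2 := c 2%N isT; have d1 := d 1%N isT.
have cn : {within `[a, b], continuous (fun x => `|derive_n_on `[a, b] 2 f x|)}.
  by move=> x; apply: continuous_comp; [exact: c2|exact: norm_continuous].
have [c' c'I maxc] := EVT_max (ltW ab) cn.
exists (`|derive_n_on `[a, b] 2 f c'| + 1); first by rewrite ltr_wpDl.
move=> x y; rewrite powRr1//; wlog xy : x y / x < y => [H xI yI|/andP[x1 x2] /andP[y1 y2]].
  have [xy|yx|->] := ltgtP x y; first exact: H.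
    by rewrite distrC [`|x - y|]distrC; exact: H.
  by rewrite !subrr normr0 mulr0.
have [z zI E] := interval_mvt d1 x1 xy y2.
rewrite distrC E normrM [`|y - x|]distrC ler_wpM2r// ler_wpDr//; apply: maxc.
by rewrite in_itv /=; move: zI => /andP[? ?]; apply/andP; split; lra.
Qed.

(** The exponent depends on [r] alone: 1 if two derivatives are available, by the mean value
    theorem, and [r - 1] if [1 < r < 2]. *)
Lemma Cr_on_holder (r : \bar R) : (1 < r)%E -> exists2 al : R, 0 < al &
  forall a b f, a < b -> Cr_on `[a, b] r f -> exists2 C, 0 < C &
    forall x y, a <= x <= b -> a <= y <= b ->
    `|derive_on `[a, b] f x - derive_on `[a, b] f y| <= C * `|x - y| `^ al.
Proof.
case: r => [r||]//= r1; last first.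
  by exists 1 => // a b f ab /(_ 2%N); exact: Cn_on_lipschitz.
rewrite lte_fin in r1; have r0 : 0 <= r by rewrite ltW// (lt_trans ltr01).
have /andP[t1 t2] := truncn_itv r0; set n := Num.truncn r in t1 t2 *.
have n1 : (0 < n)%N by rewrite lt0n; apply/eqP => n0; rewrite n0 in t2; lra.
have [n2|n2] := leqP 2 n.
  exists 1 => // a b f ab [[d c] _]; apply: Cn_on_lipschitz => //.
  by split=> k kn; [apply: d|apply: c]; exact: leq_trans n2.
have {n1 n2} nE : n = 1%N by apply/eqP; rewrite eqn_leq n1 -ltnS n2.
rewrite nE; exists (r - 1); first by rewrite subr_gt0.
move=> a b f ab [_ /(_ r1)[C HC]]; exists (`|C| + 1); first by rewrite ltr_wpDl.
move=> x y xI yI; have h1 := HC x y; rewrite !in_itv /= in h1.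
apply: le_trans (h1 xI yI) _.
by rewrite ler_wpM2r ?powR_ge0// (le_trans (ler_norm C))// lerDl.
Qed.

(** The difference quotients of [h] at [x] and of [f] at [h x] are exactly inverse to each other,
    and both converge. *)
Lemma inverse_derive (a b a2 b2 : R) f h : a < b ->
  derivable_on `[a2, b2] f -> derivable_on `[a, b] h ->
  (forall x, a <= x <= b -> a2 <= h x <= b2) -> (forall x, a <= x <= b -> f (h x) = x) ->
  forall x, a <= x <= b -> derive_on `[a, b] h x * derive_on `[a2, b2] f (h x) = 1.
Proof.
move=> ab df dh hI fh x xI.
have Dx : `[a, b]%classic x by rewrite /= in_itv.
have Dhx : `[a2, b2]%classic (h x) by rewrite /= in_itv; exact: hI.
have Hh := derivable_onP dh Dx; have Hf := derivable_onP df Dhx.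
move: Hh Hf; set l1 := derive_on _ h x; set l2 := derive_on _ f _ => Hh Hf.
apply/eqP; rewrite -subr_eq0 -normr_le0 leNgt; apply/negP => e0.
set E := `|_| in e0; have c0 : 0 < `|l1| + `|l2| + 1 by rewrite ltr_wpDl// addr_ge0.
pose e := Num.min 1 (E / (2 * (`|l1| + `|l2| + 1))).
have ep : 0 < e by rewrite lt_min ltr01 divr_gt0// mulr_gt0.
have [d1 d10 H1] := Hh e ep; have [d2 d20 H2] := Hf e ep.
have [d3 d30 H3] := quotient_lim_continuous Hh (divr_gt0 d20 (ltr0Sn _ 1)).
have [|y [Dy yx]] := itv_clusters_at ab xI (d := Num.min d1 d3); first by rewrite lt_min d10.
rewrite lt_min => /andP[yd1 yd3].
have yI : a <= y <= b by move: Dy; rewrite /= in_itv.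
have hyx : h y != h x by apply: contra_neq yx => E'; rewrite -[y]fh// E' fh.
have q1 := H1 y Dy yx yd1.
have q2 : `|quotient f (h x) (h y) - l2| <= e.
  apply: H2 => //; first by rewrite /= in_itv; exact: hI.
  by apply: le_lt_trans (H3 y Dy yd3) _; lra.
have q12 : quotient h x y * quotient f (h x) (h y) = 1.
  rewrite /quotient !fh//; field; by rewrite !subr_eq0 hyx yx.
move: q1 q2 q12; set p := quotient _ _ _; set q := quotient _ _ _ => q1 q2 q12.
have e1 : e <= 1 by rewrite ge_min lexx.
have e2 : e * (2 * (`|l1| + `|l2| + 1)) <= E by rewrite -ler_pdivlMr ?mulr_gt0// ge_min lexx orbT.
have : E <= e * (`|l1| + `|l2| + 1).
  have -> : E = `|p * q - l1 * l2| by rewrite q12 distrC.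
  rewrite (_ : p * q - l1 * l2 = (p - l1) * (q - l2) + (p - l1) * l2 + l1 * (q - l2)); last by ring.
  apply: le_trans (ler_normD _ _) _.
  have h3 : `|l1 * (q - l2)| <= e * `|l1| by rewrite normrM mulrC ler_wpM2r.
  apply: le_trans (lerD (ler_normD _ _) h3) _; rewrite -lerBrDr.
  have h2 : `|(p - l1) * l2| <= e * `|l2| by rewrite normrM ler_wpM2r.
  have h1 : `|(p - l1) * (q - l2)| <= e.
    by rewrite normrM -[e]mulr1; apply: ler_pM => //; exact: le_trans e1.
  by apply: le_trans (lerD h1 h2) _; rewrite lerBrDr le_eqVlt; apply/orP; left; apply/eqP; ring.
move=> Ele; have := le_trans e2 Ele; rewrite ler_pM2l// leNgt => /negP; apply.
by rewrite ltr_pMl// ltr1n.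
Qed.

Lemma ln_lipschitz (m s t : R) : 0 < m -> m <= s -> m <= t -> `|ln s - ln t| <= `|s - t| / m.
Proof.
move=> m0; wlog st : s t / t <= s => [H ms mt|ms mt].
  by have [/H|/ltW/H] := leP t s; [exact|rewrite distrC [`|s - t|]distrC; exact].
have t0 : 0 < t by lra. have s0 : 0 < s by lra.
rewrite !ger0_norm ?subr_ge0// ?ler_ln//.
rewrite -ln_div// (_ : s / t = 1 + (s - t) / t); last by field; rewrite gt_eqF.
have st0 : 0 <= (s - t) / t by rewrite divr_ge0 ?subr_ge0// ltW.
apply: le_trans (le_ln1Dx _) _; first by lra.
by rewrite ler_wpM2l ?subr_ge0// lef_pV2.
Qed.

End OneSidedCalculus.

(** * Construction of the inverse branches *)

Section InverseBranches.
Variables (R : realType) (r : \bar R) (g : expanding_map r).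
Hypothesis r1 : (1 < r)%E.
Local Notation T := (alphabet g).
Local Notation lo := (lo (e := g)).
Local Notation hi := (hi (e := g)).

Definition branch_derive (h : T * T -> R -> R) p := derive_on `[lo p.2, hi p.2] (h p).
Definition log_derive h p x := ln `|branch_derive h p x|.
(** The sign at one end point decides, since the derivative of a branch is continuous and has no
    zero. *)
Definition reversing h p := branch_derive h p (lo p.2) < 0.

Lemma branch_derive_facts h p : p \in transitions g ->
  Cr_diffeo r `[lo2 p, hi2 p] `[lo p.2, hi p.2] (emap g) (h p) ->
  [/\ derivable_on `[lo p.2, hi p.2] (h p),
      {within `[lo p.2, hi p.2], continuous branch_derive h p},
      forall x, lo p.2 <= x <= hi p.2 -> branch_derive h p x != 0 &
      forall x, lo p.2 <= x <= hi p.2 -> `|branch_derive h p x| * len p.2 < len p.1].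
Proof.
move=> pB [fD hE hf fh [Crf Crh]].
have [df _] := Cr_on_C1 r1 Crf; have [dh ch] := Cr_on_C1 r1 Crh.
have hI x : lo p.2 <= x <= hi p.2 -> lo2 p <= h p x <= hi2 p.
  by move=> xI; have := hE (h p x); rewrite /= !in_itv; apply; exists x => //; rewrite /= in_itv.
have fhI x : lo p.2 <= x <= hi p.2 -> emap g (h p x) = x.
  by move=> xI; apply: fh; rewrite /= in_itv.
have E := inverse_derive (lo_lt_hi p.2) df dh hI fhI.
split=> // x xI; have := E x xI; rewrite -/(branch_derive h p x) => Ex.
  by apply/eqP => b0; move/eqP: Ex; rewrite b0 mul0r eq_sym oner_eq0.
have hxI : h p x \in `[lo2 p, hi2 p] by rewrite in_itv; exact: hI.
have := emap_expanding pB hxI; set d := derive_on _ _ _ in Ex *.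
have l2 : 0 < hi p.2 - lo p.2 by rewrite subr_gt0 lo_lt_hi.
have d0 : 0 < `|d|.
  by rewrite normr_gt0; apply/eqP => d0; move/eqP: Ex; rewrite d0 mulr0 eq_sym oner_eq0.
have Ea : `|branch_derive h p x| = `|d|^-1.
  by apply: (mulIf (lt0r_neq0 d0)); rewrite -normrM Ex normr1 mulVf ?lt0r_neq0.
rewrite mulrA ltr_pdivlMr// mul1r => h1.
by rewrite Ea mulrC ltr_pdivrMr// mulrC.
Qed.

Lemma branches_exist : exists (h : T * T -> R -> R) (lam H0 al : R),
  branches h (log_derive h) (reversing h) lam H0 al /\
  forall p, p \in transitions g ->
  Cr_diffeo r `[lo2 p, hi2 p] `[lo p.2, hi p.2] (emap g) (h p).
Proof.
have /choice[h Hh] (p : T * T) : exists h, p \in transitions g ->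
    Cr_diffeo r `[lo2 p, hi2 p] `[lo p.2, hi p.2] (emap g) h.
  by have [/emap_diffeo[h H]|_] := boolP (p \in transitions g); [exists h|exists id].
have facts p (pB : p \in transitions g) := branch_derive_facts pB (Hh p pB).
have [al al0 Hal] := Cr_on_holder r1.
have cn p : p \in transitions g -> {within `[lo p.2, hi p.2], continuous (fun x => `|branch_derive h p x|)}.
  move=> pB x; have [_ ch _ _] := facts p pB.
  by apply: continuous_comp; [exact: ch|exact: norm_continuous].
have lohi (p : T * T) : lo p.2 <= hi p.2 by rewrite ltW// lo_lt_hi.
have /choice[m Hm] (p : T * T) : exists m : R, 0 < m /\ (p \in transitions g ->
    forall x, lo p.2 <= x <= hi p.2 -> m <= `|branch_derive h p x|).
  have [pB|_] := boolP (p \in transitions g); last by exists 1.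
  have [c cI Hc] := EVT_min (lohi p) (cn p pB); have [_ _ nz _] := facts p pB.
  exists `|branch_derive h p c|; rewrite normr_gt0 nz; last by rewrite in_itv in cI.
  by split=> // _ x xI; apply: Hc; rewrite in_itv.
have /choice[mu Hmu] (p : T * T) : exists m : R, 0 < m /\ (p \in transitions g ->
    forall x, lo p.2 <= x <= hi p.2 -> `|branch_derive h p x| * len p.2 <= (1 - m) * len p.1).
  have [pB|_] := boolP (p \in transitions g); last by exists 1.
  have [c cI Hc] := EVT_max (lohi p) (cn p pB); have [_ _ _ lt] := facts p pB.
  rewrite in_itv in cI; have {}lt := lt c cI; have l1 := len_gt0 p.1; have l2 := len_gt0 p.2.
  exists (1 - `|branch_derive h p c| * len p.2 / len p.1); split.
    by rewrite subr_gt0 ltr_pdivrMr// mul1r.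
  move=> _ x xI; rewrite subKr divfK ?gt_eqF// ler_pM2r//; apply: Hc; rewrite in_itv//.
have /choice[C HC] (p : T * T) : exists C : R, 0 < C /\ (p \in transitions g ->
    forall x y, lo p.2 <= x <= hi p.2 -> lo p.2 <= y <= hi p.2 ->
    `|branch_derive h p x - branch_derive h p y| <= C * `|x - y| `^ al).
  have [pB|_] := boolP (p \in transitions g); last by exists 1.
  have [_ _ _ _ [_ Crh]] := Hh p pB; have [C C0 HC] := Hal _ _ _ (lo_lt_hi p.2) Crh.
  by exists C.
have mu0 p : 0 < mu p by have [] := Hmu p.
have [mu' mu'0 Hmu'] := finite_lower_bound mu0.
(* The maximum with [1 / 2] keeps the rate positive. *)
pose lam := Num.max (1 - mu') 2^-1.
have CM p : 0 < m p / C p by rewrite divr_gt0; [|have [] := Hm p|have [] := HC p].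
have [c c0 Hc] := finite_lower_bound CM.
have expL p x : p \in transitions g -> lo p.2 <= x <= hi p.2 ->
    expR (log_derive h p x) = `|branch_derive h p x|.
  by move=> pB xI; have [_ _ nz _] := facts p pB; rewrite lnK// posrE normr_gt0 nz.
exists h, lam, c^-1, al; split=> //; split=> //.
- rewrite lt_max gt_max invr_gt0 ltr0n orbT /=; apply/andP; split; lra.
- by rewrite invr_gt0.
- move=> p x pB xI; have [_ hE _ _ _] := Hh p pB.
  by have := hE (h p x); rewrite /= !in_itv; apply; exists x => //; rewrite /= in_itv.
- by move=> p x pB xI; have [_ _ _ fh _] := Hh p pB; apply: fh; rewrite /= in_itv.
- move=> p x pB xI; have [fD _ _ _ _] := Hh p pB.
  by have := fD (emap g x); rewrite /= !in_itv; apply; exists x => //; rewrite /= in_itv.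
- by move=> p x pB xI; have [_ _ hf _ _] := Hh p pB; apply: hf; rewrite /= in_itv.
- move=> p x y pB x1 xy y1; have [dh ch nz _] := facts p pB.
  have [z /andP[z1 z2] E] := interval_mvt dh x1 xy y1; rewrite -/(branch_derive h p z) in E.
  have zI : lo p.2 <= z <= hi p.2 by rewrite (le_trans x1 z1) (le_trans z2 y1).
  have sgn : (branch_derive h p (lo p.2) < 0) = (branch_derive h p z < 0).
    have cs : {within `[lo p.2, z], continuous branch_derive h p}.
      apply: continuous_subspaceW ch => t; rewrite /= !in_itv /= => /andP[-> t2].
      by rewrite (le_trans t2 (le_trans z2 y1)).
    have loz : lo p.2 <= z := le_trans x1 z1.
    apply/idP/idP => s1; rewrite ltNge; apply/negP => s2.
      have [|c' c'I c'0] := IVT (v := 0) loz cs; first by rewrite ge_min (ltW s1)/= le_max s2 orbT.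
      have := nz c'; rewrite c'0 eqxx; rewrite in_itv /= in c'I => H; suff : false by []; apply: H.
      by case/andP: c'I => -> c2; rewrite (le_trans c2 (le_trans z2 y1)).
    have [|c' c'I c'0] := IVT (v := 0) loz cs; first by rewrite ge_min (ltW s1) orbT/= le_max s2.
    have := nz c'; rewrite c'0 eqxx; rewrite in_itv /= in c'I => H; suff : false by []; apply: H.
    by case/andP: c'I => -> c2; rewrite (le_trans c2 (le_trans z2 y1)).
  rewrite /reversing sgn -[h p y < _]subr_lt0 E; case: ltP => s1.
    by rewrite nmulr_rlt0// subr_gt0.
  by rewrite -subr_gt0 E mulr_gt0 ?subr_gt0// lt0r nz.
- move=> p x y pB x1 xy y1; have [dh ch nz _] := facts p pB.
  have [z /andP[z1 z2] E] := interval_mvt dh x1 xy y1; exists z; first by rewrite z1.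
  have zI : lo p.2 <= z <= hi p.2 by rewrite (le_trans x1 z1) (le_trans z2 y1).
  by rewrite expL// E normrM [`|y - x|]gtr0_norm// subr_gt0.
- move=> p x y pB xI yI; have [m0 mP] := Hm p; have [C0 CP] := HC p.
  apply: le_trans (ln_lipschitz m0 (mP pB x xI) (mP pB y yI)) _.
  rewrite ler_pdivrMr//; apply: le_trans (ler_dist_dist _ _) _; apply: le_trans (CP pB x y xI yI) _.
  by rewrite [leRHS]mulrAC ler_wpM2r ?powR_ge0// [leRHS]mulrC ler_pdivlMr// mulrC -ler_pdivlMr//.
move=> p x pB xI; rewrite expL//; have [_ mP] := Hmu p.
apply: le_trans (mP pB x xI) _; rewrite ler_pM2r ?len_gt0// le_max lerD2l lerN2 Hmu'//.
Qed.

End InverseBranches.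

(** * Rules of calculus for derivatives relative to a set *)

Section QuotientRules.
Variable R : realType.
Implicit Types (D : set R) (f : R -> R).

(** A form without division, for the chain rule: the inner function may take the value [f x] again
    near [x]. *)
Definition linear_approx D f x (l : R) := forall e : R, 0 < e -> exists2 d, 0 < d &
  forall y, D y -> `|y - x| < d -> `|f y - f x - l * (y - x)| <= e * `|y - x|.

Lemma linear_approxP D f x l : quotient_lim D f x l <-> linear_approx D f x l.
Proof.
have E y : y != x -> (quotient f x y - l) * (y - x) = f y - f x - l * (y - x).
  by move=> yx; rewrite mulrBl /quotient divfK// subr_eq0.
split=> H e e0; have [d d0 Hd] := H e e0; exists d => // y Dy.
  move=> yd; have [->|yx] := eqVneq y x; first by rewrite !subrr mulr0 subrr normr0 mulr0.
  by rewrite -E// normrM ler_wpM2r// Hd.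
move=> yx yd; have := Hd y Dy yd.
by rewrite -E// normrM ler_pM2r// normr_gt0 subr_eq0.
Qed.

Lemma quotient_lim_cst D c x : quotient_lim D (fun _ => c) x 0.
Proof.
by move=> e e0; exists 1 => // y _ _ _; rewrite /quotient subrr mul0r subrr normr0 ltW.
Qed.

Lemma quotient_lim_id D x : quotient_lim D id x 1.
Proof.
move=> e e0; exists 1 => // y _ yx _; rewrite /quotient divff ?subr_eq0//.
by rewrite subrr normr0 ltW.
Qed.

Lemma quotient_limD D f f' x l l' : quotient_lim D f x l -> quotient_lim D f' x l' ->
  quotient_lim D (fun y => f y + f' y) x (l + l').
Proof.
move=> H H' e e0; have e20 : 0 < e / 2 by rewrite divr_gt0.
have [d d0 Hd] := H _ e20; have [d' d'0 Hd'] := H' _ e20.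
exists (Num.min d d'); first by rewrite lt_min d0.
move=> y Dy yx; rewrite lt_min => /andP[y1 y2].
have := ler_normD (quotient f x y - l) (quotient f' x y - l').
have := Hd y Dy yx y1; have := Hd' y Dy yx y2.
have -> : quotient (fun y => f y + f' y) x y - (l + l') = quotient f x y - l + (quotient f' x y - l').
  by rewrite /quotient opprD addrACA mulrDl; ring.
lra.
Qed.

Lemma quotient_limN D f x l : quotient_lim D f x l -> quotient_lim D (fun y => - f y) x (- l).
Proof.
move=> H e e0; have [d d0 Hd] := H e e0; exists d => // y Dy yx yd.
have -> : quotient (fun y => - f y) x y - - l = - (quotient f x y - l).
  by rewrite /quotient; ring.
by rewrite normrN Hd.
Qed.

Lemma quotient_limB D f f' x l l' : quotient_lim D f x l -> quotient_lim D f' x l' ->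
  quotient_lim D (fun y => f y - f' y) x (l - l').
Proof. by move=> H H'; apply: quotient_limD => //; exact: quotient_limN. Qed.

Lemma quotient_lim_comp D D' f F x l l' : (forall y, D y -> D' (f y)) ->
  quotient_lim D f x l -> quotient_lim D' F (f x) l' ->
  quotient_lim D (F \o f) x (l' * l).
Proof.
move=> DD' H H'; have := H; rewrite linear_approxP => Hf.
have := H'; rewrite linear_approxP => HF; apply/linear_approxP => e e0.
have c0 : 0 < `|l| + `|l'| + 1 by rewrite ltr_wpDl// addr_ge0.
pose e1 := Num.min 1 (e / (`|l| + `|l'| + 1)).
have e10 : 0 < e1 by rewrite lt_min ltr01 divr_gt0.
have [d1 d10 H1] := Hf _ e10; have [d2 d20 H2] := HF _ e10.
have [d3 d30 H3] := quotient_lim_continuous H (divr_gt0 d20 (ltr0Sn _ 1)).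
exists (Num.min d1 d3); first by rewrite lt_min d10.
move=> y Dy; rewrite lt_min => /andP[yd1 yd3] /=.
have h1 := H1 y Dy yd1.
have h2 : `|F (f y) - F (f x) - l' * (f y - f x)| <= e1 * `|f y - f x|.
  by apply: H2; [exact: DD'|apply: le_lt_trans (H3 y Dy yd3) _; lra].
have h3 : `|f y - f x| <= (`|l| + 1) * `|y - x|.
  have := ler_normD (f y - f x - l * (y - x)) (l * (y - x)); rewrite subrK normrM.
  have : e1 * `|y - x| <= 1 * `|y - x| by rewrite ler_wpM2r// ge_min lexx.
  lra.
rewrite (_ : F (f y) - F (f x) - l' * l * (y - x) = (F (f y) - F (f x) - l' * (f y - f x)) +
  l' * (f y - f x - l * (y - x))); last by ring.
apply: le_trans (ler_normD _ _) _; rewrite normrM.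
have h4 := ler_wpM2l (normr_ge0 l') h1; have h5 := ler_wpM2l (ltW e10) h3.
have : e1 * (`|l| + `|l'| + 1) * `|y - x| <= e * `|y - x|.
  by rewrite ler_wpM2r// -ler_pdivlMr// ge_min lexx orbT.
lra.
Qed.

(** By polarization: the product is a quarter of the difference of two squares, and squares follow
    from the chain rule. *)
Lemma quotient_limM D f f' x l l' : quotient_lim D f x l -> quotient_lim D f' x l' ->
  quotient_lim D (fun y => f y * f' y) x (l * f' x + f x * l').
Proof.
have sq D1 F y k : quotient_lim D1 F y k -> quotient_lim D1 (fun z => F z * F z) y (2 * F y * k).
  move=> H; apply: (@quotient_lim_comp D1 setT F (fun z => z * z) y k (2 * F y)) => //.
  move=> e e0; exists e => // z _ zx ze; rewrite /quotient.
  rewrite (_ : _ - _ = z - F y); first exact: ltW.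
  by field; rewrite subr_eq0.
move=> H H'; have S := sq _ _ _ _ (quotient_limD H H'); have T := sq _ _ _ _ (quotient_limB H H').
have Q := quotient_lim_comp (F := fun z => z * 4^-1) (D' := setT) _ (quotient_limB S T).
have {}Q := Q (4^-1) (fun _ _ => I).
have E : quotient_lim D ((fun z => z * 4^-1) \o (fun y => (f y + f' y) * (f y + f' y) - (f y - f' y) * (f y - f' y))) x
   (4^-1 * (2 * (f x + f' x) * (l + l') - 2 * (f x - f' x) * (l - l'))).
  apply: Q => e e0; exists 1 => // y _ yx _; rewrite /quotient -mulrBl mulrAC divff ?subr_eq0// mul1r.
  by rewrite subrr normr0 ltW.
have -> : (fun y => f y * f' y) = (fun z => z * 4^-1) \o (fun y => (f y + f' y) * (f y + f' y) - (f y - f' y) * (f y - f' y)).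
  by apply/funext => y /=; field.
by rewrite (_ : l * f' x + f x * l' = 4^-1 * (2 * (f x + f' x) * (l + l') - 2 * (f x - f' x) * (l - l'))) //; field.
Qed.

Lemma quotient_lim_expR D f x l : quotient_lim D f x l ->
  quotient_lim D (fun y => expR (f y)) x (expR (f x) * l).
Proof.
move=> H; apply: (quotient_lim_comp (D' := setT) (F := expR)) => //.
by apply/is_deriveP; exact: is_derive_expR.
Qed.

(** Writing the function as half of [ln (f ^ 2)] avoids a discussion of the sign of [f]. *)
Lemma quotient_lim_ln D f x l : quotient_lim D f x l -> f x != 0 ->
  quotient_lim D (fun y => ln `|f y|) x (l / f x).
Proof.
move=> H f0; have sq := quotient_limM H H.
have p0 : 0 < f x * f x by rewrite -expr2 exprn_even_gt0.
have lnx : quotient_lim setT (@ln R) (f x * f x) (f x * f x)^-1.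
  by apply/is_deriveP; exact: is_derive1_ln.
have Q := quotient_lim_comp (D' := setT) (fun _ _ => I) sq lnx.
have Q2 := quotient_lim_comp (F := fun z => z * 2^-1) (D' := setT) (fun _ _ => I) Q.
have {}Q2 := Q2 (2^-1).
have E y : ln `|f y| = ((fun z => z * 2^-1) \o (@ln R \o (fun z => f z * f z))) y.
  rewrite /=; have [->|y0] := eqVneq (f y) 0; first by rewrite normr0 mulr0 ln0 ?mul0r.
  rewrite -expr2 -[in RHS]real_normK ?num_real// lnXn ?normr_gt0//.
  by rewrite mulr2n; field.
have -> : (fun y => ln `|f y|) = (fun z => z * 2^-1) \o (@ln R \o (fun z => f z * f z)) by apply/funext.
rewrite (_ : l / f x = 2^-1 * ((f x * f x)^-1 * (l * f x + f x * l))); last by field.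
apply: Q2 => e e0; exists 1 => // y _ yx _; rewrite /quotient -mulrBl mulrAC divff ?subr_eq0// mul1r.
by rewrite subrr normr0 ltW.
Qed.

Lemma quotient_limV D f x l : quotient_lim D f x l -> f x != 0 ->
  quotient_lim D (fun y => (f y)^-1) x (- (f x ^+ 2)^-1 * l).
Proof.
move=> H f0; apply: (quotient_lim_comp (D' := setT) (F := fun z => z^-1)) H _ => //.
move: (f x) f0 => z z0 e e0; have a0 : 0 < `|z| by rewrite normr_gt0.
exists (Num.min (`|z| / 2) (e * `|z| ^+ 3 / 2)).
  by rewrite lt_min !divr_gt0// mulr_gt0// exprn_gt0.
move=> y _ yz; rewrite lt_min => /andP[y1 y2].
have ya : `|z| / 2 <= `|y|.
  have := ler_normD (z - y) y; rewrite subrK distrC; lra.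
have y0 : y != 0 by rewrite -normr_gt0; apply: lt_le_trans ya; rewrite divr_gt0.
rewrite /quotient (_ : _ - _ = (y - z) / (z ^+ 2 * y)); last first.
  by field; rewrite z0 y0 subr_eq0.
rewrite normrM normfV normrM normrX ler_pdivrMr; last by rewrite mulr_gt0 ?exprn_gt0// normr_gt0.
apply: (le_trans (ltW y2)); rewrite -mulrA ler_pM2l//.
have := ler_wpM2l (exprn_ge0 2 (ltW a0)) ya; rewrite !exprS expr0; lra.
Qed.

Lemma quotient_lim_eq D f f' x l (r : R) : 0 < r -> D x ->
  (forall y, D y -> `|y - x| < r -> f y = f' y) -> quotient_lim D f x l -> quotient_lim D f' x l.
Proof.
move=> r0 Dx E H e e0; have [d d0 Hd] := H e e0; exists (Num.min d r); first by rewrite lt_min d0.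
move=> y Dy yx; rewrite lt_min => /andP[yd yr].
by rewrite /quotient -(E y)// -(E x)// ?subrr ?normr0//; exact: Hd.
Qed.

Lemma quotient_lim_Lipschitz (f f' : R -> R) x y (C : R) : (forall x, quotient_lim setT f x (f' x)) ->
  (forall x, `|f' x| <= C) -> `|f y - f x| <= C * `|y - x|.
Proof.
move=> H fC; wlog xy : x y / x < y => [W|].
  have [xy|yx|->] := ltgtP x y; first exact: W.
    by rewrite distrC [`|y - x|]distrC; exact: W.
  by rewrite !subrr normr0 mulr0.
have [||c _ ->] := @MVT R f f' x y xy.
- by move=> z _; apply/is_deriveP.
- apply/within_continuousP => z _ e e0.
  have [d d0 Hd] := quotient_lim_continuous (H z) e0; exists d => // t _; exact: Hd.
by rewrite normrM ler_wpM2r.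
Qed.

Lemma primitive_exists (f : R -> R) c : continuous f -> (forall x, x <= c -> f x = 0) ->
  exists2 F : R -> R, forall x, quotient_lim setT F x (f x) & forall x, x <= c -> F x = 0.
Proof.
move=> cf f0; pose F x := (\int[@lebesgue_measure R]_(t in `[c - 1, x]) f t)%R.
have F0 x : x <= c -> F x = 0.
  move=> xc; rewrite /F (@eq_Rintegral _ _ _ _ _ (cst 0)); last first.
    by move=> t; rewrite inE /= in_itv /= => /andP[_ tx]; rewrite f0// (le_trans tx).
  by rewrite /Rintegral integral0.
exists F => // x; have [xc|cx] := ltP x c.
  rewrite f0 ?ltW//; have c0 : 0 < c - x by rewrite subr_gt0.
  apply: (@quotient_lim_eq setT (fun _ => 0) F x 0 (c - x)) => //; last exact: quotient_lim_cst.
  by move=> y _; rewrite ltr_norml => /andP[_ h]; rewrite F0//; lra.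
have x1 : x < x + 1 by lra.
have [] := @continuous_FTC1_closed R f (c - 1) x (x + 1) x1.
- apply: continuous_compact_integrable; first exact: segment_compact.
  exact: continuous_subspaceT.
- lra.
- exact: cf.
rewrite derive1E => dF vF; apply/is_deriveP.
by rewrite -vF; exact: derivableP.
Qed.

(** The limit is the supremum of the lower bounds [s n - c * lam ^ n]; the explicit rate is what
    gives continuity of limits later. *)
Lemma geometric_limit (s : nat -> R) (c lam : R) : 0 < lam < 1 -> 0 <= c ->
  (forall n, `|s n.+1 - s n| <= c * lam ^+ n * (1 - lam)) ->
  exists l, forall n, `|s n - l| <= c * lam ^+ n.
Proof.
move=> /andP[lam0 lam1] c0 H.
have step n k : `|s (n + k)%N - s n| <= c * lam ^+ n - c * lam ^+ (n + k).
  elim: k => [|k IH]; first by rewrite addn0 !subrr normr0.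
  have := ler_normD (s (n + k.+1)%N - s (n + k)%N) (s (n + k)%N - s n).
  rewrite addrA subrK => h; have := H (n + k)%N; rewrite -addnS => h2.
  have E : c * lam ^+ (n + k.+1) = c * lam ^+ (n + k) * lam by rewrite addnS exprSr mulrA.
  rewrite E; lra.
have bnd m n : s n - c * lam ^+ n <= s m + c * lam ^+ m.
  have p k : 0 <= c * lam ^+ k by rewrite mulr_ge0// exprn_ge0// ltW.
  have [mn|nm] := leqP m n.
    have := step m (n - m)%N; rewrite subnKC// ler_norml => /andP[_ h].
    have := p n; lra.
  have := step n (m - n)%N; rewrite subnKC ?(ltnW nm)// ler_norml => /andP[h _].
  have := p m; lra.
pose A := [set s n - c * lam ^+ n | n in setT].
have hA : has_sup A.
  split; first by exists (s 0%N - c * lam ^+ 0); exists 0%N.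
  by exists (s 0%N + c * lam ^+ 0) => _ [n _ <-]; exact: bnd.
exists (sup A) => n; rewrite ler_norml; apply/andP; split.
  suff : sup A <= s n + c * lam ^+ n by lra.
  by apply: ge_sup; [case: hA|move=> _ [k _ <-]; exact: bnd].
have : s n - c * lam ^+ n <= sup A by apply: ub_le_sup; [case: hA|exists n].
lra.
Qed.

Lemma intervals_gap (I : finType) (A : {pred I}) (l h : I -> R) :
  (forall i, i \in A -> l i <= h i) ->
  (forall i j x, i \in A -> j \in A -> l i <= x <= h i -> l j <= x <= h j -> i = j) ->
  exists2 d : R, 0 < d & forall i j x y, i \in A -> j \in A -> i != j ->
  l i <= x <= h i -> l j <= y <= h j -> d <= `|x - y|.
Proof.
move=> lh disj.
pose P (p : I * I) : R := if [&& p.1 \in A, p.2 \in A & p.1 != p.2] then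
  Num.max (l p.1 - h p.2) (l p.2 - h p.1) else 1.
have P0 p : 0 < P p.
  case: p => i j; rewrite /P /=; case: ifP => // /and3P[iA jA ij].
  rewrite lt_max !subr_gt0 ltNge [h i < _]ltNge -negb_and; apply/negP => /andP[h1 h2].
  have [h3|h3] := leP (l i) (l j).
    by have := disj i j (l j) iA jA; rewrite h3 h2 lexx lh// => /(_ isT isT) E; rewrite E eqxx in ij.
  by have := disj i j (l i) iA jA; rewrite lexx lh// (ltW h3) h1 => /(_ isT isT) E; rewrite E eqxx in ij.
have [d d0 Hd] := finite_lower_bound P0.
exists d => // i j x y iA jA ij /andP[x1 x2] /andP[y1 y2].
have := Hd (i, j); rewrite /P /= iA jA ij /= le_max => /orP[h1|h1].
  by rewrite ger0_norm; lra.
by rewrite ler0_norm; lra.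
Qed.

Definition clamp (l h x : R) : R := Num.max l (Num.min x h).

Lemma clamp_in l h x : l <= h -> l <= clamp l h x <= h.
Proof. by move=> lh; rewrite /clamp le_max lexx ge_max lh ge_min lexx orbT. Qed.

Lemma clamp_id l h x : l <= x <= h -> clamp l h x = x.
Proof. by case/andP=> lx xh; rewrite /clamp min_l// max_r. Qed.

Lemma clamp_lipschitz l h x y : l <= h -> `|clamp l h x - clamp l h y| <= `|x - y|.
Proof.
move=> lh; wlog xy : x y / x <= y => [W|].
  by have [/W//|/ltW/W] := leP x y; rewrite distrC [`|x - y|]distrC.
rewrite [leRHS]distrC [`|y - x|]ger0_norm ?subr_ge0// distrC.
rewrite /clamp; case: (leP y h) => yh; case: (leP x h) => xh; rewrite ?(max_r lh);
  rewrite ler_norml; try (case: (leP l x) => ?); try (case: (leP l y) => ?);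
  by apply/andP; split; lra.
Qed.

End QuotientRules.

(** * Oscillation of ratios *)

Section Toggling.
Variables (R : realType) (r : \bar R) (g : expanding_map r).
Local Notation T := (alphabet g).
Local Notation lo := (lo (e := g)).
Local Notation hi := (hi (e := g)).
Local Notation edge := (@letter_edge R r g).
Local Notation K := (cantor_set g).
Variables (h L : T * T -> R -> R) (o : T * T -> bool) (lam H0 al : R).
Hypothesis br : branches h L o lam H0 al.
Local Notation hw := (word_map h).
Local Notation lw := (word_log_derive h L).
Local Notation ow := (word_reversing o).
Local Notation H1 := (distortion_const g lam H0 al).
Local Notation loops := (@loops R r g h o).
Local Notation sw := (word_size h).

(** The left side is the bound of [lw_hol]: after [m] letters, what follows in a word changes the
    log-derivative of what precedes by at most [eta]. *)
Definition depth_small (m : nat) (eta : R) := forall b w s t, path edge b w -> (m <= size w)%N ->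
  lo (last b w) <= s <= hi (last b w) -> lo (last b w) <= t <= hi (last b w) ->
  H1 * `|hw b w s - hw b w t| `^ al <= eta.

Lemma depth_small_exists eta : 0 < eta -> exists m0, forall m, (m0 <= m)%N -> depth_small m eta.
Proof.
move=> eta0; have [d d0 Hd] := small_distortion br eta0.
have l0 (b : T) : 0 < d / (len_ratio g * len b).
  by rewrite divr_gt0// mulr_gt0 ?len_gt0// len_ratio_gt0.
have [c c0 Hc] := finite_lower_bound l0; have [m0 Hm0] := small_expr (br_lam br) c0.
have /andP[lam0 lam1] := br_lam br.
exists m0 => m mm b w s t pw mw sI tI.
have close : `|hw b w s - hw b w t| <= d.
  apply: le_trans (hw_dist br pw tI sI) _.
  have lr0 := len_ratio_gt0 g; have lb := len_gt0 (last b w).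
  apply: (@le_trans _ _ (len_ratio g * c * len (last b w))).
    apply: ler_pM => //; first by rewrite mulr_ge0 ?exprn_ge0 ?ltW.
      rewrite ler_pM2l//; apply: le_trans (ltW Hm0); apply: ler_wiXn2l; rewrite ?ltW//.
      exact: leq_trans mm mw.
    by move: sI tI; rewrite /len => /andP[? ?] /andP[? ?]; rewrite ler_norml; apply/andP; split; lra.
  have := Hc (last b w); rewrite ler_pdivlMr ?mulr_gt0//; lra.
have H10 := distortion_const_gt0 br; have ad0 : 0 <= d by exact: ltW.
apply: (@le_trans _ _ (2 * H1 * d `^ al)).
  apply: (@le_trans _ _ (H1 * d `^ al)).
    by rewrite ler_pM2l//; apply: ge0_ler_powR; rewrite ?nnegrE ?(ltW (br_al br)).
  have : 0 <= H1 * d `^ al by rewrite mulr_ge0 ?powR_ge0 ?ltW.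
  lra.
have e1 := expR_ge1Dx (2 * H1 * d `^ al); lra.
Qed.

Lemma lw_close m eta b w c v s t : depth_small m eta -> path edge b w -> (m <= size w)%N ->
  lo (last b w) <= s <= hi (last b w) -> lo (last b w) <= t <= hi (last b w) ->
  path edge c v -> last c v = b -> `|lw c v (hw b w s) - lw c v (hw b w t)| <= eta.
Proof.
move=> ds pw mw sI tI pv lv; apply: le_trans (ds b w s t pw mw sI tI).
by apply: (lw_hol br pv); rewrite lv; exact: (hw_in br).
Qed.

(** In [U0 X U1], with [Ui = Z wi Vi], the past [V1] is evaluated at [y] and [V0] near [x], because
    [X] begins with a word leading to [x]; in [U1 X U0] the roles are exchanged. All other factors
    agree up to [eta], since a deep word follows them. Eight comparisons are made. *)
Lemma swap_log_derivative m eta e a b0 b1 u Z w0 w1 V0 V1 wx cx x x' y :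
  depth_small m eta ->
  path edge e u -> last e u = e ->
  path edge e Z -> last e Z = e -> (m <= size Z)%N ->
  path edge e w0 -> last e w0 = b0 -> path edge e w1 -> last e w1 = b1 ->
  path edge b0 V0 -> last b0 V0 = a -> (m <= size V0)%N ->
  path edge b1 V1 -> last b1 V1 = a -> (m <= size V1)%N ->
  path edge a wx -> (m <= size wx)%N -> path edge (last a wx) cx -> last a (wx ++ cx) = e ->
  lo (last a wx) <= x' <= hi (last a wx) -> x = hw a wx x' -> lo a <= y <= hi a ->
  `|lw e (u ++ (Z ++ (w0 ++ V0)) ++ (wx ++ cx) ++ (Z ++ (w1 ++ V1))) y
    - lw e (u ++ (Z ++ (w1 ++ V1)) ++ (wx ++ cx) ++ (Z ++ (w0 ++ V0))) y
    - ((lw b1 V1 y - lw b1 V1 x) - (lw b0 V0 y - lw b0 V0 x))| <= 8%:R * eta.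
Proof.
move=> ds pu lu pZ lZ mZ pw0 lw0 pw1 lw1 pV0 lV0 mV0 pV1 lV1 mV1 px mx pc lX x'I -> yI.
set X := wx ++ cx.
have pX : path edge a X by rewrite cat_path px pc.
pose W0 := w0 ++ V0; pose W1 := w1 ++ V1.
have pW0 : path edge e W0 by rewrite cat_path pw0 lw0 pV0.
have pW1 : path edge e W1 by rewrite cat_path pw1 lw1 pV1.
have lW0 : last e W0 = a by rewrite last_cat lw0.
have lW1 : last e W1 = a by rewrite last_cat lw1.
have mW0 : (m <= size W0)%N by rewrite size_cat (leq_trans mV0)// leq_addl.
have mW1 : (m <= size W1)%N by rewrite size_cat (leq_trans mV1)// leq_addl.
pose a1 := hw e W1 y; pose a0 := hw e W0 y.
have a1I : lo e <= a1 <= hi e by apply: (hw_in br) => //; rewrite lW1.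
have a0I : lo e <= a0 <= hi e by apply: (hw_in br) => //; rewrite lW0.
pose z1 := hw e Z a1; pose z0 := hw e Z a0.
have z1I : lo e <= z1 <= hi e by apply: (hw_in br) => //; rewrite lZ.
have z0I : lo e <= z0 <= hi e by apply: (hw_in br) => //; rewrite lZ.
pose x1 := hw a X z1; pose x0 := hw a X z0.
have x1I : lo a <= x1 <= hi a by apply: (hw_in br) => //; rewrite lX.
have x0I : lo a <= x0 <= hi a by apply: (hw_in br) => //; rewrite lX.
pose B0 := hw e W0 x1; pose B1 := hw e W1 x0.
have B0I : lo e <= B0 <= hi e by apply: (hw_in br) => //; rewrite lW0.
have B1I : lo e <= B1 <= hi e by apply: (hw_in br) => //; rewrite lW1.
have split3 W X' W' : last e W = a -> last a X' = e ->
    lw e (u ++ (Z ++ W) ++ X' ++ (Z ++ W')) y =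
    let t := hw e Z (hw e W' y) in let t' := hw a X' t in
    lw e u (hw e Z (hw e W t')) + lw e Z (hw e W t') + lw e W t' + (lw a X' t + lw e Z (hw e W' y)) + lw e W' y.
  by move=> lW lX' /=; rewrite !lw_cat !hw_cat !last_cat ?lu ?lZ ?lW ?lX' ?lZ; ring.
have split4 W W' (lW : last e W = a) := split3 W X W' lW lX; rewrite /= in split4.
have lwW0 t : lw e W0 t = lw e w0 (hw b0 V0 t) + lw b0 V0 t by rewrite /W0 lw_cat lw0.
have lwW1 t : lw e W1 t = lw e w1 (hw b1 V1 t) + lw b1 V1 t by rewrite /W1 lw_cat lw1.
have E1 : lw e (u ++ (Z ++ W0) ++ X ++ (Z ++ W1)) y = lw e u (hw e Z B0) + lw e Z B0 +
   (lw e w0 (hw b0 V0 x1) + lw b0 V0 x1) + (lw a X z1 + lw e Z a1) +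
   (lw e w1 (hw b1 V1 y) + lw b1 V1 y).
  by rewrite (split4 _ _ lW0) -/a1 -/z1 -/x1 -/B0 lwW0 lwW1.
have E0 : lw e (u ++ (Z ++ W1) ++ X ++ (Z ++ W0)) y = lw e u (hw e Z B1) + lw e Z B1 +
   (lw e w1 (hw b1 V1 x0) + lw b1 V1 x0) + (lw a X z0 + lw e Z a0) +
   (lw e w0 (hw b0 V0 y) + lw b0 V0 y).
  by rewrite (split4 _ _ lW1) -/a0 -/z0 -/x0 -/B1 lwW0 lwW1.
rewrite E1 E0.
have xE t : hw a X t = hw a wx (hw (last a wx) cx t) by rewrite hw_cat.
have cxI t : lo e <= t <= hi e -> lo (last a wx) <= hw (last a wx) cx t <= hi (last a wx).
  by move=> tI; apply: (hw_in br) => //; rewrite -last_cat lX.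
have k1 : `|lw e u (hw e Z B0) - lw e u (hw e Z B1)| <= eta by apply: (lw_close ds); rewrite ?lZ.
have k2 : `|lw a X z1 - lw a X z0| <= eta by apply: (lw_close ds); rewrite ?lZ.
have k3 : `|lw e Z B0 - lw e Z a0| <= eta by apply: (lw_close ds); rewrite ?lW0.
have k4 : `|lw e Z B1 - lw e Z a1| <= eta by apply: (lw_close ds); rewrite ?lW1.
have k5 : `|lw e w0 (hw b0 V0 x1) - lw e w0 (hw b0 V0 y)| <= eta by apply: (lw_close ds); rewrite ?lV0.
have k6 : `|lw e w1 (hw b1 V1 x0) - lw e w1 (hw b1 V1 y)| <= eta by apply: (lw_close ds); rewrite ?lV1.
have k7 : `|lw b0 V0 x1 - lw b0 V0 (hw a wx x')| <= eta.
  by rewrite /x1 xE; apply: (lw_close ds) => //; exact: cxI.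
have k8 : `|lw b1 V1 x0 - lw b1 V1 (hw a wx x')| <= eta.
  by rewrite /x0 xE; apply: (lw_close ds) => //; exact: cxI.
move: k1 k2 k3 k4 k5 k6 k7 k8; clear; rewrite !ler_norml.
move: (lw e u (hw e Z B0)) (lw e u (hw e Z B1)) (lw a X z1) (lw a X z0)
  (lw e Z B0) (lw e Z a0) (lw e Z B1) (lw e Z a1) (lw e w0 (hw b0 V0 x1)) (lw e w0 (hw b0 V0 y))
  (lw e w1 (hw b1 V1 x0)) (lw e w1 (hw b1 V1 y)) (lw b0 V0 x1) (lw b0 V0 (hw a wx x'))
  (lw b1 V1 x0) (lw b1 V1 (hw a wx x')) (lw b0 V0 y) (lw b1 V1 y).
move=> q1 q2 q3 q4 q5 q6 q7 q8 q9 q10 q11 q12 q13 q14 q15 q16 q17 q18.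
do 8 move=> /andP[? ?]; apply/andP; split; lra.
Qed.

(** Passing from log-derivatives at [y] to sizes costs one [eta] of distortion for each word:
    [11 = 9 + 1 + 1]. The word [Y] places what follows near [y]. *)
Lemma swap_sizes m eta E e a u Y v A B y y' : depth_small m eta ->
  path edge e (u ++ A) -> last e (u ++ A) = a -> path edge e (u ++ B) -> last e (u ++ B) = a ->
  path edge a Y -> (m <= size Y)%N -> path edge (last a Y) v ->
  lo (last a Y) <= y' <= hi (last a Y) -> y = hw a Y y' ->
  `|lw e (u ++ A) y - lw e (u ++ B) y - E| <= 9%:R * eta -> 0 < eta ->
  expR (E - 11%:R * eta) * sw e (u ++ B ++ Y ++ v) <= sw e (u ++ A ++ Y ++ v) <=
  expR (E + 11%:R * eta) * sw e (u ++ B ++ Y ++ v).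
Proof.
move=> ds pA lA pB lB pY mY pv y'I yE HE eta0.
pose s t := hw a Y (hw (last a Y) v t).
have tI t : lo (last (last a Y) v) <= t <= hi (last (last a Y) v) ->
    lo (last a Y) <= hw (last a Y) v t <= hi (last a Y) by exact: (hw_in br).
have yI : lo a <= y <= hi a by rewrite yE; exact: (hw_in br).
have lE (C : seq T) : last e (u ++ C) = a -> last e (u ++ C ++ Y ++ v) = last (last a Y) v.
  by move=> lC; rewrite (catA u C) last_cat lC last_cat.
set c := last (last a Y) v in tI lE *.
have hE (C : seq T) t : last e (u ++ C) = a -> hw e (u ++ C ++ Y ++ v) t = hw e (u ++ C) (s t).
  by move=> lC; rewrite (catA u C) hw_cat lC [hw a _ _]hw_cat.
have loI : lo c <= lo c <= hi c := lo_in c; have hiI : lo c <= hi c <= hi c := hi_in c.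
pose del := Num.max `|s (lo c) - y| `|s (hi c) - y|.
have Hdel : H1 * del `^ al <= eta.
  have dle t : lo c <= t <= hi c -> H1 * `|s t - y| `^ al <= eta.
    by move=> tt; rewrite yE; apply: ds => //; exact: tI.
  by rewrite /del /Num.max; case: ifP => _; exact: dle.
have sI t : lo c <= t <= hi c -> lo a <= s t <= hi a.
  by move=> tt; apply: (hw_in br) => //; exact: tI.
have dI t : `|s t - y| <= del -> y - del <= s t <= y + del.
  by rewrite ler_norml => /andP[? ?]; apply/andP; split; lra.
have dlo : y - del <= s (lo c) <= y + del by apply: dI; rewrite le_max lexx.
have dhi : y - del <= s (hi c) <= y + del by apply: dI; rewrite le_max lexx orbT.
have dist (C : seq T) : path edge e (u ++ C) -> last e (u ++ C) = a ->
  expR (lw e (u ++ C) y - H1 * del `^ al) * `|s (hi c) - s (lo c)| <= sw e (u ++ C ++ Y ++ v)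
    <= expR (lw e (u ++ C) y + H1 * del `^ al) * `|s (hi c) - s (lo c)|.
  move=> pC lC; rewrite /word_size lE// !hE//.
  by apply: (hw_distortion br pC); rewrite ?lC//; [exact: sI|exact: sI].
have /andP[A1 A2] := dist A pA lA; have /andP[B1 B2] := dist B pB lB.
move: A1 A2 B1 B2 HE Hdel; set D := `|s _ - _|; set sA := sw _ _; set sB := sw _ _.
move: (H1 * del `^ al) (lw e (u ++ A) y) (lw e (u ++ B) y) => k lA' lB' A1 A2 B1 B2.
rewrite ler_norml => /andP[E1 E2] kd.
have D0 : 0 <= D by exact: normr_ge0.
apply/andP; split.
  apply: le_trans A1; apply: (@le_trans _ _ (expR (E - 11%:R * eta) * (expR (lB' + k) * D))).
    by rewrite ler_pM2l ?expR_gt0.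
  by rewrite mulrA -expRD ler_wpM2r// ler_expR; lra.
apply: le_trans A2 _; apply: (@le_trans _ _ (expR (E + 11%:R * eta) * (expR (lB' - k) * D))).
  by rewrite mulrA -expRD ler_wpM2r// ler_expR; lra.
by rewrite ler_pM2l ?expR_gt0.
Qed.

Variable P : T -> T.
Hypothesis edgeP : forall a, edge (P a) a.

Fixpoint back (k : nat) (a : T) : seq T := if k is k'.+1 then iter k' P a :: back k' a else [::].

Lemma backP k a : [/\ path edge (iter k P a) (back k a), last (iter k P a) (back k a) = a &
  size (back k a) = k].
Proof.
elim: k => [|k [p l s]] //=; rewrite edgeP p l s; split=> //.
Qed.

(* [back k a] is the backward orbit of [a] under the selection [P] of
   predecessors. Up to small errors, [twist] is the change of the log-ratio of
   sizes when the pasts [back k a] and [rcons (back k b) a] are interchanged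
   inside a word. *)
Definition twist k b a x y : R :=
  (lw (iter k P a) (back k a) y - lw (iter k P a) (back k a) x)
  - (lw (iter k P b) (rcons (back k b) a) y - lw (iter k P b) (rcons (back k b) a) x).

Definition twisted := exists b a x, [/\ edge b a, K x, lo a <= x <= hi a &
  forall dl, 0 < dl -> exists y (E : R), [/\ K y, lo a <= y <= hi a, 0 < `|E| < dl &
    forall e, 0 < e -> exists k0, forall k, (k0 <= k)%N -> `|twist k b a x y - E| <= e]].

Lemma letter_word m a x : K x -> lo a <= x <= hi a -> exists w x',
  [/\ path edge a w, size w = m, lo (last a w) <= x' <= hi (last a w) & x = hw a w x'].
Proof.
move=> Kx xI; have [a' [w [pw sw yI Ky E]]] := cantor_word br m Kx.
have aa : a' = a by apply: (letter_uniq _ xI); rewrite E; exact: (hw_in br).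
by subst a'; exists w, (iter m (emap g) x).
Qed.

Lemma deep_loop e m : exists Z, [/\ path edge e Z, last e Z = e & (m <= size Z)%N].
Proof.
have [w [pw le w0]] := connect_letters e e.
elim: m => [|m [Z [pZ lZ mZ]]]; first by exists [::].
by exists (w ++ Z); rewrite cat_path pw le last_cat le size_cat -add1n leq_add.
Qed.

(** The two words are [U0 X U1 Y] and [U1 X U0 Y], whose size ratio is close to [exp E] in every
    context. *)
Lemma toggling_words e (del : R) : twisted -> 0 < del -> exists A B (kap : R), [/\ 0 < kap,
  path edge e A /\ last e A = e, path edge e B /\ last e B = e, ow e A = ow e B &
  (forall u, path edge e u -> last e u = e -> sw e (u ++ B) <= sw e u / 2) /\
  (forall u v, path edge e u -> last e u = e -> path edge e v -> last e v = e ->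
    (1 + kap) * sw e (u ++ B ++ v) <= sw e (u ++ A ++ v) <= (1 + del) * sw e (u ++ B ++ v))].
Proof.
have ar1 (t : R) : t / 2 <= t - t / 2 by lra.
have ar2 (t : R) : 0 <= t -> t + t / 2 <= 2 * t by lra.
have ar3 (t : R) : - t / 2 <= - (t + - t / 2) by lra.
have ar4 (t : R) : t <= 0 -> - (t - - t / 2) <= 2 * - t by lra.
move=> [b [a [x [eba Kx xI Hx]]]] del0.
have l0 : 0 < ln (1 + del) by rewrite ln_gt0//; lra.
have [y [E [Ky yI /andP[E0 El] HE]]] := Hx _ (divr_gt0 l0 (ltr0Sn _ 1)).
(* With this choice [11 * eta = |E| / 2], so the log-ratio keeps the sign of [E] and stays between
   [|E| / 2] and [2 * |E|] in absolute value. *)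
pose eta := `|E| / 22%:R.
have eta0 : 0 < eta by rewrite divr_gt0.
have [m0 Hm0] := depth_small_exists eta0; have [k0 Hk0] := HE _ eta0.
have [C C0 HC] := sw_cat br.
have C20 : 0 < (2 * C)^-1 by rewrite invr_gt0 mulr_gt0.
have [m1 Hm1] := small_expr (br_lam br) C20.
pose m := maxn m0 (maxn m1 k0).
have ds : depth_small m eta by apply: Hm0; rewrite leq_maxl.
have Hm : `|twist m b a x y - E| <= eta by apply: Hk0; rewrite !leq_max leqnn !orbT.
have m1m : (m1 <= m)%N by rewrite !leq_max leqnn orbT.
have [wx [x' [px sx x'I xE]]] := letter_word m Kx xI.
have [wy [y' [py sy y'I yE]]] := letter_word m Ky yI.
have [cx [pcx lcx _]] := connect_letters (last a wx) e.
have [cy [pcy lcy _]] := connect_letters (last a wy) e.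
have [Z [pZ lZ mZ]] := deep_loop e m.
have [w1 [pw1 lw1 _]] := connect_letters e (iter m P a).
have [w0 [pw0 lw0 _]] := connect_letters e (iter m P b).
have [pV1 lV1 sV1] := backP m a; have [pVb lVb sVb] := backP m b.
set V1 := back m a in pV1 lV1 sV1; pose V0 := rcons (back m b) a.
have pV0 : path edge (iter m P b) V0 by rewrite rcons_path pVb lVb.
have lV0 : last (iter m P b) V0 = a by rewrite last_rcons.
have mV0 : (m <= size V0)%N by rewrite size_rcons sVb.
have lX : last a (wx ++ cx) = e by rewrite last_cat.
pose U0 := Z ++ (w0 ++ V0); pose U1 := Z ++ (w1 ++ V1); pose X := wx ++ cx; pose Y := wy ++ cy.
have pU0 : path edge e U0 by rewrite /U0 cat_path pZ lZ cat_path pw0 lw0.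
have pU1 : path edge e U1 by rewrite /U1 cat_path pZ lZ cat_path pw1 lw1.
have lU0 : last e U0 = a by rewrite /U0 last_cat lZ last_cat lw0.
have lU1 : last e U1 = a by rewrite /U1 last_cat lZ last_cat lw1.
have pX : path edge a X by rewrite /X cat_path px.
have pY : path edge a Y by rewrite /Y cat_path py.
have lY : last a Y = e by rewrite /Y last_cat.
pose A := U0 ++ X ++ U1; pose B := U1 ++ X ++ U0.
have pA : path edge e A by rewrite /A cat_path pU0 lU0 cat_path pX lX.
have pB : path edge e B by rewrite /B cat_path pU1 lU1 cat_path pX lX.
have lA : last e A = a by rewrite /A last_cat lU0 last_cat lX.
have lB : last e B = a by rewrite /B last_cat lU1 last_cat lX.
have pAY : path edge e (A ++ Y) by rewrite cat_path pA lA.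
have pBY : path edge e (B ++ Y) by rewrite cat_path pB lB.
have lAY : last e (A ++ Y) = e by rewrite last_cat lA.
have lBY : last e (B ++ Y) = e by rewrite last_cat lB.
(* The words consist of the same pieces in different orders, so they have the same orientation. *)
have oAB : ow e (A ++ Y) = ow e (B ++ Y).
  have oswap (p q s t : seq T) : last e p = a -> last e q = a -> last a s = e ->
      ow e ((p ++ s ++ q) ++ t) = ow e ((q ++ s ++ p) ++ t).
    move=> lp lq ls; rewrite !ow_cat !last_cat lp lq ls lp lq.
    by case: (ow e p); case: (ow e q); case: (ow a s).
  exact: oswap.
have half C' : path edge e C' -> last e C' = e -> (m <= size C')%N ->
    forall u, path edge e u -> last e u = e -> sw e (u ++ C') <= sw e u / 2.
  move=> pC lC mC u pu lu; have le0 := len_gt0 e.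
  have pu' : path edge e (u ++ C') by rewrite cat_path pu lu.
  have [h1 _] := HC e u C' pu'.
  rewrite lu in h1; rewrite -(ler_pM2r le0); apply: le_trans h1 _.
  have su := ltW (sw_gt0 br pu).
  have h2 : sw e C' <= (2 * C)^-1 * len e.
    apply: le_trans (sw_contr br pC) _; rewrite ler_pM2r//; apply: le_trans (ltW Hm1).
    have /andP[lam0 lam1] := br_lam br.
    by apply: ler_wiXn2l; rewrite ?(ltW lam0) ?(ltW lam1)// (leq_trans m1m).
  have := ler_wpM2l (mulr_ge0 (ltW C0) su) h2.
  rewrite (_ : C * sw e u * ((2 * C)^-1 * len e) = sw e u / 2 * len e)//.
  by field; rewrite gt_eqF.
have mAY : (m <= size (A ++ Y))%N.
  by rewrite /A /U0 !size_cat -!addnA (leq_trans mZ)// leq_addr.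
have mBY : (m <= size (B ++ Y))%N.
  by rewrite /B /U1 !size_cat -!addnA (leq_trans mZ)// leq_addr.
have ratio u v : path edge e u -> last e u = e -> path edge e v -> last e v = e ->
   expR (E - 11%:R * eta) * sw e (u ++ (B ++ Y) ++ v) <= sw e (u ++ (A ++ Y) ++ v) <=
   expR (E + 11%:R * eta) * sw e (u ++ (B ++ Y) ++ v).
  move=> pu lu pv lv.
  have assoc (C' : seq T) : u ++ (C' ++ Y) ++ v = u ++ C' ++ wy ++ (cy ++ v) by rewrite /Y -!catA.
  rewrite !assoc.
  apply: (swap_sizes (y := y) (y' := y') (a := a) ds); rewrite ?sy//.
  - by rewrite cat_path pu lu.
  - by rewrite last_cat lu.
  - by rewrite cat_path pu lu.
  - by rewrite last_cat lu.
  - by rewrite cat_path pcy lcy.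
  have mx : (m <= size wx)%N by rewrite sx.
  have mV1 : (m <= size V1)%N by rewrite sV1.
  have := swap_log_derivative ds pu lu pZ lZ mZ pw0 lw0 pw1 lw1 pV0 lV0 mV0 pV1 lV1 mV1 px mx pcx lX x'I xE yI.
  move: Hm; rewrite /twist -/V0 -/V1; move: (lw _ V1 y - _ - _) => t; rewrite -/U0 -/U1 -/X.
  rewrite -/A -/B; move: (lw e (u ++ _) y - _) => z; move=> h1 h2.
  apply: le_trans (ler_distD t _ _) _; apply: le_trans (lerD h2 h1) _.
  by rewrite le_eqVlt; apply/orP; left; apply/eqP; ring.
have etaE : 11%:R * eta = `|E| / 2 by rewrite /eta; field.
have le1 : expR (2 * `|E|) <= 1 + del.
  have d1 : 0 < 1 + del by rewrite addr_gt0.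
  by rewrite -[leRHS]lnK ?posrE// ler_expR mulrC -ler_pdivlMr// ltW.
have kap0 : 0 < expR (`|E| / 2) - 1 by rewrite subr_gt0 expR_gt1 divr_gt0.
(* The sign of [E] decides which of the two words is the longer one. *)
have [Ep|En] := ltP 0 E.
  exists (A ++ Y), (B ++ Y), (expR (`|E| / 2) - 1); split=> //; split; first exact: half.
  move=> u v pu lu pv lv; have /andP[r1 r2] := ratio u v pu lu pv lv.
  have nE : `|E| = E by rewrite gtr0_norm.
  have pB' : path edge e (u ++ (B ++ Y) ++ v) by rewrite cat_path pu lu cat_path pBY lBY.
  have s0 := ltW (sw_gt0 br pB').
  rewrite addrC subrK; apply/andP; split.
    by apply: le_trans r1; rewrite ler_wpM2r// ler_expR etaE nE.
  apply: le_trans r2 _; rewrite ler_wpM2r//; apply: le_trans le1.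
  by rewrite ler_expR etaE nE ar2// ltW.
exists (B ++ Y), (A ++ Y), (expR (`|E| / 2) - 1); split=> //; split; first exact: half.
move=> u v pu lu pv lv; have /andP[r1 r2] := ratio u v pu lu pv lv.
have nE : `|E| = - E by rewrite ler0_norm.
have pA' : path edge e (u ++ (A ++ Y) ++ v) by rewrite cat_path pu lu cat_path pAY lAY.
have pB' : path edge e (u ++ (B ++ Y) ++ v) by rewrite cat_path pu lu cat_path pBY lBY.
have s0 := ltW (sw_gt0 br pA'); have s1 := ltW (sw_gt0 br pB').
have inv z (p q : R) : 0 <= p -> expR z * p <= q -> p <= expR (- z) * q.
  by move=> p0 h1; rewrite -[p](mul1r p) -(expR0 R) -(subrr z) addrC expRD -mulrA ler_pM2l ?expR_gt0.
have inv' z (p q : R) : q <= expR z * p -> expR (- z) * q <= p.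
  by move=> h1; rewrite -[leRHS]mul1r -(expR0 R) -(subrr z) addrC expRD -mulrA ler_pM2l ?expR_gt0.
rewrite addrC subrK; apply/andP; split.
  by apply: le_trans (inv' _ _ _ r2); rewrite ler_wpM2r// ler_expR etaE nE.
apply: le_trans (inv _ _ _ s1 r1) _; rewrite ler_wpM2r//; apply: le_trans le1.
by rewrite ler_expR etaE nE ar4.
Qed.

Lemma loop_sw a u : path edge a u -> last a u = a -> ow a u = false ->
  hw a u (hi a) - hw a u (lo a) = sw a u.
Proof.
move=> pu lu ou; rewrite /word_size lu gtr0_norm// subr_gt0.
by apply: (loop_mono br (a := a)); rewrite ?lo_lt_hi//; exists u.
Qed.

Lemma toggling_loops e : twisted -> toggling (lo e) (hi e) (loops e).
Proof.
move=> tw del del0; have [A [B [kap [kap0 [pA lA] [pB lB] oAB [half ratio]]]]] := toggling_words e tw del0.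
suff [A' [B' [[pA' lA' oA'] [pB' lB' oB'] half' ratio']]] : exists A' B',
    [/\ [/\ path edge e A', last e A' = e & ow e A' = false],
        [/\ path edge e B', last e B' = e & ow e B' = false],
    forall u, path edge e u -> last e u = e -> sw e (u ++ B') <= sw e u / 2 &
  forall u v, path edge e u -> last e u = e -> path edge e v -> last e v = e ->
    (1 + kap) * sw e (u ++ B' ++ v) <= sw e (u ++ A' ++ v) <= (1 + del) * sw e (u ++ B' ++ v)].
  have lc C u v t : last e C = e -> last e u = e ->
      hw e u (hw e C (hw e v t)) = hw e (u ++ C ++ v) t by move=> lC lu; rewrite !hw_cat lu lC.
  exists (hw e A'), (hw e B'), kap; split=> //; [by exists A'|by exists B'| |].
    move=> _ [u [pu lu ou ->]]; have := half' u pu lu.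
    rewrite -!loop_sw// ?cat_path ?last_cat ?ow_cat ?pu ?lu ?ou//.
    by rewrite !hw_cat lu.
  move=> _ _ [u [pu lu ou ->]] [v [pv lv ov ->]]; rewrite !lc//.
  by have := ratio' u v pu lu pv lv; rewrite -!loop_sw// ?cat_path ?last_cat ?ow_cat ?pu ?lu ?ou
    ?lB' ?lA' ?pB' ?pA' ?oB' ?oA' ?pv ?lv.
have [oA|oA] := boolP (ow e A); last first.
  exists A, B; split=> //; split=> //; first exact: negbTE.
  by rewrite -oAB; exact: negbTE.
(* If both words reverse orientation, a common prefix [A] corrects it and leaves the ratio estimates
   valid, since they hold for every prefix. *)
exists (A ++ A), (A ++ B); split.
- by rewrite cat_path pA lA last_cat lA ow_cat lA oA.
- by rewrite cat_path pA lA last_cat lA ow_cat lA -oAB oA.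
- move=> u pu lu; have pu' : path edge e (u ++ A) by rewrite cat_path pu lu.
  have lu' : last e (u ++ A) = e by rewrite last_cat lu.
  rewrite catA; apply: le_trans (half _ pu' lu') _.
  suff : sw e (u ++ A) <= sw e u by lra.
  have -> : sw e (u ++ A) = `|hw e u (hw e A (hi e)) - hw e u (hw e A (lo e))|.
    by rewrite /word_size lu' !hw_cat lu.
  apply: (hw_dist_sw br pu); rewrite lu;
    by apply: (hw_in br) => //; rewrite lA; first [exact: hi_in|exact: lo_in].
move=> u v pu lu pv lv; have pu' : path edge e (u ++ A) by rewrite cat_path pu lu.
by have := ratio (u ++ A) v pu' _ pv lv; rewrite -!catA; apply; rewrite last_cat lu.
Qed.

End Toggling.

(** * Linearizing coordinates *)

Section Coordinates.
Variable R : realType.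
Implicit Types f : R -> R.

Lemma setT_clusters_at (x : R) : clusters_at setT x.
Proof.
move=> d d0; exists (x + d / 2); split=> //; first by apply/eqP; lra.
by rewrite addrC addKr gtr0_norm; lra.
Qed.

Lemma line_mvt f (f' : R -> R) x y : (forall z, quotient_lim setT f z (f' z)) -> x < y ->
  exists2 c, x < c < y & f y - f x = f' c * (y - x).
Proof.
move=> H xy; have [||c] := @MVT R f f' x y xy.
- by move=> z _; apply/is_deriveP.
- apply/within_continuousP => z _ e e0.
  have [d d0 Hd] := quotient_lim_continuous (H z) e0; exists d => // t _; exact: Hd.
by rewrite in_itv; exists c.
Qed.

Lemma quotient_lim_cts f (f' : R -> R) : (forall z, quotient_lim setT f z (f' z)) -> continuous f.
Proof.
move=> H x; apply/cvgrPdist_le => e e0; have [d d0 Hd] := quotient_lim_continuous (H x) e0.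
by apply/nbhs_ballP; exists d => // y; rewrite /ball /= => yd; rewrite distrC Hd// distrC.
Qed.

Lemma Cr_on_2 f (f' f'' : R -> R) : (forall x, quotient_lim setT f x (f' x)) ->
  (forall x, quotient_lim setT f' x (f'' x)) -> continuous f'' -> Cr_on setT (2%:E : \bar R) f.
Proof.
move=> H H' c2; rewrite /Cr_on (_ : Num.truncn 2 = 2%N); last by rewrite -[2]/(2%:R) natrK.
split; last by rewrite ltxx.
have d1 : derive_on setT f = f' by apply/funext => x; exact: derive_onE (@setT_clusters_at x) (H x).
have d2 : derive_on setT f' = f'' by apply/funext => x; exact: derive_onE (@setT_clusters_at x) (H' x).
split=> [[|[|k]]|[|[|[|k]]]] //= _; rewrite ?d1 ?d2.
- exact: (derivable_on_from (fun x _ => H x)).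
- exact: (derivable_on_from (fun x _ => H' x)).
- by apply: continuous_subspaceT; exact: quotient_lim_cts H.
- by apply: continuous_subspaceT; exact: quotient_lim_cts H'.
- exact: continuous_subspaceT.
Qed.

(** As [W] has compact support, its primitive [u] is bounded; hence the derivative [exp u] of [phi]
    is bounded below and [phi] is a diffeomorphism of the whole line. *)
Lemma coordinates_exist (W : R -> R) c M : continuous W -> (forall x, x <= c -> W x = 0) ->
  (forall x, M <= x -> W x = 0) -> exists u phi psi : R -> R,
  [/\ forall x, quotient_lim setT u x (W x), forall x, quotient_lim setT phi x (expR (u x)),
      forall t, quotient_lim setT psi t (expR (- u (psi t))), cancel phi psi &
      Cr_diffeo (2%:E : \bar R) setT setT phi psi].
Proof.
move=> cW Wc WM; have [u Hu uc] := primitive_exists cW Wc.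
have cu : continuous u := quotient_lim_cts Hu.
have [U HU] : exists U, forall x, `|u x| <= U.
  pose M' := Num.max c M; have cM : c <= M' by rewrite le_max lexx.
  have MM : M <= M' by rewrite le_max lexx orbT.
  have cn : {within `[c, M'], continuous (fun x => `|u x|)}.
    apply: continuous_subspaceT => x.
    by apply: continuous_comp; [exact: cu|exact: norm_continuous].
  have [z _ Hz] := EVT_max cM cn; exists `|u z| => x.
  have [xc|cx] := leP x c; first by rewrite uc// normr0.
  have [xM|Mx] := leP x M'; first by apply: Hz; rewrite in_itv /= (ltW cx).
  have [y /andP[y1 y2] E] := line_mvt Hu Mx.
  have -> : u x = u M' by apply/eqP; rewrite -subr_eq0 E WM ?mul0r// ltW// (le_lt_trans MM).
  by apply: Hz; rewrite in_itv /= cM lexx.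
have cexp : continuous (fun x => expR (u x)).
  by move=> x; apply: continuous_comp; [exact: cu|exact: continuous_expR].
have c1 : continuous (fun x => expR (u x) - 1).
  by move=> x; apply: cvgB; [exact: cexp|exact: cvg_cst].
have [F HF Fc] : exists2 F : R -> R, forall x, quotient_lim setT F x (expR (u x) - 1)
    & forall x, x <= c -> F x = 0.
  by apply: primitive_exists => // x xc; rewrite uc// expR0 subrr.
(* [primitive_exists] integrates functions that vanish on the left, so [exp u - 1] is integrated
   instead of [exp u]. *)
pose phi x := x + F x.
have Hphi x : quotient_lim setT phi x (expR (u x)).
  have := quotient_limD (@quotient_lim_id R setT x) (HF x).
  by rewrite addrC subrK.
have low x : expR (- U) <= expR (u x).
  by rewrite ler_expR; have := HU x; rewrite ler_norml => /andP[].
have inc x y : x < y -> expR (- U) * (y - x) <= phi y - phi x.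
  move=> xy; have [z _ ->] := line_mvt Hphi xy.
  by rewrite ler_pM2r ?subr_gt0.
have incdist x y : expR (- U) * `|y - x| <= `|phi y - phi x|.
  have [xy|yx|->] := ltgtP x y; last by rewrite !subrr !normr0 mulr0.
    by rewrite gtr0_norm ?subr_gt0//; apply: le_trans (inc _ _ xy) (ler_norm _).
  by rewrite distrC gtr0_norm ?subr_gt0// distrC; apply: le_trans (inc _ _ yx) (ler_norm _).
have surj t : exists x, phi x = t.
  have [tc|ct] := leP t c; first by exists t; rewrite /phi Fc ?addr0.
  pose b := c + (t - c) * expR U.
  have cb : c < b by rewrite /b ltrDl mulr_gt0 ?subr_gt0 ?expR_gt0.
  have ph : phi c = c by rewrite /phi Fc ?addr0.
  have tb : t <= phi b.
    have := inc _ _ cb; rewrite ph /b [c + _ - c]addrC addKr mulrCA -expRD addNr expR0 mulr1; lra.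
  have [|x _ <-] := IVT (v := t) (ltW cb) (continuous_subspaceT (quotient_lim_cts Hphi)).
    by rewrite ph ge_min (ltW ct) le_max tb orbT.
  by exists x.
have /choice[psi Hpsi] := surj.
have phiK : cancel phi psi.
  move=> x; apply/eqP; rewrite -subr_eq0 -normr_le0.
  have := incdist x (psi (phi x)); rewrite Hpsi subrr normr0 => h.
  by rewrite -(ler_pM2l (expR_gt0 (- U))) mulr0.
have Hpsi' t : quotient_lim setT psi t (expR (- u (psi t))).
  move=> e e0; set k := expR (- u (psi t)).
  have nz : expR (u (psi t)) != 0 by rewrite gt_eqF// expR_gt0.
  have k0 : 0 < k by exact: expR_gt0.
  have U0 : 0 < expR (- U) by exact: expR_gt0.
  pose e' := e * expR (- U) / k; have e'0 : 0 < e' by rewrite divr_gt0// mulr_gt0.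
  have [d d0 Hd] := Hphi (psi t) e' e'0.
  exists (d * expR (- U)); first by rewrite mulr_gt0.
  move=> s _ st sd; have ps : psi s != psi t by apply: contra_neq st => E; rewrite -(Hpsi s) E Hpsi.
  have psd : `|psi s - psi t| < d.
    rewrite -(ltr_pM2r U0); apply: le_lt_trans sd.
    by have := incdist (psi t) (psi s); rewrite !Hpsi mulrC.
  have := Hd (psi s) I ps psd; rewrite /quotient !Hpsi.
  have s0 : s - t != 0 by rewrite subr_eq0.
  have p0 : psi s - psi t != 0 by rewrite subr_eq0.
  have -> : (psi s - psi t) / (s - t) - k =
      (expR (u (psi t)) - (s - t) / (psi s - psi t)) * (k * ((psi s - psi t) / (s - t))).
    rewrite /k expRN; field; rewrite s0 p0 nz//.
  rewrite distrC normrM => h; apply: (@le_trans _ _ (e' * (k * (expR (- U))^-1))).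
    apply: ler_pM => //; rewrite normrM (gtr0_norm k0) ler_pM2l// normrM normfV.
    rewrite ler_pdivrMr ?normr_gt0// mulrC ler_pdivlMr// mulrC.
    by have := incdist (psi t) (psi s); rewrite !Hpsi.
  by rewrite /e' mulrA divfK ?gt_eqF// mulfK// gt_eqF.
exists u, phi, psi; split=> //; split=> //; split.
- apply: (Cr_on_2 Hphi (f'' := fun x => expR (u x) * W x)).
    by move=> x; apply: quotient_lim_expR.
  by move=> x; apply: cvgM; [exact: cexp|exact: cW].
have cpsi := quotient_lim_cts Hpsi'.
have Hu' t : quotient_lim setT (fun t => - u (psi t)) t (- (W (psi t) * expR (- u (psi t)))).
  by apply: quotient_limN; exact: (quotient_lim_comp (D' := setT)).
apply: (Cr_on_2 Hpsi' (f'' := fun t => expR (- u (psi t)) * (- (W (psi t) * expR (- u (psi t)))))).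
  by move=> t; apply: (quotient_lim_expR (Hu' t)).
have ce : continuous (fun t => expR (- u (psi t))).
  by move=> x; apply: continuous_comp; [exact: (quotient_lim_cts Hu')|exact: continuous_expR].
move=> x; apply: cvgM; first exact: ce.
apply: cvgN; apply: cvgM; last exact: ce.
by apply: continuous_comp; [exact: cpsi|exact: cW].
Qed.

End Coordinates.

Lemma finite_upper_bound (R : realType) (I : finType) (P : I -> R) : exists C, forall i, P i <= C.
Proof.
exists (\sum_i `|P i|) => i; rewrite (bigD1 i)//= (le_trans (ler_norm _))// lerDl.
by rewrite sumr_ge0.
Qed.

Lemma geometric_zero (R : realType) (x C lam : R) : 0 < lam < 1 ->
  (forall n, `|x| <= C * lam ^+ n) -> x = 0.
Proof.
move=> lam01 H; apply/eqP; rewrite -normr_le0 leNgt; apply/negP => x0.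
have C0 : 0 < C by have := lt_le_trans x0 (H 0%N); rewrite expr0 mulr1.
have [N HN] := small_expr lam01 (divr_gt0 x0 C0).
have := H N; rewrite mulrC -ler_pdivrMr// => h; have := le_lt_trans h HN; by rewrite ltxx.
Qed.

Lemma bounded_support (R : realType) (W : R -> R) c M : continuous W ->
  (forall x, x <= c -> W x = 0) -> (forall x, M <= x -> W x = 0) -> exists B, forall x, `|W x| <= B.
Proof.
move=> cW Wc WM; pose M' := Num.max c M.
have cM : c <= M' by rewrite le_max lexx.
have cn : {within `[c, M'], continuous (fun x => `|W x|)}.
  by apply: continuous_subspaceT => x; apply: continuous_comp; [exact: cW|exact: norm_continuous].
have [z _ Hz] := EVT_max cM cn; exists `|W z| => x.
have [xc|cx] := leP x c; first by rewrite Wc// normr0.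
have [xM|Mx] := leP x M'; first by apply: Hz; rewrite in_itv /= (ltW cx).
by rewrite WM ?normr0// ltW// (le_lt_trans _ Mx)// le_max lexx orbT.
Qed.

Lemma clamp_continuous (R : realType) (l h : R) (f : R -> R) : l <= h -> continuous f ->
  continuous (fun x => clamp l h (f x)).
Proof.
move=> lh cf x; apply/cvgrPdist_le => e e0.
have /cvgrPdist_le /(_ e e0) := cf x; apply: filterS => y; apply: le_trans.
exact: clamp_lipschitz.
Qed.

Lemma sum_continuous (R : realType) (I : Type) (s : seq I) (F : I -> R -> R) :
  (forall i, continuous (F i)) -> continuous (fun x => \sum_(i <- s) F i x).
Proof.
move=> cF; elim: s => [|i s IH].
  by rewrite (_ : (fun x => _) = cst 0) => [x|]; [exact: cvg_cst|apply/funext => x; rewrite big_nil].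
rewrite (_ : (fun x => _) = fun x => F i x + \sum_(j <- s) F j x).
  by move=> x; apply: cvgD; [exact: cF|exact: IH].
by apply/funext => x; rewrite big_cons.
Qed.

Lemma telescope_arith (R : realType) (A A' u v v' w w' l l' x : R) :
  A - A' = u - (v - v') -> v' - w' - l' = v - w - l -> l + A - (l' + A') = u - (w - w').
Proof. by move=> E1 E2; rewrite opprD addrACA E1; lra. Qed.

(** * Log-derivatives along backward orbits *)

Section Linearization.
Variables (R : realType) (g : expanding_map (2%:E : \bar R)).
Local Notation T := (alphabet g).
Local Notation lo := (lo (e := g)).
Local Notation hi := (hi (e := g)).
Local Notation edge := (@letter_edge R 2%:E g).
Local Notation K := (cantor_set g).
Variables (h : T * T -> R -> R) (lam H0 al : R).
Local Notation L := (log_derive h).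
Local Notation o := (reversing h).
Hypothesis br : branches h L o lam H0 al.
Hypothesis diffeo : forall p, p \in transitions g ->
  Cr_diffeo 2%:E `[lo2 p, hi2 p] `[lo p.2, hi p.2] (emap g) (h p).
Local Notation hw := (word_map h).
Local Notation lw := (word_log_derive h L).
Variable P : T -> T.
Hypothesis edgeP : forall a, edge (P a) a.

Local Notation d := (branch_derive h).
Local Notation Dom p := (`[lo p.2, hi p.2]%classic).

Definition branch_derive2 (p : T * T) := derive_on (Dom p) (d p).
Local Notation d2 := branch_derive2.

Lemma gt12 : (1 < 2%:E :> \bar R)%E. Proof. by rewrite lte_fin ltr1n. Qed.

Lemma branch_C2 p : p \in transitions g ->
  [/\ forall x, lo p.2 <= x <= hi p.2 -> quotient_lim (Dom p) (h p) x (d p x),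
      forall x, lo p.2 <= x <= hi p.2 -> quotient_lim (Dom p) (d p) x (d2 p x),
      {within Dom p, continuous d p}, {within Dom p, continuous d2 p} &
      forall x, lo p.2 <= x <= hi p.2 -> d p x != 0].
Proof.
move=> pB; have [_ _ _ _ [_ Crh]] := diffeo pB.
have [_ cd nz _] := branch_derive_facts gt12 pB (diffeo pB).
move: Crh; rewrite /Cr_on (_ : Num.truncn 2 = 2%N); last by rewrite -[2]/(2%:R) natrK.
move=> [[dv ct] _]; split=> //.
- by move=> x xI; apply: (derivable_onP (dv 0%N isT)); rewrite /= in_itv.
- by move=> x xI; apply: (derivable_onP (dv 1%N isT)); rewrite /= in_itv.
- exact: (ct 2%N isT).
Qed.

Lemma norm_d p x : p \in transitions g -> lo p.2 <= x <= hi p.2 ->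
  `|d p x| * len p.2 <= lam * len p.1.
Proof.
move=> pB xI; have [_ _ _ _ nz] := branch_C2 pB.
have := br_contr br pB xI; rewrite lnK// posrE normr_gt0; exact: nz.
Qed.

Let q a x := d2 (P a, a) x / d (P a, a) x.

(** The derivative of the log-derivative of the word [back P n a]: each step contributes [q], which
    is [h'' / h'], times the derivative of the steps already made. *)
Fixpoint transfer (n : nat) (a : T) (x : R) : R :=
  if n is n'.+1 then q a x + d (P a, a) x * transfer n' (P a) (h (P a, a) x) else 0.

Let PB a : (P a, a) \in transitions g := edgeP a.

Let hI a x : lo a <= x <= hi a -> lo (P a) <= h (P a, a) x <= hi (P a).
Proof. by move=> xI; exact: (br_in1 br (PB a)). Qed.

Let cq a : {within `[lo a, hi a], continuous q a}.
Proof.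
have [_ _ cd cd2 nz] := branch_C2 (PB a).
apply/subspace_continuousP => x xI; apply: cvgM.
  by move/subspace_continuousP: cd2; exact.
apply: cvgV; last by move/subspace_continuousP: cd; exact.
by apply: nz; move: xI; rewrite /= in_itv.
Qed.

Lemma transfer_continuous n a : {within `[lo a, hi a], continuous transfer n a}.
Proof.
elim: n a => [|n IH] a /=; first by apply: continuous_subspaceT => x; exact: cvg_cst.
have [hd _ cd _ _] := branch_C2 (PB a).
apply/subspace_continuousP => x xI; apply: cvgD.
  by have /subspace_continuousP := @cq a; exact.
apply: cvgM; first by move/subspace_continuousP: cd; exact.
suff : {within `[lo a, hi a], continuous (fun x => transfer n (P a) (h (P a, a) x))}.
  by move/subspace_continuousP; exact.
apply/within_continuousP => y yI e e0.
have yI' : lo a <= y <= hi a by move: yI; rewrite /= in_itv.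
have hyI := hI yI'; have {}hyI : `[lo (P a), hi (P a)]%classic (h (P a, a) y) by rewrite /= in_itv.
have /within_continuousP /(_ _ hyI e e0) [d1 d10 Hd1] := IH (P a).
have [d3 d30 Hd3] := quotient_lim_continuous (hd y yI') (divr_gt0 d10 (ltr0Sn _ 1)).
exists d3 => // t tI td; apply: Hd1; last by apply: le_lt_trans (Hd3 t tI td) _; lra.
by rewrite /= in_itv; apply: hI; move: tI; rewrite /= in_itv.
Qed.

Let lam01 := br_lam br.

(** Multiplied by the length of the letter, the difference of consecutive terms is contracted by
    [lam], because [|d p| * len p.2 <= lam * len p.1]. *)
Lemma transfer_limit : exists w : T -> R -> R, exists2 c : R, 0 <= c &
  forall n a x, lo a <= x <= hi a -> `|transfer n a x - w a x| <= c * lam ^+ n.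
Proof.
have /andP[lam0 lam1] := lam01.
have /choice[Q HQ] (a : T) : exists Q, forall x, lo a <= x <= hi a -> `|q a x| * len a <= Q.
  have cn : {within `[lo a, hi a], continuous (fun x => `|q a x|)}.
    by move=> x; apply: continuous_comp; [exact: cq|exact: norm_continuous].
  have [z _ Hz] := EVT_max (ltW (lo_lt_hi a)) cn; exists (`|q a z| * len a) => x xI.
  by rewrite ler_pM2r ?len_gt0//; apply: Hz; rewrite in_itv.
have [M0 HM0] := finite_upper_bound Q; pose M := `|M0|.
have HM a x : lo a <= x <= hi a -> `|q a x| * len a <= M.
  by move=> xI; apply: le_trans (HQ a x xI) _; apply: le_trans (HM0 a) (ler_norm _).
have diff n a x : lo a <= x <= hi a ->
    `|transfer n.+1 a x - transfer n a x| * len a <= M * lam ^+ n.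
  elim: n a x => [|n IH] a x xI; first by rewrite /= mulr0 addr0 subr0 expr0 mulr1 HM.
  rewrite [transfer n.+2 a x]/= [in X in _ - X]/= opprD addrACA subrr add0r -mulrBr normrM.
  have h1 := IH (P a) _ (hI xI); have h2 := norm_d (PB a) xI.
  rewrite mulrAC; apply: (@le_trans _ _ (lam * len (P a) * `|transfer n.+1 (P a) (h (P a, a) x) - transfer n (P a) (h (P a, a) x)|)).
    by rewrite ler_wpM2r.
  have := ler_wpM2l (ltW lam0) h1; rewrite [lam ^+ n.+1]exprS; lra.
have [l l0 Hl] := finite_lower_bound (@len_gt0 R 2%:E g).
have M00 : 0 <= M by exact: normr_ge0.
pose c := M / ((1 - lam) * l); have c0 : 0 <= c.
  by apply: divr_ge0; [exact: normr_ge0|rewrite mulr_ge0 ?subr_ge0 ?(ltW lam1) ?(ltW l0)].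
have /choice[w Hw] (p : T * R) : exists w, lo p.1 <= p.2 <= hi p.1 ->
    forall n, `|transfer n p.1 p.2 - w| <= c * lam ^+ n.
  case: p => a x /=; have [xI|] := boolP (lo a <= x <= hi a); last by exists 0.
  have [|w Hw] := geometric_limit (s := fun n => transfer n a x) lam01 c0; last by exists w.
  move=> n; have := diff n a x xI; rewrite -ler_pdivlMr ?len_gt0// => h1; apply: le_trans h1 _.
  rewrite /c (_ : M / ((1 - lam) * l) * lam ^+ n * (1 - lam) = M * lam ^+ n / l); last first.
    by field; rewrite gt_eqF//= subr_eq0 gt_eqF.
  have Mp : 0 <= M * lam ^+ n by rewrite mulr_ge0 ?exprn_ge0 ?(ltW lam0).
  by rewrite ler_wpM2l// lef_pV2 ?posrE ?len_gt0.
by exists (fun a x => w (a, x)), c => // n a x xI; exact: (Hw (a, x)).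
Qed.

(* Integrating [W] gives the [u] for which the branches [(P a, a)] become affine
   in the coordinate of derivative [exp u]. *)
Lemma derivative_field : exists W : R -> R, exists c M : R, [/\ continuous W,
  forall x, x <= c -> W x = 0, forall x, M <= x -> W x = 0 &
  forall a x, lo a <= x <= hi a -> W x = q a x + d (P a, a) x * W (h (P a, a) x)].
Proof.
have /andP[lam0 lam1] := lam01.
have [w [c c0 Hw]] := transfer_limit.
have weq a x : lo a <= x <= hi a -> w a x = q a x + d (P a, a) x * w (P a) (h (P a, a) x).
  move=> xI; apply/eqP; rewrite -subr_eq0; apply/eqP.
  apply: (@geometric_zero _ _ (c + `|d (P a, a) x| * c) lam lam01) => n.
  have h1 := Hw n.+1 a x xI; have h2 := Hw n (P a) _ (hI xI).
  rewrite /= in h1; set s := transfer n _ _ in h1 h2; set s' := w (P a) _ in h2 *.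
  rewrite (_ : w a x - _ = - (q a x + d (P a, a) x * s - w a x) + d (P a, a) x * (s - s')); last by ring.
  apply: le_trans (ler_normD _ _) _; rewrite normrN normrM mulrDl; apply: lerD.
    apply: le_trans h1 _; by rewrite exprS mulrCA ler_piMl ?mulr_ge0 ?exprn_ge0 ?(ltW lam0) ?(ltW lam1).
  by rewrite -mulrA ler_wpM2l.
have cw a : {within `[lo a, hi a], continuous w a}.
  apply/within_continuousP => x xI e e0.
  have e30 : 0 < e / 3 by rewrite divr_gt0.
  have cp : 0 < c + 1 by lra.
  have [N HN] := small_expr lam01 (divr_gt0 e30 cp).
  have small : c * lam ^+ N <= e / 3.
    move: HN; rewrite ltr_pdivlMr// => h1; have : 0 <= lam ^+ N by rewrite exprn_ge0 ?ltW.
    lra.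
  have /within_continuousP /(_ x xI _ e30)[dl dl0 Hdl] := @transfer_continuous N a.
  exists dl => // y yI yd; have h1 := Hdl y yI yd.
  have h2 := Hw N a x; have h3 := Hw N a y; rewrite /= in_itv in xI; rewrite /= in_itv in yI.
  have := h2 xI; have := h3 yI; move: h1; rewrite !ler_norml => /andP[? ?] /andP[? ?] /andP[? ?].
  by apply/andP; split; lra.
have lohi a : lo a <= hi a by rewrite ltW// lo_lt_hi.
have [dl dl0 gap] : exists2 dl : R, 0 < dl & forall a b x y, a \in predT -> b \in predT -> a != b ->
    lo a <= x <= hi a -> lo b <= y <= hi b -> dl <= `|x - y|.
  by apply: intervals_gap => // a b x _ _; exact: letter_uniq.
(* A cut-off equal to 1 on [I(a)] and to 0 at distance [dl] from it, where [dl] is the gap between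
   letters: the sum [W] restricts to [w a] on each [I(a)]. *)
pose chi a x := clamp 0 1 (1 - `|x - clamp (lo a) (hi a) x| / dl).
pose W x := \sum_a w a (clamp (lo a) (hi a) x) * chi a x.
have chi0 a x : dl <= `|x - clamp (lo a) (hi a) x| -> chi a x = 0.
  move=> h1; rewrite /chi /clamp max_l// ge_min; apply/orP; left.
  by rewrite subr_le0 ler_pdivlMr// mul1r.
have chi1 a x : lo a <= x <= hi a -> chi a x = 1.
  by move=> xI; rewrite /chi (clamp_id xI) subrr normr0 mul0r subr0 clamp_id// lexx ler01.
have WI a x : lo a <= x <= hi a -> W x = w a x.
  move=> xI; rewrite /W (bigD1 a)//= big1 ?addr0; first by rewrite clamp_id// chi1// mulr1.
  move=> b ba; rewrite chi0 ?mulr0//; apply: (gap a b) => //; first by rewrite eq_sym.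
  exact: clamp_in.
have cclamp a : continuous (fun x => clamp (lo a) (hi a) x).
  by apply: clamp_continuous => // x; exact: cvg_id.
have cW : continuous W.
  apply: (@sum_continuous R T (index_enum T) (fun a y => w a (clamp (lo a) (hi a) y) * chi a y)) => a x; apply: cvgM.
    apply/cvgrPdist_le => e e0.
    have cI y : `[lo a, hi a]%classic (clamp (lo a) (hi a) y) by rewrite /= in_itv /=; exact: clamp_in.
    have /within_continuousP /(_ _ (cI x) e e0)[d1 d10 Hd1] := cw a.
    apply/nbhs_ballP; exists d1 => // y; rewrite /ball /= => yd.
    rewrite distrC; apply: Hd1 => //; apply: le_lt_trans yd; rewrite distrC; exact: clamp_lipschitz.
  suff : continuous (chi a) by exact.
  apply: clamp_continuous => // y; apply: cvgB; first exact: cvg_cst.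
  apply: cvgM; last exact: cvg_cst.
  by apply: (@cvg_norm _ R^o); apply: cvgB; [exact: cvg_id|exact: cclamp].
have [m Hm] := finite_upper_bound (fun a => - lo a); have [M HM] := finite_upper_bound hi.
exists W, (- m - dl), (M + dl); split=> //.
- move=> x xm; rewrite /W big1// => a _; rewrite chi0 ?mulr0//.
  have := Hm a => h1; have := clamp_in x (lohi a) => /andP[h2 _].
  by rewrite distrC ger0_norm; lra.
- move=> x xm; rewrite /W big1// => a _; rewrite chi0 ?mulr0//.
  have := HM a => h1; have := clamp_in x (lohi a) => /andP[_ h2].
  by rewrite ger0_norm; lra.
by move=> a x xI; rewrite (WI a x xI) (WI (P a) _ (hI xI)); exact: weq.
Qed.

(** Two distinct edges into [a] give, arbitrarily close to [x], two points of [K] with different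
    pasts; at least one of them is not [x]. *)
Lemma cantor_clusters_at b a x : edge b a -> b != P a -> K x -> lo a <= x <= hi a ->
  clusters_at (K `&` `[lo a, hi a]) x.
Proof.
move=> eba bP Kx xI dl dl0.
have [k0 Kk0 k0I] := cantor_nonempty br a.
have /andP[lam0 lam1] := lam01.
have pos : 0 < len_ratio g * (1 + \sum_c len (g := g) c).
  by rewrite mulr_gt0 ?len_ratio_gt0// ltr_wpDr ?sumr_ge0// => c _; rewrite ltW// len_gt0.
have [n Hn] := small_expr lam01 (divr_gt0 dl0 pos).
have [w [x' [pw sw x'I xE]]] := letter_word br n Kx xI.
have [v [pv lv _]] := connect_letters (last a w) a.
have [cb [pb lb _]] := connect_letters a b.
have [cP [pP lP _]] := connect_letters a (P a).
pose R1 := rcons cb a; pose R2 := rcons cP a.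
have pR1 : path edge a R1 by rewrite rcons_path pb lb.
have pR2 : path edge a R2 by rewrite rcons_path pP lP edgeP.
have lR1 : last a R1 = a by rewrite last_rcons.
have lR2 : last a R2 = a by rewrite last_rcons.
pose y S := hw a (w ++ (v ++ S)) k0.
have yK S : path edge a S -> last a S = a -> (K `&` `[lo a, hi a]) (y S) /\ `|y S - x| < dl.
  move=> pS lS.
  have p1 : path edge (last a w) (v ++ S) by rewrite cat_path pv lv pS.
  have l1 : last (last a w) (v ++ S) = a by rewrite last_cat lv.
  have p2 : path edge a (w ++ (v ++ S)) by rewrite cat_path pw p1.
  have l2 : last a (w ++ (v ++ S)) = a by rewrite last_cat l1.
  split; first split.
  - by apply: (cantor_hw br p2); rewrite ?l2.
  - by rewrite /= in_itv /=; apply: (hw_in br p2); rewrite l2.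
  have zI : lo (last a w) <= hw (last a w) (v ++ S) k0 <= hi (last a w).
    by apply: (hw_in br p1); rewrite l1.
  rewrite /y hw_cat xE; apply: le_lt_trans (hw_dist br pw x'I zI) _; rewrite sw.
  rewrite ltr_pdivlMr// in Hn; apply: le_lt_trans Hn.
  rewrite mulrA [lam ^+ n * _]mulrC ler_wpM2l ?mulr_ge0 ?exprn_ge0 ?(ltW lam0) ?(ltW (len_ratio_gt0 g))//.
  have : `|hw (last a w) (v ++ S) k0 - x'| <= len (last a w).
    by rewrite /len; move: zI x'I => /andP[? ?] /andP[? ?]; rewrite ler_norml; apply/andP; split; lra.
  move/le_trans; apply; rewrite (bigD1 (last a w))//= addrCA lerDl addr_ge0// sumr_ge0// => c _.
  by rewrite ltW// len_gt0.
pose S1 := R2 ++ R1; pose S2 := R1 ++ R2.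
have pS1 : path edge a S1 by rewrite cat_path pR2 lR2.
have lS1 : last a S1 = a by rewrite last_cat lR2.
have pS2 : path edge a S2 by rewrite cat_path pR1 lR1.
have lS2 : last a S2 = a by rewrite last_cat lR1.
have [D1 d1] := yK S1 pS1 lS1; have [D2 d2'] := yK S2 pS2 lS2.
have y12 : y S1 != y S2.
  have yE S : y S = hw a w (hw (last a w) v (hw a S k0)) by rewrite /y !hw_cat lv.
  apply/eqP; rewrite !yE => E.
  have i1 S : path edge a S -> last a S = a -> lo a <= hw a S k0 <= hi a.
    by move=> pS lS; apply: (hw_in br pS); rewrite lS.
  have {}E := hw_inj br pw _ _ E.
  have {}E : hw (last a w) v (hw a S1 k0) = hw (last a w) v (hw a S2 k0).
    by apply: E; apply: (hw_in br pv); rewrite lv; exact: i1.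
  have {}E : hw a S1 k0 = hw a S2 k0.
    by apply: (hw_inj br pv); rewrite ?lv//; exact: i1.
  have end_edge S c : path edge a (rcons S a) -> last a S = c ->
      iter (size S) (emap g) (hw a (rcons S a) k0) = h (c, a) k0 /\ edge c a.
    rewrite -cats1 => pS lS; rewrite (iter_hw br pS) ?last_cat//= lS; split=> //.
    by move: pS; rewrite cat_path /= lS andbT => /andP[].
  have E1 : S1 = rcons (R2 ++ cb) a by rewrite /S1 /R1 -rcons_cat.
  have E2 : S2 = rcons (R1 ++ cP) a by rewrite /S2 /R2 -rcons_cat.
  have [||h1 e1] := end_edge (R2 ++ cb) b; [by rewrite -E1|by rewrite last_cat lR2|].
  have [||h2 e2] := end_edge (R1 ++ cP) (P a); [by rewrite -E2|by rewrite last_cat lR1|].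
  rewrite -E1 E in h1; rewrite -E2 in h2.
  (* Both points reach their final edges after the same number of iterations; if they were equal,
     the images under the two edges would coincide. *)
  have sz : size (R2 ++ cb) = size (R1 ++ cP) by rewrite !size_cat !size_rcons !addSn addnC.
  rewrite sz h2 in h1.
  have b1 := br_in br (p := (b, a)) e1 k0I; have b2 := br_in br (p := (P a, a)) e2 k0I.
  rewrite -h1 in b1; have [Eb] := edge_uniq e1 e2 b1 b2.
  by rewrite Eb eqxx in bP.
have [yx|yx] := eqVneq (y S1) x; last by exists (y S1).
by exists (y S2); split=> //; rewrite -yx eq_sym.
Qed.

Section Field.
Variables (W u : R -> R) (B : R).
Hypothesis Hu : forall x, quotient_lim setT u x (W x).
Hypothesis WB : forall x, `|W x| <= B.
Hypothesis Weq : forall a x, lo a <= x <= hi a ->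
  W x = q a x + d (P a, a) x * W (h (P a, a) x).

(* Log-derivative of the branch [p] in the coordinate whose derivative is
   [exp u]. *)
Definition Psi (p : T * T) z := u z - u (h p z) - L p z.
Definition Psi' (p : T * T) z := W z - W (h p z) * d p z - d2 p z / d p z.

Lemma Psi_derive p z : p \in transitions g -> lo p.2 <= z <= hi p.2 ->
  quotient_lim (Dom p) (Psi p) z (Psi' p z).
Proof.
move=> pB zI; have [hd hd2 _ _ nz] := branch_C2 pB.
apply: quotient_limB; last by apply: quotient_lim_ln; [exact: hd2|exact: nz].
apply: quotient_limB; first exact: quotient_lim_sub (Hu z).
by apply: (quotient_lim_comp (D' := setT)) => //; exact: hd.
Qed.

Lemma Psi'_field a z : lo a <= z <= hi a -> Psi' (P a, a) z = 0.
Proof. by move=> zI; rewrite /Psi' (Weq zI) /q; ring. Qed.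

Lemma Psi_const a x y : lo a <= x <= hi a -> lo a <= y <= hi a ->
  Psi (P a, a) x = Psi (P a, a) y.
Proof.
wlog xy : x y / x < y => [H xI yI|/andP[x1 x2] /andP[y1 y2]].
  by have [xy|yx|->//] := ltgtP x y; [exact: H|symmetry; exact: H].
have Hd z : `[lo a, hi a]%classic z -> quotient_lim `[lo a, hi a] (Psi (P a, a)) z 0.
  rewrite /= in_itv /= => zI; rewrite -(Psi'_field zI); exact: (Psi_derive (PB a) zI).
have [c /andP[c1 c2] E] := interval_mvt (derivable_on_from Hd) x1 xy y2.
have cI : lo a <= c <= hi a by rewrite (le_trans x1 c1) (le_trans c2 y2).
have c0 : derive_on `[lo a, hi a] (Psi (P a, a)) c = 0.
  apply: derive_onE; first exact: (itv_clusters_at (lo_lt_hi a) cI).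
  by apply: Hd; rewrite /= in_itv.
by apply/esym/eqP; rewrite -subr_eq0 E c0 mul0r.
Qed.

(** By [Psi_const] the selected branches are affine in the chart, so the log-derivatives telescope
    and only the values of [u] at both ends remain. *)
Lemma back_log_derivative k a x y : lo a <= x <= hi a -> lo a <= y <= hi a ->
  lw (iter k P a) (back P k a) y - lw (iter k P a) (back P k a) x =
  u y - u x - (u (hw (iter k P a) (back P k a) y) - u (hw (iter k P a) (back P k a) x)).
Proof.
move=> xI yI; elim: k => [|k IH] /=; first by rewrite !subrr.
have [pb lb _] := backP edgeP k a.
set c := iter k P a in IH pb lb *.
have cI z : lo a <= z <= hi a -> lo c <= hw c (back P k a) z <= hi c.
  by move=> zI; apply: (hw_in br pb); rewrite lb.
by have := Psi_const (cI x xI) (cI y yI); exact: telescope_arith IH.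
Qed.

(** The values of [u] at the far ends of the two pasts cancel in the limit, since [u] is Lipschitz
    and the pasts contract. What remains is the variation of [Psi] for the edge that was not
    selected. *)
Lemma twist_limit b a x y : edge b a -> lo a <= x <= hi a -> lo a <= y <= hi a ->
  forall e, 0 < e -> exists k0, forall k, (k0 <= k)%N ->
    `|twist h L P k b a x y - (Psi (b, a) y - Psi (b, a) x)| <= e.
Proof.
move=> eba xI yI e e0; have /andP[lam0 lam1] := lam01.
have B0 : 0 <= B := le_trans (normr_ge0 _) (WB 0).
have hI' z : lo a <= z <= hi a -> lo b <= h (b, a) z <= hi b.
  by move=> zI; exact: (br_in1 br (p := (b, a)) eba zI).
have Bpos c : 0 < B * (len_ratio g * len (g := g) c) + 1.
  by rewrite ltr_wpDl// !mulr_ge0// ltW ?len_ratio_gt0 ?len_gt0.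
have small c (z z' : R) : lo c <= z <= hi c -> lo c <= z' <= hi c -> exists k0, forall k, (k0 <= k)%N ->
   `|u (hw (iter k P c) (back P k c) z) - u (hw (iter k P c) (back P k c) z')| <= e / 2.
  move=> zI z'I; have [k0 Hk0] := small_expr lam01 (divr_gt0 (divr_gt0 e0 (ltr0Sn _ 1)) (Bpos c)).
  exists k0 => k kk; have [pb lb sb] := backP edgeP k c.
  apply: le_trans (quotient_lim_Lipschitz _ _ Hu WB) _.
  have := hw_dist br pb (x := z') (y := z); rewrite lb sb => /(_ z'I zI) h1.
  apply: le_trans (ler_wpM2l B0 h1) _.
  have zz : `|z - z'| <= len c.
    by rewrite /len; move: zI z'I => /andP[? ?] /andP[? ?]; rewrite ler_norml; apply/andP; split; lra.
  have lk : lam ^+ k <= lam ^+ k0 by rewrite ler_wiXn2l// ltW.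
  rewrite ltr_pdivlMr// in Hk0; apply: le_trans (ltW Hk0).
  apply: (@le_trans _ _ (lam ^+ k0 * (B * (len_ratio g * len c)))); last first.
    by rewrite ler_wpM2l ?exprn_ge0 ?(ltW lam0)// lerDl.
  rewrite [leLHS](_ : _ = (B * len_ratio g) * (lam ^+ k * `|z - z'|)); last by ring.
  rewrite [leRHS](_ : _ = (B * len_ratio g) * (lam ^+ k0 * len c)); last by ring.
  rewrite ler_wpM2l ?mulr_ge0 ?(ltW (len_ratio_gt0 g))//.
  by apply: ler_pM => //; rewrite exprn_ge0// ltW.
have [k1 Hk1] := small a y x yI xI; have [k2 Hk2] := small b _ _ (hI' y yI) (hI' x xI).
exists (maxn k1 k2) => k; rewrite geq_max => /andP[kk1 kk2].
have [pb lb sb] := backP edgeP k b.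
have rc z : lw (iter k P b) (rcons (back P k b) a) z =
    lw (iter k P b) (back P k b) (h (b, a) z) + L (b, a) z.
  by rewrite -cats1 lw_cat lb /= addr0.
rewrite /twist !rc.
have E1 := back_log_derivative k xI yI; have E2 := back_log_derivative k (hI' x xI) (hI' y yI).
rewrite (_ : _ - _ - _ = (u (hw (iter k P b) (back P k b) (h (b, a) y)) -
    u (hw (iter k P b) (back P k b) (h (b, a) x))) -
  (u (hw (iter k P a) (back P k a) y) - u (hw (iter k P a) (back P k a) x))).
  apply: le_trans (ler_normB _ _) _; rewrite [e](splitr e); apply: lerD; [exact: Hk2|exact: Hk1].
by move/eqP: E2; rewrite subr_eq => /eqP ->; rewrite E1 /Psi; ring.
Qed.

(** A nonzero derivative makes [Psi] take values different from [Psi p z], but close to it, at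
    nearby points of [K]; such points exist because [p] is not a selected edge. *)
Lemma Psi'_twisted p z : p \in transitions g -> K z -> lo p.2 <= z <= hi p.2 ->
  Psi' p z != 0 -> twisted h L P.
Proof.
case: p => b a /= eba Kz zI c0.
have bP : b != P a by apply: contra_neq c0 => ->; exact: Psi'_field.
exists b, a, z; split=> // dl dl0; set c := Psi' (b, a) z in c0.
have Q := Psi_derive (p := (b, a)) eba zI.
have cp : 0 < `|c| / 2 by rewrite divr_gt0 ?normr_gt0.
have [d1 d10 H1] := Q _ cp.
have [d3 d30 H3] := quotient_lim_continuous Q (divr_gt0 dl0 (ltr0Sn _ 1)).
have [|y [[Ky yD] yz]] := cantor_clusters_at eba bP Kz zI (d := Num.min d1 d3).
  by rewrite lt_min d10.
rewrite lt_min => /andP[yd1 yd3].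
have yI : lo a <= y <= hi a by move: yD; rewrite /= in_itv.
exists y, (Psi (b, a) y - Psi (b, a) z); split=> //; last exact: twist_limit.
apply/andP; split; last by apply: le_lt_trans (H3 y yD yd3) _; lra.
rewrite normr_gt0; apply/eqP => E; have := H1 y yD yz yd1.
by rewrite /quotient E mul0r sub0r normrN -/c leNgt ltr_pdivrMr// ltr_pMr ?ltr1n// normr_gt0.
Qed.

End Field.
End Linearization.

(** * The second derivative of the map in the new coordinate *)

Section NonAffine.
Variables (R : realType) (g : expanding_map (2%:E : \bar R)).
Local Notation T := (alphabet g).
Local Notation lo := (lo (e := g)).
Local Notation hi := (hi (e := g)).
Local Notation edge := (@letter_edge R 2%:E g).
Local Notation K := (cantor_set g).
Variables (h : T * T -> R -> R) (lam H0 al : R).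
Local Notation L := (log_derive h).
Local Notation d := (branch_derive h).
Local Notation Dom p := (`[lo p.2, hi p.2]%classic).
Hypothesis br : branches h L (reversing h) lam H0 al.
Hypothesis diffeo : forall p, p \in transitions g ->
  Cr_diffeo 2%:E `[lo2 p, hi2 p] `[lo p.2, hi p.2] (emap g) (h p).

Lemma predecessors : exists P : T -> T, forall a, edge (P a) a.
Proof.
suff /choice[P HP] (a : T) : exists b, edge b a by exists P.
have [w [pw lw w0]] := connect_letters a a.
case/lastP: w pw lw w0 => // w b; rewrite rcons_path last_rcons => /andP[_ e] <- _.
by exists (last a w).
Qed.

Section Chart.
Variables (W u phi psi : R -> R).
Hypothesis Hu : forall x, quotient_lim setT u x (W x).
Hypothesis Hphi : forall x, quotient_lim setT phi x (expR (u x)).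
Hypothesis Hpsi : forall t, quotient_lim setT psi t (expR (- u (psi t))).
Hypothesis phiK : cancel phi psi.

Local Notation D' := (phi @` edom g).
Local Notation F := (phi \o emap g \o psi).

(** The derivative of [phi \o g \o psi] as a function of the image [z = g y]. Up to sign it is
    [exp (Psi p z)], so its logarithmic derivative is [Psi']. *)
Let chart_derive (p : T * T) z := expR (u z) * ((d p z)^-1 * expR (- u (h p z))).

Lemma lo2_lt_hi2 p : p \in transitions g -> lo2 p < hi2 p.
Proof.
move=> pB; have l := lo_lt_hi p.2.
have loI : lo p.2 <= lo p.2 <= hi p.2 by rewrite lexx ltW.
have hiI : lo p.2 <= hi p.2 <= hi p.2 by rewrite lexx ltW.
have /andP[h1 h2] := br_in br pB loI; have /andP[h3 h4] := br_in br pB hiI.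
have := br_mono br pB (lexx _) l (lexx _); case: ifP => _ h5.
  by apply: le_lt_trans h3 _; apply: lt_le_trans h5 h2.
by apply: le_lt_trans h1 _; apply: lt_le_trans h5 h4.
Qed.

(** Derivatives are relative to the image of the whole domain; the gap between the intervals [I(p)]
    makes a single branch visible near each point. *)
Lemma chart_local p y : p \in transitions g -> lo2 p <= y <= hi2 p ->
  exists2 r : R, 0 < r & forall t, D' t -> `|t - phi y| < r ->
    D' t /\ lo2 p <= psi t <= hi2 p.
Proof.
move=> pB yI.
have [dl dl0 gap] : exists2 dl : R, 0 < dl & forall p q x y, p \in transitions g ->
    q \in transitions g -> p != q -> lo2 p <= x <= hi2 p -> lo2 q <= y <= hi2 q -> dl <= `|x - y|.
  apply: intervals_gap => [q qB|q q' x qB q'B]; last exact: edge_uniq.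
  by rewrite ltW// lo2_lt_hi2.
have [r r0 Hr] := quotient_lim_continuous (Hpsi (phi y)) (divr_gt0 dl0 (ltr0Sn _ 1)).
exists r => // t Dt tr; split=> //; have [x /edomP[q qB xq] tE] := Dt.
rewrite -tE phiK; have := Hr t I tr; rewrite -tE !phiK => xy.
have [<-//|pq] := eqVneq q p; exfalso.
have := gap q p x y qB pB pq xq yI; lra.
Qed.

Let D'' (p : T * T) := [set t | D' t /\ lo2 p <= psi t <= hi2 p].

Lemma chart_inner_derive p y : p \in transitions g -> lo2 p <= y <= hi2 p ->
  quotient_lim (D'' p) (emap g \o psi) (phi y) ((d p (emap g y))^-1 * expR (- u y)).
Proof.
move=> pB yI; have [fD hE hf fh [Crf Crh]] := diffeo pB.
have [df _] := Cr_on_C1 (@gt12 R) Crf; have [dh _] := Cr_on_C1 (@gt12 R) Crh.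
have zI := br_emap_in br pB yI.
have yD : `[lo2 p, hi2 p]%classic y by rewrite /= in_itv.
have hIn x : lo p.2 <= x <= hi p.2 -> lo2 p <= h p x <= hi2 p by exact: (br_in br pB).
have fhI x : lo p.2 <= x <= hi p.2 -> emap g (h p x) = x by exact: (br_emap br pB).
have := inverse_derive (lo_lt_hi p.2) df dh hIn fhI zI.
rewrite -/(d p (emap g y)) (br_can br pB yI) => E.
have nz : d p (emap g y) != 0 by apply/eqP => z0; move/eqP: E; rewrite z0 mul0r eq_sym oner_eq0.
have dE : (d p (emap g y))^-1 = derive_on `[lo2 p, hi2 p] (emap g) y.
  by apply: (mulfI nz); rewrite mulfV// E.
rewrite dE; apply: (quotient_lim_comp (D' := `[lo2 p, hi2 p]%classic)).
- by move=> t [_]; rewrite /= in_itv.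
- have := Hpsi (phi y); rewrite phiK => H; exact: quotient_lim_sub H.
by rewrite phiK; exact: derivable_onP.
Qed.

Lemma chart_clusters_at p y : p \in transitions g -> lo2 p <= y <= hi2 p ->
  clusters_at D' (phi y).
Proof.
move=> pB yI e e0; have [r r0 Hr] := quotient_lim_continuous (Hphi y) (divr_gt0 e0 (ltr0Sn _ 1)).
have [t [tI ty tr]] := itv_clusters_at (lo2_lt_hi2 pB) yI r0.
exists (phi t); split.
- by exists t => //; apply/edomP; exists p => //; move: tI; rewrite /= in_itv.
- by apply: contra_neq ty => E; rewrite -[t]phiK E phiK.
by apply: le_lt_trans (Hr t I tr) _; lra.
Qed.

Lemma chart_first p y : p \in transitions g -> lo2 p <= y <= hi2 p ->
  derive_on D' F (phi y) = chart_derive p (emap g y).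
Proof.
move=> pB yI; apply: derive_onE; first exact: chart_clusters_at pB yI.
have [r r0 Hr] := chart_local pB yI.
apply: (quotient_lim_local (D' := D'' p) r0) => //.
have Q := quotient_lim_comp (D' := setT) (fun _ _ => I) (chart_inner_derive pB yI) (Hphi _).
by move: Q; rewrite /= phiK /chart_derive (br_can br pB yI).
Qed.

Lemma chart_derive_flat p z : p \in transitions g -> lo p.2 <= z <= hi p.2 ->
  Psi' h W p z = 0 -> quotient_lim (Dom p) (chart_derive p) z 0.
Proof.
move=> pB zI psi0; have [hd hd2 _ _ nz] := branch_C2 diffeo pB.
have Q1 := quotient_lim_expR (quotient_lim_sub (@subsetT _ (Dom p)) (Hu z)).
have Q2 := quotient_limV (hd2 z zI) (nz z zI).
have Q3 := quotient_lim_expR (quotient_limN (quotient_lim_comp (D' := setT) (fun _ _ => I) (hd z zI) (Hu _))).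
have := quotient_limM Q1 (quotient_limM Q2 Q3); rewrite /= => Q.
rewrite (_ : 0 = expR (u z) * W z * ((d p z)^-1 * expR (- u (h p z))) +
   expR (u z) * (- (d p z ^+ 2)^-1 * branch_derive2 h p z * expR (- u (h p z)) +
   (d p z)^-1 * (expR (- u (h p z)) * - (W (h p z) * d p z)))) //.
rewrite (_ : _ + _ = expR (u z) * ((d p z)^-1 * expR (- u (h p z))) * Psi' h W p z).
  by rewrite psi0 mulr0.
by rewrite /Psi'; field; exact: nz.
Qed.

Lemma chart_second p y : p \in transitions g -> lo2 p <= y <= hi2 p ->
  Psi' h W p (emap g y) = 0 -> derive_n_on D' 2 F (phi y) = 0.
Proof.
move=> pB yI psi0; apply: derive_onE; first exact: chart_clusters_at pB yI.
have [r r0 Hr] := chart_local pB yI.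
apply: (quotient_lim_local (D' := D'' p) r0) => //.
have zI := br_emap_in br pB yI.
apply: (@quotient_lim_eq _ _ (chart_derive p \o (emap g \o psi)) _ _ _ 1) => //.
- by split; [exists y => //; apply/edomP; exists p|rewrite phiK].
- move=> t [[x _ tE] tI] _ /=; rewrite -tE phiK in tI *; by rewrite (chart_first pB tI).
have flat := chart_derive_flat pB zI psi0.
rewrite -[X in quotient_lim _ _ _ X](mul0r ((d p (emap g y))^-1 * expR (- u y))).
apply: (quotient_lim_comp (D' := Dom p)); last by rewrite /= phiK.
- by move=> t [_ tI]; rewrite /= in_itv; exact: (br_emap_in br pB).
- exact: chart_inner_derive.
Qed.

End Chart.

(** Any selection [P] works: without a twist, [Psi'] vanishes over [K] for every edge, and the chart
    built from the selected branches makes the second derivative vanish on the image of [K]. *)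
Lemma nonaffine_twisted : non_essentially_affine g ->
  exists P, (forall a, edge (P a) a) /\ twisted h L P.
Proof.
move=> naff; have [P edgeP] := predecessors; exists P; split=> //.
apply: contrapT => ntw; apply: naff.
have [W [c [M [cW Wc WM Weq]]]] := derivative_field br diffeo edgeP.
have [B HB] := bounded_support cW Wc WM.
have [u [phi [psi [Hu Hphi Hpsi phiK Cdiff]]]] := coordinates_exist cW Wc WM.
exists phi, psi; split=> // _ [y Ky <-].
have [p pB yI] := cantor_edom Ky.
apply: (chart_second Hu Hphi Hpsi phiK pB yI).
apply: contrapT => /eqP psi0; apply: ntw.
apply: (Psi'_twisted br diffeo edgeP Hu HB Weq pB _ _ psi0); first exact: cantor_emap.
exact: (br_emap_in br pB).
Qed.

End NonAffine.

(** * The dimension formula *)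

Section DimensionOfCantorSets.
Variable R : realType.

Lemma hausdorff_dim_ge0 (E : set R) : (0 <= hausdorff_dim E)%E.
Proof. by apply: le_ereal_inf_tmp => _ [t [t0 _] <-]; rewrite lee_fin. Qed.

Lemma compact_sub_interval (E : set R) : compact E -> exists a b, E `<=` `[a, b].
Proof.
move=> /compact_bounded[M [_ HM]]; exists (- (M + 1)), (M + 1) => x Ex.
have M1 : M < M + 1 by rewrite ltrDl.
by have := HM _ M1 x Ex; rewrite /= in_itv /= -ler_norml.
Qed.

Lemma sum_scaled_compact (E E' : set R) s : compact E -> compact E' -> compact (sum_scaled E s E').
Proof.
move=> cE cE'; rewrite (_ : sum_scaled E s E' = (fun p : R * R => p.1 + s * p.2) @` (E `*` E')).
  apply: continuous_compact; last exact: compact_setX.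
  apply: continuous_subspaceT => p; apply: cvgD; first exact: cvg_fst.
  by apply: cvgM; [exact: cvg_cst|exact: cvg_snd].
apply/seteqP; split=> z.
  by move=> [x Ex [y Ey <-]]; exists (x, y).
by move=> [[x y] [/= Ex Ey] <-]; exists x => //; exists y.
Qed.

(** Branching is available at every exponent strictly below the box dimension and bounds the
    Hausdorff dimension below, so the two agree. The factor [t < 1] keeps the exponent strict;
    dimension 0 uses [branching_zero]. *)
Lemma cantor_dimensions (r : \bar R) (g : expanding_map r) h L o lam H0 al :
  branches (g := g) h L o lam H0 al -> exists D : R, [/\ 0 <= D,
    upper_box_dim (cantor_set g) = D%:E, hausdorff_dim (cantor_set g) = D%:E &
    forall a t, 0 < t < 1 -> branching (lo (e := g) a) (hi (e := g) a) (loops h o a) (t * D)].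
Proof.
move=> br; have /card_gt0P[a _] := alphabet_nonempty g.
have cK := cantor_compact br; have [x0 Kx0 _] := cantor_nonempty br a.
have K0 : cantor_set g !=set0 by exists x0.
have [l [b Kb]] := compact_sub_interval cK.
have u1 := upper_box_dim_le1 Kb; have u0 := upper_box_dim_ge0 K0.
have hu := hausdorff_dim_le_upper_box_dim K0; have h0 := hausdorff_dim_ge0 (cantor_set g).
have [D DE] : exists D : R, upper_box_dim (cantor_set g) = D%:E.
  by case: (upper_box_dim _) u0 u1 => [D||] //; exists D.
have [D1 D1E] : exists D1 : R, hausdorff_dim (cantor_set g) = D1%:E.
  by move: hu h0; rewrite DE; case: (hausdorff_dim _) => [D1||] //; exists D1.
rewrite DE D1E in hu u0 u1 h0; rewrite !lee_fin in hu u0 u1 h0.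
have br_lt d : 0 < d -> d < D -> forall c, branching (lo (e := g) c) (hi (e := g) c) (loops h o c) d.
  by move=> d0 dD c; apply: (branching_loops br c d0); rewrite DE lte_fin.
exists D; split=> //.
- rewrite D1E; congr EFin; apply/eqP; rewrite eq_le hu /= leNgt; apply/negP => lt.
  have d0 : 0 < (D1 + D) / 2 by lra.
  have dD : (D1 + D) / 2 < D by lra.
  have := hausdorff_dim_system_ge (loops_csystem br a) d0 (br_lt _ d0 dD a) cK (@subIsetl _ _ _).
  by rewrite D1E lee_fin; lra.
move=> c t /andP[t0 t1]; have [->|D0] := eqVneq D 0; first by rewrite mulr0; exact: branching_zero br c.
have Dp : 0 < D by rewrite lt0r D0.
by apply: br_lt; rewrite ?mulr_gt0// gtr_pMl.
Qed.

Lemma cantor_sum_ge (r r' : \bar R) (g : expanding_map r) (g' : expanding_map r')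
    h L o lam H0 al h' L' o' lam' H0' al' a a' d d' e s :
  branches (g := g) h L o lam H0 al -> branches (g := g') h' L' o' lam' H0' al' ->
  0 <= d -> 0 <= d' -> 0 < e -> e < d + d' -> d + d' < 1 -> s != 0 ->
  branching (lo (e := g) a) (hi (e := g) a) (loops h o a) d ->
  branching (lo (e := g') a') (hi (e := g') a') (loops h' o' a') d' ->
  toggling (lo (e := g) a) (hi (e := g) a) (loops h o a) ->
  (e%:E <= hausdorff_dim (sum_scaled (cantor_set g) s (cantor_set g')))%E.
Proof.
move=> br br' d0 d'0 e0 ed dd s0 b b' tog.
have cE := sum_scaled_compact (s := s) (cantor_compact br) (cantor_compact br').
have S := loops_csystem br a; have S' := loops_csystem br' a'.
(* For negative [s] the second system is reflected. *)
have [sp|sn|se] := ltgtP s 0; last by rewrite se eqxx in s0.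
  have sp' : 0 < - s by rewrite oppr_gt0.
  apply: (hausdorff_dim_sum_ge S (csystem_opp S') d0 d'0 e0 ed dd sp' b (branching_opp b') tog cE).
  move=> _ [x [Kx _] [_ [y [Ky _] <-] <-]]; rewrite mulrNN.
  by exists x => //; exists y.
apply: (hausdorff_dim_sum_ge S S' d0 d'0 e0 ed dd sn b b' tog cE).
by move=> _ [x [Kx _] [y [Ky _] <-]]; exists x => //; exists y.
Qed.

End DimensionOfCantorSets.

Theorem mainTheorem2 (R : realType) (r' : \bar R) (hr' : (1 < r')%E)
    (g : expanding_map (2%:E : \bar R)) (hg : non_essentially_affine g)
    (g' : expanding_map r') (s : R) (hs : s != 0) :
  let K := cantor_set g in
  let K' := cantor_set g' in
  hausdorff_dim (sum_scaled K s K') = upper_box_dim (sum_scaled K s K') /\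
  upper_box_dim (sum_scaled K s K') =
    Order.min 1%E (hausdorff_dim K + hausdorff_dim K')%E.
Proof.
move=> K K'.
have [h [lam [H0 [al [br diffeo]]]]] := branches_exist g (@gt12 R).
have [h' [lam' [H0' [al' [br' _]]]]] := branches_exist g' hr'.
have [P [edgeP tw]] := nonaffine_twisted br diffeo hg.
have /card_gt0P[a _] := alphabet_nonempty g; have /card_gt0P[a' _] := alphabet_nonempty g'.
have tog := toggling_loops br edgeP a tw.
have [D [D0 uD hD bD]] := cantor_dimensions br.
have [D' [D'0 uD' hD' bD']] := cantor_dimensions br'.
have cE := sum_scaled_compact (s := s) (cantor_compact br) (cantor_compact br').
have [x Kx _] := cantor_nonempty br a; have [x' Kx' _] := cantor_nonempty br' a'.
have E0 : sum_scaled K s K' !=set0 by exists (x + s * x'), x => //; exists x'.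
have [l [b Eb]] := compact_sub_interval cE.
have u1 := upper_box_dim_le1 Eb.
have hu := hausdorff_dim_le_upper_box_dim E0.
rewrite hD hD' -EFinD -EFin_min.
set m := Num.min 1 (D + D').
have um : (upper_box_dim (sum_scaled K s K') <= m%:E)%E.
  rewrite /m EFin_min le_min u1 /=; apply/lee_addgt0Pr => e e0.
  have e20 : 0 < e / 2 by rewrite divr_gt0.
  have := @upper_box_dim_sum_scaled R K K' s (D + e / 2) (D' + e / 2) hs.
  rewrite uD uD' !lte_fin !ltrDl e20 => /(_ isT isT); rewrite -EFinD.
  by rewrite (_ : D + e / 2 + (D' + e / 2) = D + D' + e)//; field.
have mh : (m%:E <= hausdorff_dim (sum_scaled K s K'))%E.
  apply/lee_addgt0Pr => e e0.
  (* If [m <= e] the bound is trivial; otherwise [D + D'] is positive and can be divided by. *)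
  have [me|em] := leP m e.
    by apply: (@le_trans _ _ e%:E); rewrite ?lee_fin// leeDr// hausdorff_dim_ge0.
  have m1 : m <= 1 by rewrite ge_min lexx.
  have mD : m <= D + D' by rewrite ge_min lexx orbT.
  (* Both dimensions are lowered in the same proportion, so that their sum [m - e / 2] is less than
     1 and still exceeds [m - e]. *)
  pose t := (m - e / 2) / (D + D'); have DD : 0 < D + D' by lra.
  have t01 : 0 < t < 1 by rewrite divr_gt0 ?ltr_pdivrMr ?mul1r//=; lra.
  have tD : t * D + t * D' = m - e / 2 by rewrite -mulrDr divfK ?gt_eqF.
  have t0 : 0 <= t by case/andP: t01 => /ltW.
  rewrite -leeBlDr// -EFinB.
  have me0 : 0 < m - e by rewrite subr_gt0.
  have d1 : m - e < t * D + t * D' by rewrite tD; lra.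
  have d2 : t * D + t * D' < 1 by rewrite tD; lra.
  exact: (cantor_sum_ge br br' (mulr_ge0 t0 D0) (mulr_ge0 t0 D'0) me0 d1 d2 hs
    (bD a t t01) (bD' a' t t01) tog).
have E1 : upper_box_dim (sum_scaled K s K') = m%:E.
  by apply/le_anti; rewrite um (le_trans mh hu).
by split=> //; apply/le_anti; rewrite hu E1 mh.
Qed.
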